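(* Let $D\subset\mathbb{R}^2$ be a bounded strictly convex domain whose boundary $\Gamma$ is $C^2$ with nowhere null curvature. Then there exists $k>0$ such that, for every $0<\epsilon<\pi/2$, if $n>2+\frac{k}{\epsilon^2}$, there exists $b=b(\epsilon)>0$ such that the density $p^n_\epsilon$ of the $n$-step transition kernel $P^n_\epsilon$ of the stochastically perturbed billiard in $D$ satisfies $$p^n_\epsilon(x,y)>b\qquad\text{for all }x,y\in M.$$
   Context: Strict convexity means $\Gamma$ contains no line segment. Let $|\Gamma|$ be the length of $\Gamma$, parametrized by arc length $s$ (taken modulo $|\Gamma|$) and positively oriented. The phase space is the compact cylinder $M=\{(s,\theta):0\le s<|\Gamma|,\ 0\le\theta\le\pi\}$. A point $(s,\theta)$ represents the boundary point $q\in\Gamma$ with parameter $s$ together with the unit vector $v$ pointing into $D$ (or tangent to $\Gamma$) that makes angle $\theta$ with the oriented tangent line to $\Gamma$ at $q$. For $x\in M$, write $s(x),\theta(x)$ for its coordinates. Deterministic billiard map $T:M\to M$: for $x=(s,\theta)$ with $0<\theta<\pi$, representing $(q_0,v_0)$, let $q_1$ be the next point where the oriented line through $q_0$ with direction $v_0$ hits $\Gamma$, and let $v_1=v_0-2\langle n(q_1),v_0\rangle n(q_1)$, where $n(q_1)$ is the inward unit normal at $q_1$. Then $Tx$ is the point of $M$ representing $(q_1,v_1)$. For $\theta\in\{0,\pi\}$, $Tx=x$. For $\theta\in[0,\pi]$ put $\theta^\epsilon=\min\{\max(\theta,\epsilon),\pi-\epsilon\}$. For $x=(s,\theta)\in M$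 and Borel $A\subset M$ let $$Q^\epsilon_x(A)=\int_{\theta^\epsilon-\epsilon}^{\theta^\epsilon+\epsilon}\mathbf{1}_A(s,u)\,\frac{1}{2\epsilon}\,du,\qquad P_\epsilon(x,A)=Q^\epsilon_{Tx}(A).$$ The powers are $P_\epsilon^1=P_\epsilon$ and $P^{n+1}_\epsilon(x,A)=\int_M P_\epsilon(x,dy)P^n_\epsilon(y,A)$. For $n\ge2$, $p^n_\epsilon(x,\cdot)$ is the density of $P^n_\epsilon(x,\cdot)$ with respect to Lebesgue measure $dy=ds\,d\theta$ on $M$, that is, $P^n_\epsilon(x,A)=\int_A p^n_\epsilon(x,y)\,dy$. The version is fixed as follows. Let $Tx=(s_1,\theta_1)$. For $s'\ne s_1$ let $\theta'=\theta'(s_1,s')\in(0,\pi)$ be the unique angle with $s(T(s_1,\theta'))=s'$, and let $\theta_1'=\theta(T(s_1,\theta'))$. Then $$p^2_\epsilon(x,(s',\theta))=\frac{1}{4\epsilon^2}\left|\frac{\partial\theta'}{\partial s'}\right|\mathbf{1}_{\{|\theta'-\theta_1^\epsilon|\le\epsilon\}}\mathbf{1}_{\{|\theta-(\theta_1')^\epsilon|\le\epsilon\}},$$ with value $0$ when $s'=s_1$. For $n\ge2$, $p^{n+1}_\epsilon(x,y)=\int_M P_\epsilon(x,dz)\,p^n_\epsilon(z,y)$. *)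

(* Defs.v *)
From HB Require Import structures.
From mathcomp Require Import all_boot all_order all_algebra.
From mathcomp Require Import all_classical all_reals all_analysis.
From mathcomp Require Import measurable_realfun lra.
Set Implicit Arguments.
Unset Strict Implicit.
Unset Printing Implicit Defensive.
Import Order.TTheory GRing.Theory Num.Theory.
Import numFieldNormedType.Exports.
Local Open Scope classical_set_scope.
Local Open Scope ring_scope.

Section billiard.
Context {R : realType}.

Definition dot (u v : R * R) : R := u.1 * v.1 + u.2 * v.2.

Definition rot90 (u : R * R) : R * R := (- u.2, u.1).

Definition boundary (D : set (R * R)) : set (R * R) := closure D `\` interior D.

Definition contains_segment (C : set (R * R)) : Prop :=
  exists a b : R * R, a <> b /\
    forall t : R, 0 <= t <= 1 -> C ((1 - t) *: a + t *: b).

Definition bounded_strictly_convex_domain (D : set (R * R)) : Prop :=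
  [/\ D !=set0, open D, bounded_set D, convex_set D &
      ~ contains_segment (boundary D)].

Definition C2_curve (g : R -> R * R) : Prop :=
  [/\ forall s, derivable g s 1,
      forall s, derivable (derive1 g) s 1 &
      continuous (derive1n 2 g)].

(* [g] is the arc-length parametrization of the boundary of [D], as an
   [L]-periodic map on the line, so that [L] is the length of the boundary.
   The last clause is positive orientation: [D] lies to the left of [g]. *)
Definition C2_arclength_boundary (D : set (R * R)) (L : R) (g : R -> R * R)
    : Prop :=
  0 < L /\
  C2_curve g /\
  (forall s, dot (derive1 g s) (derive1 g s) = 1) /\
  (forall s, g (s + L) = g s) /\
  (forall s s', 0 <= s < L -> 0 <= s' < L -> g s = g s' -> s = s') /\
  range g = boundary D /\
  (forall s, \forall t \near 0^'+, D (g s + t *: rot90 (derive1 g s))).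

(* Signed curvature, for a unit-speed curve. *)
Definition curvature (g : R -> R * R) (s : R) : R :=
  dot (rot90 (derive1 g s)) (derive1n 2 g s).

Definition phase (L : R) : set (R * R) :=
  [set x | 0 <= x.1 < L /\ 0 <= x.2 <= pi].

(* Inward because of positive orientation. *)
Definition inward_normal (g : R -> R * R) (s : R) : R * R := rot90 (derive1 g s).

Definition direction (g : R -> R * R) (x : R * R) : R * R :=
  cos x.2 *: derive1 g x.1 + sin x.2 *: inward_normal g x.1.

(* [y] represents [(q1, v1)], where [q1] is the first point, strictly after
   [g x.1], at which the oriented line meets the curve. *)
Definition billiard_step (L : R) (g : R -> R * R) (x y : R * R) : Prop :=
  let v0 := direction g x in
  let n1 := inward_normal g y.1 in
  [/\ phase L y,
      exists t : R, [/\ 0 < t, g y.1 = g x.1 + t *: v0 &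
        forall t', 0 < t' < t -> ~ range g (g x.1 + t' *: v0)] &
      direction g y = v0 - (2 * dot n1 v0) *: n1].

(* Grazing vectors are fixed; the choice by [xget] is that of a unique point. *)
Definition billiard_map (L : R) (g : R -> R * R) (x : R * R) : R * R :=
  if 0 < x.2 < pi then xget x [set y | billiard_step L g x y] else x.

Definition trunc_angle (e a : R) : R := Num.min (Num.max a e) (pi - e).

Definition Q_eps (e : R) (x : R * R) (A : set (R * R)) : \bar R :=
  (\int[lebesgue_measure]_(u in
      `[(trunc_angle e x.2 - e)%R, (trunc_angle e x.2 + e)%R])
    (\1_A (x.1, u) * (2 * e)^-1)%:E)%E.

Local Lemma Q_eps0 (e : R) (x : R * R) : Q_eps e x set0 = 0%E.
Proof.
rewrite /Q_eps; under eq_integral do rewrite indic0 mul0r.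
exact: integral0.
Qed.

Local Lemma Q_eps_ge0 (e : R) (x : R * R) (A : set (R * R)) : (0 <= Q_eps e x A)%E.
Proof.
apply: integral_ge0 => u; rewrite /= in_itv/= => /andP[u1 u2].
rewrite lee_fin mulr_ge0// invr_ge0.
by move: (le_trans u1 u2); lra.
Qed.

Local Lemma Q_eps_sigma_additive (e : R) (x : R * R) : semi_sigma_additive (Q_eps e x).
Proof.
move=> F mF tF mUF.
suff -> : Q_eps e x (\bigcup_n F n) = (\sum_(n <oo) Q_eps e x (F n))%E.
  by apply: is_cvg_ereal_nneg_natsum => n _; exact: Q_eps_ge0.
have mI : measurable_fun setT (fun u : R => (x.1, u)).
  exact: pair1_measurable.
rewrite /Q_eps -integral_nneseries//=.
- apply: eq_integral => u; rewrite inE/= in_itv/= => /andP[u1 u2].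
  have e0 : 0 <= (2 * e)^-1 by rewrite invr_ge0; move: (le_trans u1 u2); lra.
  rewrite EFinM indic_bigcup// muleC -nneseriesZl//.
  by apply: eq_eseriesr => n _; rewrite EFinM muleC.
- move=> n; apply/measurable_EFinP/measurable_funM => //.
  apply/measurable_funTS; apply: (measurableT_comp _ mI).
  exact: measurable_indic.
- move=> n u; rewrite /= in_itv/= => /andP[u1 u2].
  by rewrite lee_fin mulr_ge0// invr_ge0; move: (le_trans u1 u2); lra.
Qed.

HB.instance Definition _ (e : R) (x : R * R) :=
  isMeasure.Build _ _ _ (Q_eps e x)
    (Q_eps0 e x) (Q_eps_ge0 e x) (@Q_eps_sigma_additive e x).

Definition P_eps (L : R) (g : R -> R * R) (e : R) (x : R * R) :
    {measure set (R * R) -> \bar R} := Q_eps e (billiard_map L g x).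

Definition eq_param (L a b : R) : Prop := exists m : int, a = b + m%:~R * L.

(* Defined for every real [s'], not only for [0 <= s' < L], so that the
   two-sided derivative in [s'] also makes sense at [s' = 0]. *)
Definition angle_to (L : R) (g : R -> R * R) (s1 s' : R) : R :=
  xget 0 [set a | 0 < a < pi /\ eq_param L (billiard_map L g (s1, a)).1 s'].

(* Two-step density: the first noise is the jump to angle [a'], from which the
   billiard reaches position [y.1]; its law is transported to the position
   variable by the Jacobian of [angle_to]. *)
Definition density2 (L : R) (g : R -> R * R) (e : R) (x y : R * R) : \bar R :=
  let: (s1, a1) := billiard_map L g x in
  let a' := angle_to L g s1 y.1 in
  let a1' := (billiard_map L g (s1, a')).2 in
  if y.1 == s1 then 0%E else
  ((4 * e ^+ 2)^-1 * `|derive1 (angle_to L g s1) y.1|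
    * (`|a' - trunc_angle e a1| <= e)%R%:R
    * (`|y.2 - trunc_angle e a1'| <= e)%R%:R)%:E.

(* For [2 <= n], the everywhere-defined version of the Lebesgue density of the
   [n]-step transition kernel, determined by its two-step value and by
   [p^(n+1) x y = \int P_eps(x, dz) p^n z y]; junk for [n < 2]. *)
Definition density (L : R) (g : R -> R * R) (e : R) (n : nat) :
    R * R -> R * R -> \bar R :=
  iter (n - 2)
    (fun p x y => (\int[P_eps L g e x]_(z in phase L) p z y)%E)
    (density2 L g e).

End billiard.

(* Main.v *)
Require Import Defs.
From HB Require Import structures.
From mathcomp Require Import all_boot all_order all_algebra.
From mathcomp Require Import all_classical all_reals all_analysis.
From mathcomp Require Import measurable_realfun ring lra zify.
Set Implicit Arguments.
Unset Strict Implicit.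
Unset Printing Implicit Defensive.
Import Order.TTheory GRing.Theory Num.Theory.
Import numFieldNormedType.Exports HBNNSimple.
Local Open Scope classical_set_scope.
Local Open Scope ring_scope.

(** A trajectory of the perturbed billiard is a sequence of boundary points [s 0],
    [s 1], [s 2] and so on. Let [ph s t] be the angle at [s] between the tangent and
    the chord to [t]. Specular reflection at [s n] reads
    [ph (s n) (s n.+1) + ph (s n) (s n.-1) = pi], and the noise allows an error of [e]
    in it. If the points can be chosen with room to spare, each of them may
    be moved along a short stretch of boundary; since [ph s] increases at a
    positive speed, each stretch contributes a positive factor to the iterated
    integral that defines the density ([density_hop], [density_last]). It thus suffices
    to join any two states by about [1 / e ^+ 2] chords, with a margin that does not
    depend on the states. The boundary is cut into [N] arcs of length [h], and between
    the two given states only chords between the end points of these arcs (nodes) are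
    used, under the noise [e / 2]; the grid being finite, the margin is uniform.

    Sets of chords are measured with [sin ph ds dph], which the billiard preserves.
    In terms of the two ends of a chord this is the mixed second derivative of its
    length, and [weight] is the corresponding second difference over two arcs. It is
    symmetric, and by the mean value theorem ([grid_mvt]) its row [i] consists of [h]
    times the increments of [- cos] over the intervals of directions that the arcs
    occupy, seen from a point of arc [i]. Let [B] be the set of the chords that end a
    chain issued from a given state. Its mass grows for two reasons.

    - At one point ([fattening]). If [I] is the set of incoming directions and [O] the
      set of the directions that are [e]-close to a reflection of [I], then the mass of
      [O] exceeds that of [I] by a multiple of [e] times the mass of [I] or times that of
      the complement of [O]. Indeed the complement of [O], the reflection of [I] and
      an empty gap of length of order [e] fit side by side in a half turn
      ([packing]), and the gap can be taken where it outweighs [e] times everything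
      between it and the nearest grazing direction, because [sin] increases up to
      [pi / 2] ([cap_gap]).

    - Globally ([flow_mixing]). [B] cannot be nearly full or nearly empty at every node:
      any two nodes have positive weights to a whole common arc ([grid_mixing]), so a
      set of mass [m] in a total of [Wt] leaves an imbalance of order [m * (Wt - m)],
      among outgoing or among incoming chords.

    Together they give a logistic growth [m n.+2 >= m n + c * e * m n.+1 * (Wt - m n.+1)]
    up to losses that vanish with [h] ([mass_growth]). The first chords
    already have mass of order [e ^+ 4] ([start_mass]), hence after [8 * r] steps, with
    [r] of order [1 / e ^+ 2], more than half of the total is reached
    ([logistic_escape], [escape_time]). Do this from the state [x], and from [y] with
    time reversed: the two sets of chords, one of them reversed, must meet
    ([masses_meet]), and the two chains make a chain from [x] to [y] ([chain_join]).
    Once the density of some step is bounded below, so are all the later ones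
    ([density_ge_persists]). *)

(** * Supporting lines of a strictly convex domain *)

Lemma is_derive_quotientP {R : realType} (V : normedModType R) (f : R -> V) (s : R) (l : V) :
  is_derive s 1 f l <-> h^-1 *: (f (s + h) - f s) @[h --> 0^'] --> l.
Proof.
have E : (fun h : R => h^-1 *: (f (s + h) - f s)) =
         (fun h : R => h^-1 *: (((f \o shift s) (h *: 1)) - f s)).
  by apply/funext => h /=; rewrite /shift/= scaler1 [s + _]addrC.
split=> [[df dE]|H].
  rewrite E -dE.
  by have /cvg_ex[l' Hl'] := df; rewrite /derive (cvg_lim _ Hl').
apply: DeriveDef.
  by apply/cvg_ex; exists l; rewrite /= -E.
by rewrite /derive -E; exact: cvg_lim.
Qed.

Lemma is_derive_fst {R : realType} (g : R -> R * R) (s : R) (l : R * R) :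
  is_derive s 1 g l -> is_derive s 1 (fun t => (g t).1) l.1.
Proof.
move=> /is_derive_quotientP H; apply/is_derive_quotientP.
exact: (cvg_comp _ _ H (@cvg_fst _ _ _ _ _)).
Qed.

Lemma is_derive_snd {R : realType} (g : R -> R * R) (s : R) (l : R * R) :
  is_derive s 1 g l -> is_derive s 1 (fun t => (g t).2) l.2.
Proof.
move=> /is_derive_quotientP H; apply/is_derive_quotientP.
exact: (cvg_comp _ _ H (@cvg_snd _ _ _ _ _)).
Qed.

Lemma is_derive_near {R : realType} (F : R -> R) (l e : R) :
  is_derive (0 : R) 1 F l -> 0 < e ->
  \forall h \near 0^'+, `|F h - F 0 - h * l| < e * h.
Proof.
move=> /is_derive_quotientP H e0.
have /cvgrPdist_lt /(_ e e0) : h^-1 *: (F (0 + h) - F 0) @[h --> 0^'+] --> l.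
  exact: cvg_dnbhs_at_right.
apply: filterS2 (nbhs_right_gt 0) => h h0.
rewrite add0r /GRing.scale/= => {}H.
have -> : F h - F 0 - h * l = - (l - h^-1 * (F h - F 0)) * h by field; lra.
by rewrite normrM normrN (gtr0_norm h0) ltr_pM2r.
Qed.

Section convexity.
Context {R : realType} (D : set (R * R)).
Hypotheses (oD : open D) (cD : convex_set D).

Lemma convex_mem (a b : R * R) (t : R) : D a -> D b -> 0 <= t <= 1 ->
  D (t *: a + (1 - t) *: b).
Proof.
move=> Da Db /andP[t0 t1].
have := @cD a b (Itv01 t0 t1); rewrite !inE; exact.
Qed.

Lemma open_box (a : R * R) : D a -> exists2 e : R, 0 < e &
  forall b : R * R, `|b.1 - a.1| < e -> `|b.2 - a.2| < e -> D b.
Proof.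
move=> Da; have /nbhs_ballP[e /= e0 He] := open_nbhs_nbhs (conj oD Da).
exists e => // b b1 b2; apply: He; split => /=; rewrite /ball/= distrC//.
Qed.

Lemma closure_box (p : R * R) (e : R) : closure D p -> 0 < e ->
  exists2 q : R * R, D q & `|p.1 - q.1| < e /\ `|p.2 - q.2| < e.
Proof.
move=> cp e0; have [q [Dq [q1 q2]]] := cp _ (nbhsx_ballx p e e0).
by exists q.
Qed.

(** [p] is approached by points [q] of [D], and the error [p - q] is compensated by
    moving [a] inside the open set [D]. *)
Lemma closure_mix (p a : R * R) (t : R) : closure D p -> D a -> 0 < t <= 1 ->
  D (p + t *: (a - p)).
Proof.
move=> cp Da /andP[t0 t1]; have [e e0 He] := open_box Da.
have [||q Dq [q1 q2]] := @closure_box p (e * t); rewrite ?mulr_gt0//.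
have D' : D (a + ((1 - t) / t) *: (p - q)).
  have aux x : `|x| < e * t -> `|(1 - t) / t * x| < e.
    move=> hx; rewrite mulrAC normrM normfV (gtr0_norm t0) ltr_pdivrMr//.
    apply: le_lt_trans hx; rewrite normrM ger0_norm ?subr_ge0//.
    by rewrite ler_piMl//; lra.
  by apply: He; rewrite /= [_ + _ - _]addrC addKr; exact: aux.
have := convex_mem D' Dq (_ : 0 <= t <= 1).
rewrite (ltW t0) t1 => /(_ isT).
congr (D _); apply: injective_projections => /=; rewrite /GRing.scale/=; field; lra.
Qed.

(** A point of the cone that [a] and [z] span at [p] is on the segment from [p] to
    some point between [a] and [z]. *)
Lemma closure_cone (p a z : R * R) (al be : R) : closure D p -> D a -> D z ->
  0 < al -> 0 < be -> al + be <= 1 ->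
  D (p + al *: (a - p) + be *: (z - p)).
Proof.
move=> cp Da Dz a0 b0 ab.
have Dm : D ((al / (al + be)) *: a + (1 - al / (al + be)) *: z).
  apply: convex_mem => //; apply/andP; split.
    by rewrite divr_ge0 ?addr_ge0 ?ltW.
  by rewrite ler_pdivrMr ?addr_gt0// mul1r lerDl ltW.
have := closure_mix cp Dm (_ : 0 < al + be <= 1).
rewrite ab addr_gt0// => /(_ isT).
congr (D _); apply: injective_projections => /=; rewrite /GRing.scale/=; field; lra.
Qed.

End convexity.

Definition cross {R : realType} (u v : R * R) : R := u.1 * v.2 - u.2 * v.1.

Lemma unit_coord_le1 {R : realType} (u : R * R) :
  dot u u = 1 -> `|u.1| <= 1 /\ `|u.2| <= 1.
Proof. by rewrite /dot !ler_norml => uu; split; apply/andP; split; nra. Qed.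

Section support.
Context {R : realType} (D : set (R * R)) (L : R) (g : R -> R * R).
Hypotheses (hD : bounded_strictly_convex_domain D)
           (hg : C2_arclength_boundary D L g).

Lemma curve_is_derive (s : R) : is_derive s 1 g (derive1 g s).
Proof.
have [_ [[dg _ _] _]] := hg; rewrite derive1E; exact: derivableP.
Qed.

Lemma curve_closure s : closure D (g s).
Proof.
have [_ [_ [_ [_ [_ [rg _]]]]]] := hg.
by have : range g (g s); [exists s | rewrite rg => -[]].
Qed.

Lemma curve_notin s : ~ D (g s).
Proof.
have [_ oD _ _ _] := hD; have [_ [_ [_ [_ [_ [rg _]]]]]] := hg.
move=> Dg; have : range g (g s) by exists s.
by rewrite rg => -[_]; apply; rewrite ((interior_id D).1 oD).
Qed.

(** If [z] were strictly to the right of the tangent at [g s], the cone spanned at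
    [g s] by an inward point and by points near [z] would contain the points of the
    curve next to [g s], and these are not in [D]. *)
Lemma support_line s z : D z -> 0 <= cross (derive1 g s) (z - g s).
Proof.
have [_ oD _ cD _] := hD; have [_ [_ [u1 [_ [_ [_ inw]]]]]] := hg.
move=> Dz; rewrite leNgt; apply/negP => zneg.
have [t0 t0p Da] : exists2 t0 : R, 0 < t0 & D (g s + t0 *: rot90 (derive1 g s)).
  have := inw s => inws.
  near (0 : R)^'+ => t; exists t; first by near: t; exact: nbhs_right_gt.
  by near: t.
set u := derive1 g s in zneg Da *; set p := g s in zneg Da *.
set zx := dot u (z - p); set zy := cross u (z - p) in zneg *.
have [e e0 He] := open_box oD Dz.
have dcomp (F : R -> R) (dF : R) : is_derive s 1 F dF ->
    is_derive (0 : R) 1 (fun h => F (s + h * zx)) (dF * zx).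
  move=> H; have := @is_derive1_comp R F (fun h => s + h * zx) 0 dF zx; apply.
    by rewrite mul0r addr0.
  by apply: is_derive_eq; rewrite scaler0 !add0r mul1r /GRing.scale/= mulr1.
have d1 := dcomp _ _ (is_derive_fst (curve_is_derive s)).
have d2 := dcomp _ _ (is_derive_snd (curve_is_derive s)).
have n1 := is_derive_near d1 e0; have n2 := is_derive_near d2 e0.
pose al := - zy / t0.
have al0 : 0 < al by rewrite divr_gt0// oppr_gt0.
(* the point of parameter [s + h * zx] is in the cone, for small [h] *)
near (0 : R)^'+ => h.
have h0 : 0 < h by near: h; exact: nbhs_right_gt.
have h1 : h * (al + 1) <= 1.
  rewrite -ler_pdivlMr ?addr_gt0//; near: h; apply: nbhs_right_le.
  by rewrite divr_gt0// addr_gt0.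
have : D (g (s + h * zx)); last exact: curve_notin.
have Dz' : D (z + h^-1 *: (g (s + h * zx) - p) - zx *: u).
  have aux (x y l : R) : `|x - y - h * l| < e * h -> h^-1 * (x - y) - l = (x - y - h * l) / h.
    by move=> _; field; lra.
  have sh (w a b : R) : w + a - b - w = a - b by ring.
  apply: He => /=; rewrite sh /GRing.scale/=.
    rewrite [zx * _]mulrC; have H : `|(g (s + h * zx)).1 - p.1 - h * (u.1 * zx)| < e * h.
      by have : `|(g (s + h * zx)).1 - (g (s + 0 * zx)).1 - h * (u.1 * zx)| < e * h;
       [near: h; exact: n1 | rewrite mul0r addr0].
    by rewrite (aux _ _ _ H) normrM normfV (gtr0_norm h0) ltr_pdivrMr.
  rewrite [zx * _]mulrC; have H : `|(g (s + h * zx)).2 - p.2 - h * (u.2 * zx)| < e * h.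
    by have : `|(g (s + h * zx)).2 - (g (s + 0 * zx)).2 - h * (u.2 * zx)| < e * h;
     [near: h; exact: n2 | rewrite mul0r addr0].
  by rewrite (aux _ _ _ H) normrM normfV (gtr0_norm h0) ltr_pdivrMr.
have := closure_cone oD cD (@curve_closure s) Da Dz' (mulr_gt0 h0 al0) h0.
rewrite -{2}[h]mulr1 -mulrDr => /(_ h1).
have uu : u.1 * u.1 + u.2 * u.2 = 1 := u1 s.
congr (D _); apply: injective_projections => /=; rewrite -/p /GRing.scale/=.
  have -> : z.1 = p.1 + zx * u.1 - zy * u.2.
    have : (z.1 - p.1) * (u.1 * u.1 + u.2 * u.2) = z.1 - p.1 by rewrite uu mulr1.
    by rewrite /zx /zy /dot /cross /=; lra.
  by rewrite /al /rot90/=; field; lra.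
have -> : z.2 = p.2 + zx * u.2 + zy * u.1.
  have : (z.2 - p.2) * (u.1 * u.1 + u.2 * u.2) = z.2 - p.2 by rewrite uu mulr1.
  by rewrite /zx /zy /dot /cross /=; lra.
by rewrite /al /rot90/=; field; lra.
Unshelve. all: by end_near.
Qed.

Lemma tangent_le1 (s : R) : `|(derive1 g s).1| <= 1 /\ `|(derive1 g s).2| <= 1.
Proof.
by have [_ [_ [u1 _]]] := hg; exact: unit_coord_le1.
Qed.

Lemma support_line_closure s z : closure D z ->
  0 <= cross (derive1 g s) (z - g s).
Proof.
move=> cz; rewrite leNgt; apply/negP => zneg.
have [a1 a2] := tangent_le1 s.
have e0 : 0 < - cross (derive1 g s) (z - g s) / 3 by lra.
have [q Dq [q1 q2]] := closure_box cz e0.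
have := support_line s Dq; move: a1 a2 q1 q2 e0.
set u := derive1 g s; set p := g s; rewrite /cross/=.
set e := - _ / 3 => a1 a2 q1 q2 e0 qpos.
have m1 : `|u.1 * (z.2 - q.2)| < e.
  by apply: le_lt_trans q2; rewrite normrM ler_piMl.
have m2 : `|u.2 * (z.1 - q.1)| < e.
  by apply: le_lt_trans q1; rewrite normrM ler_piMl.
move: m1 m2; rewrite !ltr_norml => /andP[m11 m12] /andP[m21 m22].
have ee : u.1 * (z.2 - p.2) - u.2 * (z.1 - p.1) = - (3 * e) by rewrite /e; field.
lra.
Qed.

Lemma support_line_interior s z : D z -> 0 < cross (derive1 g s) (z - g s).
Proof.
have [_ oD _ _ _] := hD; have [_ [_ [u1 _]]] := hg.
move=> Dz; rewrite lt_neqAle (support_line s Dz) andbT eq_sym; apply/eqP => c0.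
have [e e0 He] := open_box oD Dz.
have [a1 a2] := tangent_le1 s.
have Dz' : D (z - (e / 2) *: rot90 (derive1 g s)).
  have sh (w a : R) : w - a - w = - a by ring.
  have e2 : `|e / 2| = e / 2 by rewrite gtr0_norm; lra.
  by apply: He; rewrite /= sh normrN /GRing.scale/= ?mulrN ?normrN normrM e2; nra.
have := support_line s Dz'; have := u1 s; move: c0.
rewrite /cross /dot /rot90/= /GRing.scale/=; nra.
Qed.

(** With two points of the curve on a tangent, the support inequality would keep
    the segment between them out of [D], hence inside the boundary. *)
Lemma chord_cross_gt0 (s t : R) : g s <> g t ->
  0 < cross (derive1 g s) (g t - g s).
Proof.
have [_ oD _ cD noseg] := hD; have [_ [_ [u1 [_ [_ [rg _]]]]]] := hg.
move=> gst; rewrite lt_neqAle support_line_closure ?andbT; last exact: curve_closure.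
rewrite eq_sym; apply/eqP => c0; apply: noseg; exists (g s), (g t); split => // l l01.
rewrite /boundary ((interior_id D).1 oD); split.
  have cC (x y : R * R) : closure D x -> closure D y ->
      closure D ((1 - l) *: x + l *: y).
    move=> cx cy B /nbhs_ballP[e /= e0 He].
    have [p Dp [p1 p2]] := closure_box cx e0; have [q Dq [q1 q2]] := closure_box cy e0.
    exists ((1 - l) *: p + l *: q); split.
      have -> : (1 - l) *: p + l *: q = (1 - l) *: p + (1 - (1 - l)) *: q.
        by congr (_ + _ *: _); ring.
      by apply: convex_mem => //; lra.
    have aux (x1 x2 y1 y2 : R) : `|x1 - x2| < e -> `|y1 - y2| < e ->
        `|(1 - l) * x1 + l * y1 - ((1 - l) * x2 + l * y2)| < e.
      move: l01 => /andP[l0 l1].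
      have mix (a b : R) : 0 < a -> 0 < b -> 0 < (1 - l) * a + l * b.
        by case: (lerP a b); nra.
      rewrite !ltr_norml => /andP[u1' u2'] /andP[v1' v2']; apply/andP; split.
        have := mix (e + (x1 - x2)) (e + (y1 - y2)); lra.
      have := mix (e - (x1 - x2)) (e - (y1 - y2)); lra.
    by apply: He; split => /=; rewrite /ball/=; exact: aux.
  by apply: cC; exact: curve_closure.
move=> /(support_line_interior s).
have -> : (1 - l) *: g s + l *: g t - g s = l *: (g t - g s).
  by apply: injective_projections => /=; rewrite /GRing.scale/=; ring.
have -> : cross (derive1 g s) (l *: (g t - g s)) = l * cross (derive1 g s) (g t - g s).
  by rewrite /cross/= /GRing.scale/=; ring.
by rewrite c0 mulr0 ltxx.
Qed.

End support.

Definition crossing {R : realType} (g : R -> R * R) (s t : R) : R :=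
  cross (derive1 g s) (g t - g s).

(** What the dynamics uses of the table: a closed [C^2] unit-speed curve that
    lies strictly to the left of each of its tangents. [K] bounds its acceleration. *)
Record oval {R : realType} (L : R) (g : R -> R * R) (K : R) : Prop := Oval {
  oval_length_gt0 : 0 < L;
  oval_bound_ge1 : 1 <= K;
  oval_derive : forall s : R, is_derive s 1 g (derive1 g s);
  oval_derive2 : forall s : R, is_derive s 1 (derive1 g) (derive1n 2 g s);
  oval_bound1 : forall s, `|(derive1n 2 g s).1| <= K;
  oval_bound2 : forall s, `|(derive1n 2 g s).2| <= K;
  oval_unit : forall s, (derive1 g s).1 ^+ 2 + (derive1 g s).2 ^+ 2 = 1;
  oval_periodic : forall s, g (s + L) = g s;
  oval_inj : forall s t, s < t < s + L -> g s != g t;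
  oval_cross : forall s t, g s != g t -> 0 < crossing g s t }.

Section periodic.
Context {R : realType} (L : R).
Hypothesis L0 : 0 < L.

Lemma reduce_period (s : R) : exists m : int, 0 <= s + m%:~R * L < L.
Proof.
exists (- Num.floor (s / L)).
have := floor_itv (s / L); rewrite rmorphN/= intrD1 => /andP[f1 f2].
rewrite mulNr subr_ge0 ltrBlDr.
have E : s = s / L * L by rewrite divfK ?gt_eqF.
move: f1 f2; set F := _%:~R; rewrite {3 4}E; set q := s / L => f1 f2.
by rewrite ler_pM2r// f1/= [L + _]addrC -{3}[L]mul1r -mulrDl ltr_pM2r.
Qed.

Lemma periodicz (V : Type) (f : R -> V) : (forall s, f (s + L) = f s) ->
  forall (m : int) s, f (s + m%:~R * L) = f s.
Proof.
move=> per.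
have pern (n : nat) s : f (s + n%:R * L) = f s.
  elim: n s => [|n IH] s; first by rewrite mul0r addr0.
  by rewrite -natr1 mulrDl mul1r addrA per IH.
move=> [n|n] s; first exact: pern.
by rewrite NegzE -[in RHS](subrK (n.+1%:R * L) s) pern rmorphN/= mulNr.
Qed.

Lemma derive1_periodic (V : normedModType R) (f : R -> V) :
  (forall s, f (s + L) = f s) -> (forall s : R, derivable f s 1) ->
  forall s, derive1 f (s + L) = derive1 f s.
Proof.
move=> per df s.
have H : is_derive (s + L) 1 f (derive1 f (s + L)).
  by rewrite derive1E; exact: derivableP.
have {}H : is_derive s 1 f (derive1 f (s + L)).
  apply/is_derive_quotientP; move/is_derive_quotientP : H.
  set F := fun h : R => _; set G := fun h : R => h^-1 *: (f (s + h) - _).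
  suff -> : F = G by [].
  by apply/funext => h; rewrite /F /G addrAC !per.
by rewrite [RHS]derive1E (@derive_val _ _ _ _ _ _ _ H).
Qed.

End periodic.

Lemma C2_boundary_oval {R : realType} (D : set (R * R)) (L : R) (g : R -> R * R) :
  bounded_strictly_convex_domain D -> C2_arclength_boundary D L g ->
  exists K : R, oval L g K.
Proof.
move=> hD hg; have [L0 [[dg ddg cg] [u1 [per [inj _]]]]] := hg.
have per1 := derive1_periodic per dg.
have per2 : forall s, derive1n 2 g (s + L) = derive1n 2 g s.
  exact: (derive1_periodic per1 ddg).
have bound (f : R -> R) : continuous f -> (forall s, f (s + L) = f s) ->
    exists K, forall s, `|f s| <= K.
  move=> cf perf.
  have [|c _ Hc] := @EVT_max R (fun x => `|f x|) 0 L (ltW L0).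
    apply: continuous_subspaceT => x; apply: continuous_comp; [exact: cf|].
    exact: norm_continuous.
  exists `|f c| => s; have [m Hm] := reduce_period L0 s.
  rewrite -(periodicz perf m); apply: Hc.
  by rewrite in_itv/=; move: Hm => /andP[-> /ltW ->].
have [K1 HK1] : exists K, forall s, `|(derive1n 2 g s).1| <= K.
  apply: (bound (fun s => (derive1n 2 g s).1)) => [x|s]; last by rewrite per2.
  by apply: cvg_comp (cg x) _; exact: cvg_fst.
have [K2 HK2] : exists K, forall s, `|(derive1n 2 g s).2| <= K.
  apply: (bound (fun s => (derive1n 2 g s).2)) => [x|s]; last by rewrite per2.
  by apply: cvg_comp (cg x) _; exact: cvg_snd.
have K10 := le_trans (normr_ge0 _) (HK1 0).
have K20 := le_trans (normr_ge0 _) (HK2 0).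
have injL s t : s < t < s + L -> g s != g t.
  move=> /andP[st tsL]; apply/eqP => gst.
  have [m Hm] := reduce_period L0 s; have [n Hn] := reduce_period L0 t.
  have E := inj _ _ Hm Hn.
  rewrite !(periodicz per) in E; have {}E := E gst.
  have mn : (m - n)%:~R * L = t - s by rewrite rmorphB/=; lra.
  have : 0 < (m - n)%:~R * L < 1%:~R * L by rewrite mn mul1r; lra.
  by rewrite pmulr_lgt0// ltr_pM2r// ltr0z ltr_int; clear; lia.
exists (1 + K1 + K2); apply: Oval.
- exact: L0.
- by lra.
- by move=> s; exact: (curve_is_derive hg).
- by move=> s; have := derivableP (ddg s); rewrite -derive1E.
- by move=> s; have := HK1 s; lra.
- by move=> s; have := HK2 s; lra.
- by move=> s; exact: u1.
- exact: per.
- exact: injL.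
- by move=> s t /eqP; exact: (chord_cross_gt0 hD hg).
Qed.

(** * Lengths and angles of chords *)

Definition advance {R : realType} (g : R -> R * R) (s t : R) : R :=
  dot (derive1 g s) (g t - g s).

Definition chord {R : realType} (g : R -> R * R) (s t : R) : R :=
  Num.sqrt (((g t).1 - (g s).1) ^+ 2 + ((g t).2 - (g s).2) ^+ 2).

(** The angle at [g s] from the tangent to the chord: [acos] suffices, as the
    chord is to the left of the tangent. *)
Definition angle {R : realType} (g : R -> R * R) (s t : R) : R :=
  acos (advance g s t / chord g s t).

Section chords.
Context {R : realType} (L : R) (g : R -> R * R) (K : R).
Hypothesis ov : oval L g K.

Local Notation cr := (crossing g).
Local Notation ad := (advance g).
Local Notation ch := (chord g).
Local Notation ph := (angle g).

Lemma chordC s t : ch s t = ch t s.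
Proof. by rewrite /chord -(sqrrN (_.1 - _)) -(sqrrN (_.2 - _)) !opprB. Qed.

Lemma chord_ge0 s t : 0 <= ch s t. Proof. exact: sqrtr_ge0. Qed.

Lemma chord_sqr s t :
  ch s t ^+ 2 = ((g t).1 - (g s).1) ^+ 2 + ((g t).2 - (g s).2) ^+ 2.
Proof. by rewrite /chord sqr_sqrtr// addr_ge0// sqr_ge0. Qed.

Lemma chord_pythagoras s t : ad s t ^+ 2 + cr s t ^+ 2 = ch s t ^+ 2.
Proof.
rewrite chord_sqr -[RHS]mul1r -(oval_unit ov s) /advance /crossing /dot /cross/=.
ring.
Qed.

Lemma cross_sqr s t : cr s t ^+ 2 = ch s t ^+ 2 - ad s t ^+ 2.
Proof. by rewrite -chord_pythagoras addrAC subrr add0r. Qed.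

Lemma chord_gt0 s t : g s != g t -> 0 < ch s t.
Proof.
move=> /(oval_cross ov) c0; rewrite lt_neqAle chord_ge0 andbT eq_sym.
apply/eqP => z; have := chord_pythagoras s t; rewrite z; nra.
Qed.

Lemma chord_ratio_lt1 s t : g s != g t -> -1 < ad s t / ch s t < 1.
Proof.
move=> st; have c0 := oval_cross ov st; have h0 := chord_gt0 st.
rewrite ltr_pdivrMr// ltr_pdivlMr//; have := chord_pythagoras s t.
by move=> e; apply/andP; split; nra.
Qed.

Lemma chord_ratio_le1 s t : g s != g t -> -1 <= ad s t / ch s t <= 1.
Proof. by move=> /chord_ratio_lt1/andP[? ?]; rewrite !ltW. Qed.

Lemma cos_angle s t : g s != g t -> cos (ph s t) = ad s t / ch s t.
Proof. by move=> st; rewrite acosK// in_itv/= chord_ratio_le1. Qed.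

Lemma sqrt_chord_ratio s t : g s != g t ->
  Num.sqrt (1 - (ad s t / ch s t) ^+ 2) = cr s t / ch s t.
Proof.
move=> st; have c0 := oval_cross ov st; have h0 := chord_gt0 st.
have -> : 1 - (ad s t / ch s t) ^+ 2 = (cr s t / ch s t) ^+ 2.
  by rewrite !expr_div_n cross_sqr; field; rewrite gt_eqF.
by rewrite sqrtr_sqr ger0_norm// divr_ge0// ltW.
Qed.

Lemma sin_angle s t : g s != g t -> sin (ph s t) = cr s t / ch s t.
Proof. by move=> st; rewrite sin_acos ?chord_ratio_le1// sqrt_chord_ratio. Qed.

Lemma angle_gt0 s t : g s != g t -> 0 < ph s t.
Proof. by move=> /chord_ratio_lt1/andP[l r]; rewrite acos_gt0// r ltW. Qed.

Lemma angle_ltpi s t : g s != g t -> ph s t < pi.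
Proof. by move=> /chord_ratio_lt1/andP[l r]; rewrite acos_ltpi// l ltW. Qed.

(** First variation: only the component of the velocity of [g t] along the chord
    changes its length. *)
Lemma is_derive_chord s t : g s != g t -> is_derive t 1 (ch s) (- cos (ph t s)).
Proof.
move=> st; have h0 := chord_gt0 st.
have d1 := is_derive_fst (oval_derive ov t); have d2 := is_derive_snd (oval_derive ov t).
rewrite cos_angle 1?eq_sym//.
have dQ : is_derive t 1 (fun u => ((g u).1 - (g s).1) ^+ 2 + ((g u).2 - (g s).2) ^+ 2)
  (2 * (((g t).1 - (g s).1) * (derive1 g t).1 + ((g t).2 - (g s).2) * (derive1 g t).2)).
  by apply: is_derive_eq; rewrite /GRing.scale/=; ring.
have Q0 : 0 < ((g t).1 - (g s).1) ^+ 2 + ((g t).2 - (g s).2) ^+ 2.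
  by rewrite -chord_sqr exprn_gt0.
have dS := @is_derive1_comp R Num.sqrt _ t _ _ (is_derive1_sqrt Q0) dQ.
refine (is_derive_eq dS _).
rewrite [ch t s]chordC -[Num.sqrt _]/(ch s t) /advance /dot/=; field.
by rewrite gt_eqF.
Qed.

Lemma is_derive_div (F G : R -> R) (t dF dG : R) : G t != 0 ->
  is_derive t 1 F dF -> is_derive t 1 G dG ->
  is_derive t 1 (fun u => F u / G u) ((dF * G t - F t * dG) / G t ^+ 2).
Proof.
move=> Gt HF HG; have HV := is_deriveV Gt HG.
by apply: is_derive_eq; rewrite /GRing.scale/=; field.
Qed.

Lemma is_derive_dotr (X Y : R -> R) (t dX dY a b c d : R) :
  is_derive t 1 X dX -> is_derive t 1 Y dY ->
  is_derive t 1 (fun u => a * (X u - b) + c * (Y u - d)) (a * dX + c * dY).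
Proof.
by move=> HX HY; apply: is_derive_eq; rewrite /GRing.scale/=; ring.
Qed.

Lemma is_derive_dotl (X Y P S : R -> R) (t dX dY dP dS b d : R) :
  is_derive t 1 X dX -> is_derive t 1 Y dY ->
  is_derive t 1 P dP -> is_derive t 1 S dS ->
  is_derive t 1 (fun u => P u * (b - X u) + S u * (d - Y u))
    (dP * (b - X t) + dS * (d - Y t) - (P t * dX + S t * dY)).
Proof.
by move=> HX HY HP HS; apply: is_derive_eq; rewrite /GRing.scale/=; ring.
Qed.

Lemma is_derive_angler s t : g s != g t ->
  is_derive t 1 (ph s) (cr t s / ch s t ^+ 2).
Proof.
move=> st; have h0 := chord_gt0 st; have c0 := oval_cross ov st.
have d1 := is_derive_fst (oval_derive ov t); have d2 := is_derive_snd (oval_derive ov t).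
have dc := is_derive_chord st; rewrite cos_angle 1?eq_sym// [ch t s]chordC in dc.
have dA : is_derive t 1 (ad s) (dot (derive1 g s) (derive1 g t)).
  exact: (is_derive_dotr _ _ _ _ d1 d2).
have dr := is_derive_div (lt0r_neq0 h0) dA dc.
have da := is_derive1_acos (chord_ratio_lt1 st); rewrite sqrt_chord_ratio// in da.
refine (is_derive_eq (@is_derive1_comp R (@acos R) (fun u => ad s u / ch s u) t _ _ da dr) _).
have E : dot (derive1 g s) (derive1 g t) * ch s t ^+ 2 + ad s t * ad t s = - (cr s t * cr t s).
  rewrite chord_sqr /advance /crossing.
  move: (derive1 g s) (derive1 g t) (g s) (g t) => u v p q.
  by rewrite /dot /cross/=; ring.
have -> : cr t s = - (dot (derive1 g s) (derive1 g t) * ch s t ^+ 2 + ad s t * ad t s) / cr s t.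
  by rewrite E; field; rewrite gt_eqF.
by field; rewrite !gt_eqF.
Qed.

Lemma is_derive_sumsq (X Y : R -> R) (t dX dY : R) :
  is_derive t 1 X dX -> is_derive t 1 Y dY ->
  is_derive t 1 (fun u => X u ^+ 2 + Y u ^+ 2) (2 * (X t * dX + Y t * dY)).
Proof.
by move=> HX HY; apply: is_derive_eq; rewrite /GRing.scale/=; ring.
Qed.

(** The curvature, written without a normal. *)
Definition turning (s : R) : R := cross (derive1 g s) (derive1n 2 g s).

(** The chord turns as in [is_derive_angler], while the tangent from which its
    angle is measured turns at the rate of the curvature. *)
Lemma is_derive_anglel s t : g s != g t ->
  is_derive s 1 (fun u => ph u t) (cr s t / ch s t ^+ 2 - turning s).
Proof.
move=> st; have h0 := chord_gt0 st; have c0 := oval_cross ov st.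
have d1 := is_derive_fst (oval_derive ov s); have d2 := is_derive_snd (oval_derive ov s).
have e1 := is_derive_fst (oval_derive2 ov s); have e2 := is_derive_snd (oval_derive2 ov s).
have dc := is_derive_chord (_ : g t != g s); rewrite eq_sym in dc.
move: dc => /(_ st) dc; rewrite cos_angle// in dc.
have dc' : is_derive s 1 (fun u => ch u t) (- (ad s t / ch s t)).
  by under eq_fun do rewrite chordC.
have dA : is_derive s 1 (fun u => ad u t) (dot (derive1n 2 g s) (g t - g s) - 1).
  refine (is_derive_eq (is_derive_dotl (g t).1 (g t).2 d1 d2 e1 e2) _).
  have := oval_unit ov s.
  move: (derive1 g s) (derive1n 2 g s) (g s) (g t) => u w p q uu.
  by rewrite /dot/=; lra.
have dr := @is_derive_div (fun u => ad u t) (fun u => ch u t) s _ _ (lt0r_neq0 h0) dA dc'.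
have da := is_derive1_acos (chord_ratio_lt1 st); rewrite sqrt_chord_ratio// in da.
refine (is_derive_eq (@is_derive1_comp R (@acos R) (fun u => ad u t / ch u t) s _ _ da dr) _).
(* the acceleration is normal to the curve *)
have unn : (derive1 g s).1 * (derive1n 2 g s).1 + (derive1 g s).2 * (derive1n 2 g s).2 = 0.
  have H : is_derive s 1 (fun u => (derive1 g u).1 ^+ 2 + (derive1 g u).2 ^+ 2)
      (2 * ((derive1 g s).1 * (derive1n 2 g s).1 + (derive1 g s).2 * (derive1n 2 g s).2)).
    exact: (is_derive_sumsq e1 e2).
  have {}H : is_derive s 1 (cst (1 : R))
      (2 * ((derive1 g s).1 * (derive1n 2 g s).1 + (derive1 g s).2 * (derive1n 2 g s).2)).
    by move: H; congr is_derive; apply/funext => u; rewrite (oval_unit ov).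
  have := @derive_val _ _ _ _ _ _ _ H; rewrite derive_cst.
  by move: (derive1 g s) (derive1n 2 g s) => u w; lra.
have E : dot (derive1n 2 g s) (g t - g s) = turning s * cr s t.
  have uu := oval_unit ov s.
  rewrite /turning /crossing; move: unn uu.
  move: (derive1 g s) (derive1n 2 g s) (g s) (g t) => u w p q unn uu.
  rewrite /dot /cross/=.
  set x1 := u.1 in unn uu *; set y1 := u.2 in unn uu *.
  set x2 := w.1 in unn *; set y2 := w.2 in unn *.
  set a := q.1 - p.1; set b := q.2 - p.2.
  have -> : (x1 * y2 - y1 * x2) * (x1 * b - y1 * a) =
    (x1 ^+ 2 + y1 ^+ 2) * (x2 * a + y2 * b) - (x1 * x2 + y1 * y2) * (x1 * a + y1 * b) by ring.
  by rewrite uu unn; ring.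
have -> : cr s t / ch s t ^+ 2 - turning s =
  cr s t ^+ 2 / (cr s t * ch s t ^+ 2) - turning s.
  by move: (turning s) (ch s t) (cr s t) h0 c0 => k h c h0 c0; field; rewrite !gt_eqF.
rewrite cross_sqr E.
move: (turning s) (ad s t) (ch s t) (cr s t) h0 c0 => k a h c h0 c0.
by field; rewrite !gt_eqF.
Qed.

End chords.

(** * Short chords and long chords *)

Lemma taylor1 {R : realType} (F dF ddF : R -> R) (K : R) :
  (forall s : R, is_derive s 1 F (dF s)) -> (forall s : R, is_derive s 1 dF (ddF s)) ->
  (forall s, `|ddF s| <= K) ->
  forall s t, `|F t - F s - (t - s) * dF s| <= K * (t - s) ^+ 2.
Proof.
move=> HF HdF HK.
have cont (f df : R -> R) : (forall s : R, is_derive s 1 f (df s)) ->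
    forall a b, {within `[a, b], continuous f}.
  move=> Hf a b; apply: continuous_subspaceT => x.
  by apply: differentiable_continuous; apply/derivable1_diffP; have [] := Hf x.
have mvt (f df : R -> R) : (forall s : R, is_derive s 1 f (df s)) ->
    forall a b, exists2 c, `|c - a| <= `|b - a| & f b - f a = df c * (b - a).
  move=> Hf a b; have [ab|ba|->] := ltgtP a b.
  - have [c] := MVT ab (fun x _ => Hf x) (cont _ _ Hf _ _).
    rewrite in_itv/= => /andP[c1 c2] E; exists c => //.
    by rewrite !gtr0_norm ?subr_gt0// lerD2r ltW.
  - have [c] := MVT ba (fun x _ => Hf x) (cont _ _ Hf _ _).
    rewrite in_itv/= => /andP[c1 c2] E; exists c; last by rewrite -opprB E; ring.
    by rewrite ![`|_ - a|]distrC !gtr0_norm ?subr_gt0// lerD2l lerN2 ltW.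
  - by exists b; rewrite ?subrr ?mulr0.
move=> s t; have [c cs ->] := mvt _ _ HF s t; have [d _ E] := mvt _ _ HdF s c.
have -> : dF c * (t - s) - (t - s) * dF s = (dF c - dF s) * (t - s) by ring.
rewrite E !normrM -[(t - s) ^+ 2]real_normK ?num_real// expr2 mulrA.
by rewrite ler_wpM2r// ler_pM.
Qed.

Section bounds.
Context {R : realType} (L : R) (g : R -> R * R) (K : R).
Hypothesis ov : oval L g K.

Local Notation cr := (crossing g).
Local Notation ad := (advance g).
Local Notation ch := (chord g).

Let L0 := oval_length_gt0 ov.

Lemma tangent_bound (s : R) : `|(derive1 g s).1| <= 1 /\ `|(derive1 g s).2| <= 1.
Proof.
exact: unit_coord_le1 (oval_unit ov s).
Qed.

Lemma turning_bound s : `|turning g s| <= 2 * K.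
Proof.
have [u1 u2] := tangent_bound s.
have w1 := oval_bound1 ov s; have w2 := oval_bound2 ov s.
rewrite /turning /cross; apply: le_trans (ler_normB _ _) _; rewrite !normrM.
have A : `|(derive1 g s).1| * `|(derive1n 2 g s).2| <= 1 * K by rewrite ler_pM.
have B : `|(derive1 g s).2| * `|(derive1n 2 g s).1| <= 1 * K by rewrite ler_pM.
by rewrite -[2]/(1 + 1) mulrDl lerD.
Qed.

Lemma chord_taylor s t :
  `|(g t).1 - (g s).1 - (t - s) * (derive1 g s).1| <= K * (t - s) ^+ 2 /\
  `|(g t).2 - (g s).2 - (t - s) * (derive1 g s).2| <= K * (t - s) ^+ 2.
Proof.
split.
- apply: (taylor1 (fun s => is_derive_fst (oval_derive ov s))
    (fun s => is_derive_fst (oval_derive2 ov s)) (oval_bound1 ov)).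
- apply: (taylor1 (fun s => is_derive_snd (oval_derive ov s))
    (fun s => is_derive_snd (oval_derive2 ov s)) (oval_bound2 ov)).
Qed.

Lemma advance_near s t : `|ad s t - (t - s)| <= 2 * K * (t - s) ^+ 2.
Proof.
have [u1 u2] := tangent_bound s; have [T1 T2] := chord_taylor s t.
have -> : ad s t - (t - s) =
  (derive1 g s).1 * ((g t).1 - (g s).1 - (t - s) * (derive1 g s).1) +
  (derive1 g s).2 * ((g t).2 - (g s).2 - (t - s) * (derive1 g s).2).
  rewrite /advance; have := oval_unit ov s.
  move: (derive1 g s) (g s) (g t) => u p q uu.
  have : (t - s) * (u.1 ^+ 2 + u.2 ^+ 2) = t - s by rewrite uu mulr1.
  by rewrite /dot/=; lra.
have -> : 2 * K * (t - s) ^+ 2 = K * (t - s) ^+ 2 + K * (t - s) ^+ 2 by ring.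
by apply: le_trans (ler_normD _ _) _; apply: lerD; rewrite normrM -[leRHS]mul1r ler_pM.
Qed.

Lemma cross_near s t : `|cr s t| <= 2 * K * (t - s) ^+ 2.
Proof.
have [u1 u2] := tangent_bound s; have [T1 T2] := chord_taylor s t.
have -> : cr s t =
  (derive1 g s).1 * ((g t).2 - (g s).2 - (t - s) * (derive1 g s).2) -
  (derive1 g s).2 * ((g t).1 - (g s).1 - (t - s) * (derive1 g s).1).
  rewrite /crossing.
  by move: (derive1 g s) (g s) (g t) => u p q; rewrite /cross/=; ring.
have -> : 2 * K * (t - s) ^+ 2 = K * (t - s) ^+ 2 + K * (t - s) ^+ 2 by ring.
by apply: le_trans (ler_normB _ _) _; apply: lerD; rewrite normrM -[leRHS]mul1r ler_pM.
Qed.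

Lemma chord_near s t : `|t - s| <= (4 * K)^-1 -> `|t - s| <= 2 * ch s t.
Proof.
move=> ts; have K1 := oval_bound_ge1 ov.
have H : 2 * K * (t - s) ^+ 2 <= `|t - s| / 2.
  rewrite -[(t - s) ^+ 2]real_normK ?num_real// expr2 mulrA ler_pdivlMr//.
  have : `|t - s| * (4 * K) <= 1 by rewrite -ler_pdivlMr ?mul1r//; lra.
  have := normr_ge0 (t - s); move: `|t - s| => x x0 x1.
  by have := mulr_ge0 x0 (_ : 0 <= 1 - x * (4 * K)); rewrite subr_ge0 => /(_ x1); lra.
have A := advance_near s t.
have : `|ad s t| <= ch s t.
  rewrite -(@ler_pXn2r _ 2) ?nnegrE ?chord_ge0// real_normK ?num_real//.
  by rewrite -(chord_pythagoras ov) lerDl sqr_ge0.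
have := ler_distD (ad s t) (t - s) 0; rewrite !subr0 [X in _ <= X + _]distrC.
by move: A H; set a := `|ad s t - _|; set b := `|ad s t|; lra.
Qed.

Lemma oval_continuous : continuous g.
Proof.
move=> x; apply: differentiable_continuous; apply/derivable1_diffP.
by have [] := oval_derive ov x.
Qed.

Lemma oval_continuous1 : continuous (derive1 g).
Proof.
move=> x; apply: differentiable_continuous; apply/derivable1_diffP.
by have [] := oval_derive2 ov x.
Qed.

Lemma cross_periodicr s t : cr s (t + L) = cr s t.
Proof. by rewrite /crossing (oval_periodic ov). Qed.

Lemma derive1_oval_periodic s : derive1 g (s + L) = derive1 g s.
Proof.
apply: derive1_periodic => [|u]; first exact: (oval_periodic ov).
by have [] := oval_derive ov u.
Qed.

Lemma cross_periodicl s t : cr (s + L) t = cr s t.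
Proof. by rewrite /crossing (oval_periodic ov) derive1_oval_periodic. Qed.

(** Strict convexity is uniform: the pairs at distance at least [d] along the curve
    form a compact set modulo the period. *)
Lemma cross_far (d : R) : 0 < d -> exists2 c, 0 < c &
  forall s t, s + d <= t <= s + L - d -> c <= cr s t.
Proof.
move=> d0; have [Ld|Ld] := ltP (L - d) d.
  by exists 1 => // s t; lra.
pose F (p : R * R) : R := cr p.1 (p.1 + p.2).
have cF : continuous F.
  move=> p.
  have c1 : (derive1 g q.1 @[q --> p] --> derive1 g p.1).
    by apply: (cvg_comp _ _ (@cvg_fst _ _ _ _ _)); exact: oval_continuous1.
  have c2 : (g q.1 @[q --> p] --> g p.1).
    by apply: (cvg_comp _ _ (@cvg_fst _ _ _ _ _)); exact: oval_continuous.
  have c3 : (g (q.1 + q.2) @[q --> p] --> g (p.1 + p.2)).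
    have H : (q.1 + q.2 @[q --> p] --> p.1 + p.2).
      by apply: cvgD; [exact: cvg_fst|exact: cvg_snd].
    exact: (cvg_comp _ _ H (@oval_continuous _)).
  have fs (f : R * R -> R * R) (l : R * R) : f q @[q --> p] --> l ->
      ((f q).1 @[q --> p] --> l.1) /\ ((f q).2 @[q --> p] --> l.2).
    by move=> H; split; [exact: (cvg_comp _ _ H (@cvg_fst _ _ _ _ _))|
                         exact: (cvg_comp _ _ H (@cvg_snd _ _ _ _ _))].
  have [a1 a2] := fs _ _ c1; have [b1 b2] := fs _ _ c2; have [e1 e2] := fs _ _ c3.
  rewrite /F /crossing /cross/=.
  by apply: cvgB; apply: cvgM => //; apply: cvgB.
pose A : set (R * R) := `[0, L] `*` `[d, L - d].
have A0 : A !=set0 by exists (0, d); split; rewrite /= in_itv/= lexx//= ltW.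
have cA : compact A by apply: compact_setX; exact: segment_compact.
have [c] := compact_EVT_min A0 cA (continuous_subspaceT cF).
rewrite inE => -[]; rewrite /= !in_itv/= => /andP[c1 c2] /andP[c3 c4] Hc.
exists (F c).
  apply: (oval_cross ov); apply: (oval_inj ov); lra.
move=> s t /andP[st ts]; have [m /andP[m1 m2]] := reduce_period L0 s.
have -> : cr s t = F (s + m%:~R * L, t - s).
  rewrite /F/=; have -> : s + m%:~R * L + (t - s) = t + m%:~R * L by ring.
  rewrite (periodicz (fun u => cross_periodicr (s + m%:~R * L) u)).
  by rewrite (periodicz (f := fun u => cr u t) (fun u => cross_periodicl u t)).
apply: Hc; rewrite inE; split; rewrite /= in_itv/=; first by rewrite m1 ltW.
by apply/andP; split; lra.
Qed.

End bounds.

(** * Regularity of the angle of a chord *)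

Lemma cos_nincr {R : realType} (x y : R) : 0 <= x -> x <= y -> y <= pi ->
  cos y <= cos x.
Proof. by move=> x0 xy ypi; rewrite leNgt ltr_cos ?in_itv/= -?leNgt//; lra. Qed.

Section angle_bounds.
Context {R : realType} (L : R) (g : R -> R * R) (K : R).
Hypothesis ov : oval L g K.

Local Notation cr := (crossing g).
Local Notation ad := (advance g).
Local Notation ch := (chord g).
Local Notation ph := (angle g).

Let L0 := oval_length_gt0 ov.

Lemma oval_apartC s t : s < t < s + L -> g t != g s.
Proof. by rewrite eq_sym; exact: (oval_inj ov). Qed.

Lemma apart_lift s t : g s != g t -> exists m : int, s < t + m%:~R * L < s + L.
Proof.
move=> st; have [m /andP[m1 m2]] := reduce_period L0 (t - s); exists m.
move: st; rewrite -(periodicz (oval_periodic ov) m t).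
move: m1 m2; rewrite addrAC; set u := t + _ => m1 m2.
move=> gu; have su : s != u by apply: contraNneq gu => ->.
by rewrite lt_neqAle su/=; apply/andP; split; lra.
Qed.

Lemma chord_periodicr s t : ch s (t + L) = ch s t.
Proof. by rewrite /chord (oval_periodic ov). Qed.

Lemma advance_periodicr s t : ad s (t + L) = ad s t.
Proof. by rewrite /advance (oval_periodic ov). Qed.

Lemma angle_periodicr s t : ph s (t + L) = ph s t.
Proof. by rewrite /angle chord_periodicr advance_periodicr. Qed.

Lemma chord_continuous s : continuous (ch s).
Proof.
move=> t; have c := @oval_continuous _ _ _ _ ov t.
have c1 : (g u).1 @[u --> t] --> (g t).1 by apply: (cvg_comp _ _ c (@cvg_fst _ _ _ _ _)).
have c2 : (g u).2 @[u --> t] --> (g t).2 by apply: (cvg_comp _ _ c (@cvg_snd _ _ _ _ _)).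
have H : ((g u).1 - (g s).1) ^+ 2 + ((g u).2 - (g s).2) ^+ 2 @[u --> t] -->
    ((g t).1 - (g s).1) ^+ 2 + ((g t).2 - (g s).2) ^+ 2.
  by apply: cvgD; apply: cvgM; apply: cvgB => //; exact: cvg_cst.
exact: (cvg_comp _ _ H (@sqrt_continuous _ _)).
Qed.

Lemma chordxx s : ch s s = 0.
Proof. by rewrite /chord !subrr expr0n/= addr0 sqrtr0. Qed.

Lemma chord_le s t : s <= t < s + L -> ch s t <= t - s.
Proof.
move=> /andP[st tL].
have D u : u \in `]s, t[ -> is_derive u 1 (ch s) (- cos (ph u s)).
  rewrite in_itv/= => /andP[u1 u2]; apply: (is_derive_chord ov).
  by apply: (oval_inj ov); lra.
have [c _] := MVT_segment st D (continuous_subspaceT (@chord_continuous s)).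
rewrite chordxx subr0 => ->; have := cos_geN1 (ph c s); move: (cos _) => x x1; nra.
Qed.

Lemma cross_le_chord s t : g s != g t -> cr s t <= ch s t.
Proof.
move=> st; have c0 := oval_cross ov st; have h0 := chord_gt0 ov st.
rewrite -(@ler_pXn2r _ 2) ?nnegrE ?(ltW c0) ?(ltW h0)//.
by rewrite -(chord_pythagoras ov s t) lerDr sqr_ge0.
Qed.

(** Short chords, on either side of [s], obey the Taylor bound; long chords are long
    enough for the trivial bound [cross_le_chord]. *)
Lemma cross_le_chord_sqr : exists2 C, 0 < C &
  forall s t, g s != g t -> cr s t <= C * ch s t ^+ 2.
Proof.
have K1 := oval_bound_ge1 ov.
have d0 : 0 < (4 * K)^-1 by rewrite invr_gt0; lra.
have [c c0 Hc] := cross_far ov d0.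
have ci : 0 < c^-1 by rewrite invr_gt0.
exists (8 * K + c^-1); first by lra.
have near s t : `|t - s| <= (4 * K)^-1 -> cr s t <= (8 * K + c^-1) * ch s t ^+ 2.
  move=> ts; have h := chord_near ov ts; have H := le_trans (ler_norm _) (cross_near ov s t).
  apply: le_trans H _; rewrite -[(t - s) ^+ 2]real_normK ?num_real//.
  have : `|t - s| ^+ 2 <= 4 * ch s t ^+ 2.
    have -> : 4 * ch s t ^+ 2 = (2 * ch s t) ^+ 2 by ring.
    by rewrite ler_pXn2r// nnegrE mulr_ge0// chord_ge0.
  by have := sqr_ge0 (ch s t); move: (ch s t ^+ 2) (`|t - s| ^+ 2) => a b; nra.
move=> s t st; have [m] := apart_lift st; move: (st).
rewrite -(periodicz (oval_periodic ov) m t).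
rewrite -(periodicz (fun u => cross_periodicr ov s u) m t).
rewrite -(periodicz (fun u => chord_periodicr s u) m t).
move: (t + m%:~R * L) => {st m}t st /andP[t1 t2].
have [tn|tf] := lerP (t - s) (4 * K)^-1.
  by apply: near; rewrite ger0_norm; lra.
have [tn|tf'] := lerP (s + L - t) (4 * K)^-1.
  have -> : t = (t - L) + L by ring.
  rewrite (cross_periodicr ov) chord_periodicr.
  by apply: near; rewrite distrC ger0_norm; lra.
have h : c <= cr s t by apply: Hc; apply/andP; split; lra.
have h2 := cross_le_chord st.
apply: (le_trans h2).
have : ch s t <= c^-1 * ch s t ^+ 2.
  rewrite mulrC ler_pdivlMr// expr2 ler_wpM2l ?chord_ge0//.
  exact: le_trans h h2.
by have := sqr_ge0 (ch s t); move: (ch s t ^+ 2) (ch s t) => a b; nra.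
Qed.

Lemma cos_angle_near s x : 0 < x < L -> 2 * K * x <= 1 ->
  1 - 2 * K * x <= cos (ph s (s + x)) /\
  cos (ph s (s + L - x)) <= - (1 - 2 * K * x).
Proof.
move=> /andP[x0 xL] xK; split.
  have st : g s != g (s + x) by apply: (oval_inj ov); lra.
  rewrite (cos_angle ov st) ler_pdivlMr ?(chord_gt0 ov)//.
  have h : ch s (s + x) <= x.
    by have := @chord_le s (s + x); rewrite [s + x - s]addrC addKr; apply; lra.
  have := advance_near ov s (s + x); rewrite [s + x - s]addrC addKr ler_norml.
  move=> /andP[a _]; have := chord_ge0 g s (s + x).
  by move: (ch s (s + x)) (ad s (s + x)) h a => c a; nra.
have st : g s != g (s + L - x) by apply: (oval_inj ov); lra.
rewrite (cos_angle ov st) ler_pdivrMr ?(chord_gt0 ov)//.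
have -> : s + L - x = (s - x) + L by ring.
rewrite advance_periodicr chord_periodicr.
have h : ch s (s - x) <= x.
  have := @chord_le (s - x) s; rewrite chordC; have -> : s - (s - x) = x by ring.
  by apply; lra.
have := advance_near ov s (s - x); have -> : s - x - s = - x by ring.
rewrite opprK sqrrN ler_norml => /andP[_ a]; have := chord_ge0 g s (s - x).
by move: (ch s (s - x)) (ad s (s - x)) h a => c a; nra.
Qed.

Definition lipschitz_angle (A : R) :=
  (forall s t t', s < t -> t <= t' -> t' < s + L ->
     0 <= ph s t' - ph s t <= A * (t' - t)) /\
  (forall s s' t, s <= s' -> s' < t -> t < s + L ->
     `|ph s t - ph s' t| <= A * (s' - s)).

Lemma angle_mvtr s t t' : s < t -> t <= t' -> t' < s + L ->
  exists2 c, t <= c <= t' & ph s t' - ph s t = cr c s / ch s c ^+ 2 * (t' - t).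
Proof.
move=> st tt' tL.
have D u : t <= u <= t' -> is_derive u 1 (ph s) (cr u s / ch s u ^+ 2).
  by move=> ?; apply: (is_derive_angler ov); apply: (oval_inj ov); lra.
have [|||c] := @MVT_segment R (ph s) (fun u => cr u s / ch s u ^+ 2) t t' => //.
- by move=> u; rewrite in_itv/= => ?; apply: D; lra.
- apply: derivable_within_continuous => u; rewrite in_itv/= => ?.
  by have [] := D u _.
- by rewrite in_itv/= => cc E; exists c.
Qed.

Lemma angle_lipschitz : exists2 A, 1 <= A & lipschitz_angle A.
Proof.
have [C C0 HC] := cross_le_chord_sqr; have K1 := oval_bound_ge1 ov.
have HC' s t : g s != g t -> 0 <= cr s t / ch s t ^+ 2 <= C.
  move=> st; have h := chord_gt0 ov st; have c := oval_cross ov st.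
  by rewrite ler_pdivrMr ?exprn_gt0// HC// divr_ge0 ?sqr_ge0// ltW.
exists (C + 2 * K); first by lra.
split=> [s t t' st tt' tL|s s' t ss' st tL].
  have [c c12 ->] := angle_mvtr st tt' tL.
  have /HC' : g c != g s by rewrite eq_sym; apply: (oval_inj ov); lra.
  rewrite chordC; move: (_ / _) => x /andP[x0 x1].
  by apply/andP; split; nra.
have D u : s <= u <= s' -> is_derive u 1 (fun v => ph v t) (cr u t / ch u t ^+ 2 - turning g u).
  by move=> ?; apply: (is_derive_anglel ov); apply: (oval_inj ov); lra.
have [|||c] := @MVT_segment R (fun v => ph v t) (fun u => cr u t / ch u t ^+ 2 - turning g u) s s' => //.
- by move=> u; rewrite in_itv/= => ?; apply: D; lra.
- apply: derivable_within_continuous => u; rewrite in_itv/= => ?.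
  by have [] := D u _.
rewrite in_itv/= distrC => /andP[c1 c2] ->; rewrite normrM [X in _ * X]ger0_norm ?subr_ge0//.
rewrite ler_wpM2r ?subr_ge0//.
have /HC' : g c != g t by apply: (oval_inj ov); lra.
have := turning_bound ov c; move: (_ / _) (turning g c) => x y.
by rewrite !ler_norml => /andP[? ?] /andP[? ?]; apply/andP; split; lra.
Qed.

(** By [cos_angle_near], [ph s t] tends to [0] as [t] decreases to [s] and to [pi] as
    [t] increases to [s + L]: the Lipschitz bound applies from these limits. *)
Lemma angle_near (A : R) : lipschitz_angle A -> forall s t, s < t < s + L ->
  ph s t <= A * (t - s) /\ pi - ph s t <= A * (s + L - t).
Proof.
move=> [HA _] s t /andP[st tL]; have K1 := oval_bound_ge1 ov.
have st0 : g s != g t by apply: (oval_inj ov); lra.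
have p0 := angle_gt0 ov st0; have p1 := angle_ltpi ov st0.
have A0 : 0 <= A.
  by have := HA s t t st (lexx _) tL; have := HA s ((s + t) / 2) t; nra.
have cosl (al : R) : 0 < al < pi -> cos al < 1.
  by move=> a; rewrite -[ltRHS]cos0 ltr_cos ?in_itv/=; lra.
have pick al w : 0 < al < pi -> 0 < w -> exists2 x : R, 0 < x < w & 2 * K * x <= (1 - cos al) / 2.
  move=> /cosl al1 w0; exists (Num.min (w / 2) ((1 - cos al) / (4 * K))).
    rewrite lt_min gt_min; apply/andP; split; last by apply/orP; left; lra.
    by apply/andP; split; [lra|rewrite divr_gt0; lra].
  have : Num.min (w / 2) ((1 - cos al) / (4 * K)) <= (1 - cos al) / (4 * K) by rewrite ge_min lexx orbT.
  by rewrite ler_pdivlMr; lra.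
split; rewrite leNgt; apply/negP => N.
  pose al := ph s t - A * (t - s).
  have al0 : 0 < al < pi by rewrite /al; apply/andP; split; nra.
  have [||x x0 xK] := pick al (t - s) => //; first lra.
  have al1 := cosl _ al0; have al2 := cos_geN1 al.
  have [||C _] := @cos_angle_near s x; [lra|lra|].
  have /andP[_ M] := HA s (s + x) t ltac:(lra) ltac:(lra) tL.
  have sx : g s != g (s + x) by apply: (oval_inj ov); lra.
  have : cos (ph s (s + x)) <= cos al.
    have := angle_gt0 ov sx; have := angle_ltpi ov sx => ? ?.
    by apply: cos_nincr; [lra|rewrite /al; nra|lra].
  lra.
pose al := pi - ph s t - A * (s + L - t).
have al0 : 0 < al < pi by rewrite /al; apply/andP; split; nra.
have [||x x0 xK] := pick al (s + L - t) => //; first lra.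
have al1 := cosl _ al0; have al2 := cos_geN1 al.
have [||_ C] := @cos_angle_near s x; [lra|lra|].
have /andP[_ M] := HA s t (s + L - x) st ltac:(lra) ltac:(lra).
have sx : g s != g (s + L - x) by apply: (oval_inj ov); lra.
have : cos (pi - al) <= cos (ph s (s + L - x)).
  have := angle_gt0 ov sx; have := angle_ltpi ov sx => ? ?.
  by apply: cos_nincr; [lra|rewrite /al; nra|lra].
have -> : cos (pi - al) = - cos al by rewrite cosB cospi sinpi; ring.
lra.
Qed.

Lemma angle_ivt s t1 t2 u : s < t1 -> t1 <= t2 -> t2 < s + L ->
  ph s t1 <= u <= ph s t2 -> exists2 t, t1 <= t <= t2 & ph s t = u.
Proof.
move=> st1 t12 t2L u12.
have cont : {within `[t1, t2], continuous (ph s)}.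
  apply: derivable_within_continuous => v; rewrite in_itv/= => ?.
  by have [] : is_derive v 1 (ph s) (cr v s / ch s v ^+ 2);
     first by apply: (is_derive_angler ov); apply: (oval_inj ov); lra.
have [|c] := IVT t12 cont (v := u).
  by move: u12 => /andP[u1 u2]; rewrite ge_min u1 le_max u2 orbT.
by rewrite in_itv/= => cc E; exists c.
Qed.

Lemma angle_slope_far d : 0 < d -> exists2 c, 0 < c & forall s t,
  s + d <= t <= s + L - d -> c <= cr t s / ch s t ^+ 2.
Proof.
move=> d0; have [c c0 Hc] := cross_far ov d0.
exists (c / L ^+ 2); first by rewrite divr_gt0// exprn_gt0.
move=> s t /andP[t1 t2].
have st : g s != g t by apply: (oval_inj ov); lra.
have h := chord_gt0 ov st.
have hL : ch s t <= L by have := @chord_le s t; lra.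
have : c <= cr t s by rewrite -(cross_periodicr ov); apply: Hc; lra.
move=> cc; apply: ler_pM => //; first exact: ltW.
  by rewrite invr_ge0 sqr_ge0.
by rewrite lef_pV2 ?posrE ?exprn_gt0// ler_pXn2r ?nnegrE ?(ltW h) ?(ltW L0).
Qed.

Lemma angle_increase_far d : 0 < d -> exists2 c, 0 < c & forall s t t',
  s + d <= t -> t <= t' -> t' <= s + L - d -> c * (t' - t) <= ph s t' - ph s t.
Proof.
move=> d0; have [c c0 Hc] := angle_slope_far d0; exists c => // s t t' st tt' tL.
have [||u uu ->] := @angle_mvtr s t t' _ tt'; [lra|lra|].
by rewrite ler_wpM2r ?subr_ge0// Hc//; lra.
Qed.

End angle_bounds.

(** * The billiard map and the two-step density *)

Section billiard_map.
Context {R : realType} (L : R) (g : R -> R * R) (K : R).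
Hypothesis ov : oval L g K.

Local Notation cr := (crossing g).
Local Notation ad := (advance g).
Local Notation ch := (chord g).
Local Notation ph := (angle g).
Local Notation T := (billiard_map L g).

Let L0 := oval_length_gt0 ov.

Lemma direction_angle s t : g s != g t ->
  direction g (s, ph s t) = (ch s t)^-1 *: (g t - g s).
Proof.
move=> st; have h := chord_gt0 ov st.
rewrite /direction /inward_normal/= (cos_angle ov st) (sin_angle ov st).
rewrite /advance /crossing; have := oval_unit ov s; move: (ch s t) h => c c0.
move: (derive1 g s) (g s) (g t) => u p q uu.
rewrite /rot90 /dot /cross; apply: injective_projections => /=; rewrite /GRing.scale/=.
  transitivity (((u.1 ^+ 2 + u.2 ^+ 2) * (q.1 - p.1)) / c); first by field; lra.
  by rewrite uu mul1r mulrC.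
transitivity (((u.1 ^+ 2 + u.2 ^+ 2) * (q.2 - p.2)) / c); first by field; lra.
by rewrite uu mul1r mulrC.
Qed.

Lemma direction_decompose s a :
  let v := direction g (s, a) in
  dot (derive1 g s) v = cos a /\ cross (derive1 g s) v = sin a.
Proof.
rewrite /direction /inward_normal/=; have := oval_unit ov s.
move: (derive1 g s) (cos a) (sin a) => u x y uu.
rewrite /rot90 /dot /cross/= /GRing.scale/=; split.
  transitivity ((u.1 ^+ 2 + u.2 ^+ 2) * x); first by ring.
  by rewrite uu mul1r.
transitivity ((u.1 ^+ 2 + u.2 ^+ 2) * y); first by ring.
by rewrite uu mul1r.
Qed.

Lemma direction_inj s a b : 0 <= a <= pi -> 0 <= b <= pi ->
  direction g (s, a) = direction g (s, b) -> a = b.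
Proof.
move=> a0 b0 E; have [ca _] := direction_decompose s a.
have [cb _] := direction_decompose s b.
by apply: cos_inj; rewrite ?in_itv// -ca -cb E.
Qed.

Lemma oval_inj_phase s t : 0 <= s < L -> 0 <= t < L -> g s = g t -> s = t.
Proof.
move=> s0 t0 st; have [ss|ss|//] := ltgtP s t.
  by have : g s != g t; [apply: (oval_inj ov); lra|rewrite st eqxx].
by have : g t != g s; [apply: (oval_inj ov); lra|rewrite st eqxx].
Qed.

Lemma billiard_step_unique x y y' :
  billiard_step L g x y -> billiard_step L g x y' -> y = y'.
Proof.
move=> [[p1 p2] [t [t0 gt Ht]] d] [[p1' p2'] [t' [t0' gt' Ht']] d'].
have tt : t = t'.
  have [tt|tt|//] := ltgtP t t'.
    by have /Ht' := (introT andP (conj t0 tt)); case; exists y.1; rewrite // gt.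
  by have /Ht := (introT andP (conj t0' tt)); case; exists y'.1; rewrite // gt'.
have E : y.1 = y'.1 by apply: oval_inj_phase => //; rewrite gt gt' tt.
have dd : direction g y = direction g y'.
  by rewrite E in d; rewrite [LHS]d [RHS]d'.
move: p2 p2' E dd; clear -ov; case: y y' => [u a] [u' b] /= a0 b0 -> dd.
by rewrite (direction_inj a0 b0 dd).
Qed.

(** Between its two ends a chord stays off the curve: the three points would be
    collinear, and the middle one would have the other two on both sides of its
    tangent. *)
Lemma chord_interior_notin s t l : g s != g t -> 0 < l < 1 ->
  ~ range g (g s + l *: (g t - g s)).
Proof.
move=> st l01 [u _ gu].
have us : g u != g s.
  apply/eqP => E; move: gu; rewrite E => /eqP.
  rewrite -subr_eq0 opprD addrA subrr sub0r oppr_eq0 scaler_eq0 subr_eq0.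
  by rewrite [g t == _]eq_sym (negbTE st) orbF => /eqP; lra.
have ut : g u != g t.
  apply/eqP => E; move: gu; rewrite E => /eqP.
  rewrite -subr_eq0 opprD addrA -{1}[g t - g s]scale1r -scalerBl scaler_eq0 subr_eq0.
  by rewrite subr_eq0 [g t == _]eq_sym (negbTE st) orbF => /eqP; lra.
have := oval_cross ov us; have := oval_cross ov ut; rewrite /crossing gu.
move: (derive1 g u) (g s) (g t) l01 => v p q l01.
rewrite /cross/= /GRing.scale/= => A B.
set a := v.1 * (q.2 - p.2) - v.2 * (q.1 - p.1).
have : 0 < (1 - l) * a by rewrite /a; lra.
have : 0 < - l * a by rewrite /a; lra.
by move: a => a; nra.
Qed.

Lemma billiard_step_chord s t : g s != g t -> 0 <= t < L ->
  billiard_step L g (s, ph s t) (t, pi - ph t s).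
Proof.
move=> st tL; have h := chord_gt0 ov st.
have ts : g t != g s by rewrite eq_sym.
have p0 := angle_gt0 ov ts; have p1 := angle_ltpi ov ts.
split; first by split => //=; lra.
  exists (ch s t); split => //=.
    by rewrite direction_angle// scalerA mulfV ?gt_eqF// scale1r addrC subrK.
  move=> l /andP[l0 lh]; rewrite direction_angle// scalerA.
  apply: chord_interior_notin => //.
  by rewrite divr_gt0//= ltr_pdivrMr ?mul1r.
rewrite direction_angle//=.
have -> : g t - g s = - (g s - g t) by rewrite opprB.
rewrite scalerN chordC -direction_angle//.
rewrite /direction /inward_normal/= cosB sinB cospi sinpi.
have := oval_unit ov t; move: (derive1 g t) (cos _) (sin _) => u x y uu.
rewrite /rot90 /dot; apply: injective_projections => /=; rewrite /GRing.scale/=.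
  have : u.2 * y * (u.1 ^+ 2 + u.2 ^+ 2) = u.2 * y by rewrite uu mulr1.
  by lra.
have : u.1 * y * (u.1 ^+ 2 + u.2 ^+ 2) = u.1 * y by rewrite uu mulr1.
by lra.
Qed.

Lemma billiard_map_chord s t : g s != g t -> 0 <= t < L ->
  T (s, ph s t) = (t, pi - ph t s).
Proof.
move=> st tL; rewrite /billiard_map/= (angle_gt0 ov) ?(angle_ltpi ov)//=.
case: xgetP => [y _ /= Hy|/(_ (t, pi - ph t s))].
  exact: (billiard_step_unique Hy (billiard_step_chord st tL)).
by case; exact: billiard_step_chord.
Qed.

Lemma billiard_map_phase x : phase L x -> phase L (T x).
Proof.
move=> px; rewrite /billiard_map; case: ifP => // _.
by case: xgetP => // y _ [].
Qed.

Lemma angle_of_billiard_map s t a : g s != g t -> 0 < a < pi ->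
  eq_param L (T (s, a)).1 t -> a = ph s t.
Proof.
move=> st a0 [m]; rewrite /billiard_map/= a0.
have h := chord_gt0 ov st.
case: xgetP => [y _ /= [_ [l [l0 gy _]] _] ym|_ /= sm]; last first.
  by move: st; rewrite sm (periodicz (oval_periodic ov)) eqxx.
have {}gy : g t - g s = l *: direction g (s, a).
  by apply/eqP; rewrite subr_eq addrC -gy ym (periodicz (oval_periodic ov)).
have [ca sa] := direction_decompose s a.
have E1 : ad s t = l * cos a.
  rewrite /advance gy -ca; move: (derive1 g s) (direction g _) => u v.
  by rewrite /dot/= /GRing.scale/=; ring.
have E2 : cr s t = l * sin a.
  rewrite /crossing gy -sa; move: (derive1 g s) (direction g _) => u v.
  by rewrite /cross/= /GRing.scale/=; ring.
have E3 : ch s t = l.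
  apply: (@pexpIrn _ 2) => //; rewrite ?nnegrE ?chord_ge0 ?(ltW l0)//.
  by rewrite -(chord_pythagoras ov s t) E1 E2 !exprMn -mulrDr cos2Dsin2 mulr1.
rewrite /angle E1 E3 mulrAC mulfV ?gt_eqF// mul1r cosK// in_itv/=.
by case/andP: a0 => a0 a1; rewrite !ltW.
Qed.

Lemma angle_toE s t : g s != g t -> angle_to L g s t = ph s t.
Proof.
move=> st; rewrite /angle_to; case: xgetP => [a _ /= [a0 H]|/(_ (ph s t))].
  exact: (angle_of_billiard_map st).
case; split; first by rewrite (angle_gt0 ov) ?(angle_ltpi ov).
have [m m0] := reduce_period L0 t; exists m.
rewrite -(periodicz (fun u => angle_periodicr ov s u) m t).
rewrite billiard_map_chord//.
by rewrite (periodicz (oval_periodic ov)).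
Qed.

Lemma derive1_angle_to s t : g s != g t ->
  derive1 (angle_to L g s) t = cr t s / ch s t ^+ 2.
Proof.
move=> st; have D := is_derive_angler ov st.
rewrite derive1E -[RHS](@derive_val _ _ _ _ _ _ _ D); apply: near_eq_derive.
have H : ch s u @[u --> t] --> ch s t := @chord_continuous _ _ _ _ ov s t.
have {}H := cvgr_gt (ch s t) H 0 (chord_gt0 ov st).
near=> u; have us : 0 < ch s u by near: u; exact: H.
rewrite angle_toE//.
by apply: contraTneq us => us; rewrite /chord -us !subrr expr0n/= addr0 sqrtr0 ltxx.
Unshelve. all: by end_near.
Qed.

Lemma density2E e x y s a : T x = (s, a) -> 0 <= s < L -> 0 <= y.1 < L ->
  y.1 != s ->
  density2 L g e x y = ((4 * e ^+ 2)^-1 * (cr y.1 s / ch s y.1 ^+ 2)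
    * (`|ph s y.1 - trunc_angle e a| <= e)%R%:R
    * (`|y.2 - trunc_angle e (pi - ph y.1 s)| <= e)%R%:R)%:E.
Proof.
move=> Tx s0 y0 ys; have st : g s != g y.1.
  by apply: contra_neq ys => /oval_inj_phase ->.
have ts : g y.1 != g s by rewrite eq_sym.
rewrite /density2 Tx (negbTE ys) derive1_angle_to// !angle_toE//.
rewrite billiard_map_chord//= ger0_norm// divr_ge0 ?sqr_ge0// ltW//.
exact: (oval_cross ov).
Qed.

End billiard_map.

(** * Lower bounds for the kernel and the densities *)

(** The integral of a non-negative function is a supremum over the simple functions
    below it, and [c] times the indicator of [A] is one of them; this holds even
    when [f] is not measurable. *)
Lemma integral_ge_measure d (T : measurableType d) (R : realType)
    (mu : {measure set T -> \bar R}) (D A : set T) (f : T -> \bar R) (c : R) :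
  measurable A -> A `<=` D -> 0 <= c -> (forall x, D x -> (0 <= f x)%E) ->
  (forall x, A x -> (c%:E <= f x)%E) ->
  (c%:E * mu A <= \int[mu]_(x in D) f x)%E.
Proof.
move=> mA AD c0 f0 fc; rewrite ge0_integralE//.
pose h := scale_nnsfun (indic_nnsfun R mA) c0.
have -> : (c%:E * mu A)%E = sintegral mu h.
  by rewrite -sintegral_indic -[X in (_ * sintegral mu X)%E]/(indic_nnsfun R mA : T -> R) -sintegralrM.
apply: ereal_sup_ubound; exists h => // x; rewrite /h/= /patch.
rewrite /mindic indicE; case: (boolP (x \in A)) => xA.
  have Ax : A x by rewrite -in_setE.
  by rewrite mulr1 mem_set ?fc//; exact: AD.
by rewrite mulr0; case: ifPn => [xD|_]; [apply: f0; rewrite -in_setE|exact: lexx].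
Qed.

Section kernel.
Context {R : realType} (L : R) (g : R -> R * R) (e : R).
Hypothesis e_pi : 0 < e < pi / 2.

Lemma trunc_angle_itv a : e <= trunc_angle e a <= pi - e.
Proof.
rewrite /trunc_angle le_min ge_min le_max !lexx orbT/= !orbT andbT.
by move: e_pi; lra.
Qed.

(** Truncation shifts the noise window into [[0, pi]] by the amount that sticks out
    of it, so no admissible angle leaves the window. *)
Lemma trunc_angle_near a u : 0 <= a <= pi -> 0 <= u <= pi ->
  `|u - a| <= e -> `|u - trunc_angle e a| <= e.
Proof.
move=> a0 u0; rewrite /trunc_angle !ler_norml; move: e_pi.
by rewrite /Num.min /Num.max; case: ifPn; case: ifPn; rewrite -?leNgt; lra.
Qed.

Lemma Q_eps_segment s a u1 u2 : u1 <= u2 ->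
  trunc_angle e a - e <= u1 -> u2 <= trunc_angle e a + e ->
  Q_eps e (s, a) ([set s] `*` `[u1, u2]) = ((u2 - u1) / (2 * e))%:E.
Proof.
move=> u12 l1 l2; rewrite /Q_eps/=.
have e0 : 0 <= (2 * e)^-1 by rewrite invr_ge0; lra.
under eq_integral do rewrite EFinM.
rewrite ge0_integralZr//; last first.
  apply/measurable_EFinP; apply/measurable_funTS.
  apply: (measurableT_comp _ (@pair1_measurable _ _ _ _ s)).
  by apply: measurable_indic; apply: measurableX.
rewrite (_ : (fun x : R => _) = (fun x : R => (\1_(`[u1, u2] : set R) x)%:E)); last first.
  apply/funext => x; congr EFin; rewrite !indicE; congr (nat_of_bool _)%:R.
  by apply/idP/idP => /set_mem H; apply/mem_set; [case: H|split].
rewrite integral_indic// setIidl; last first.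
  by move=> x; rewrite /= !in_itv/=; lra.
have := @lebesgue_measure_itv R `[u1, u2]; rewrite /= lte_fin => ->; case: ltP => u21.
  by rewrite -EFinB -EFinM.
by rewrite mul0e (_ : u2 - u1 = 0) ?mul0r//; lra.
Qed.

Lemma integral_P_eps_ge x s a u1 u2 (f : R * R -> \bar R) c :
  billiard_map L g x = (s, a) -> 0 <= s < L -> u1 <= u2 ->
  trunc_angle e a - e <= u1 -> u2 <= trunc_angle e a + e -> 0 <= c ->
  (forall z, (0 <= f z)%E) ->
  (forall u, u1 <= u <= u2 -> (c%:E <= f (s, u))%E) ->
  ((c * ((u2 - u1) / (2 * e)))%:E <= \int[P_eps L g e x]_(z in phase L) f z)%E.
Proof.
move=> Tx s0 u12 l1 l2 c0 f0 fc.
pose A : set (R * R) := [set s] `*` `[u1, u2].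
have := @integral_ge_measure _ _ _ (P_eps L g e x) (phase L) A f c.
rewrite /P_eps Tx EFinM.
rewrite -[X in (_ -> _ -> _ -> _ -> _ -> (_ * X <= _)%E) -> _]/(Q_eps e (s, a) A).
rewrite Q_eps_segment//; apply => //.
- by apply: measurableX => //; exact: measurable_set1.
- move=> [s' u] [/= -> ]; rewrite in_itv/= => uu; split => //=.
  by have := trunc_angle_itv a; lra.
- by move=> [s' u] [/= ->]; rewrite in_itv/=; exact: fc.
Qed.

Lemma density_ge0 n x y : (0 <= density L g e n x y)%E.
Proof.
rewrite /density; elim: (n - 2)%N x => [|m IH] x /=.
  rewrite /density2; case: (billiard_map _ _ _) => s a; case: ifP => // _.
  rewrite lee_fin; do 2 (apply: mulr_ge0; last exact: ler0n).
  by apply: mulr_ge0 => //; rewrite invr_ge0 mulr_ge0 ?sqr_ge0.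
by apply: integral_ge0 => z _; exact: IH.
Qed.

Lemma densityS n x y : (2 <= n)%N -> density L g e n.+1 x y =
  (\int[P_eps L g e x]_(z in phase L) density L g e n z y)%E.
Proof. by move=> n2; rewrite /density subSn. Qed.

Lemma density_step n x y s a u1 u2 c : (2 <= n)%N ->
  billiard_map L g x = (s, a) -> 0 <= s < L -> u1 <= u2 ->
  trunc_angle e a - e <= u1 -> u2 <= trunc_angle e a + e -> 0 <= c ->
  (forall u, u1 <= u <= u2 -> (c%:E <= density L g e n (s, u) y)%E) ->
  ((c * ((u2 - u1) / (2 * e)))%:E <= density L g e n.+1 x y)%E.
Proof.
move=> n2 Tx s0 u12 l1 l2 c0 fc; rewrite densityS//.
by apply: (integral_P_eps_ge Tx s0 u12 l1 l2 c0) => // z; exact: density_ge0.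
Qed.

(** The kernel is a probability on the phase space, so it averages the next density. *)
Lemma density_ge_persists n m b : (2 <= n)%N -> (n <= m)%N -> 0 <= b ->
  (forall x y, phase L x -> phase L y -> (b%:E <= density L g e n x y)%E) ->
  forall x y, phase L x -> phase L y -> (b%:E <= density L g e m x y)%E.
Proof.
move=> n2 nm b0 H; have -> : m = (n + (m - n))%N by rewrite subnKC.
elim: (m - n)%N => [|k IH] x y px py; first by rewrite addn0; exact: H.
rewrite addnS; have : phase L (billiard_map L g x) := billiard_map_phase g px.
case E : (billiard_map L g x) => [s a] [/= s0 a0].
have t := trunc_angle_itv a.
have := @density_step (n + k) x y s a (trunc_angle e a - e) (trunc_angle e a + e) b.
have -> : b * ((trunc_angle e a + e - (trunc_angle e a - e)) / (2 * e)) = b.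
  by field; rewrite gt_eqF//; case/andP: e_pi.
apply => //; first exact: leq_trans n2 (leq_addr _ _).
  by move: e_pi; lra.
by move=> u uu; apply: IH => //; split => //=; lra.
Qed.

End kernel.

(** * Growth of a set of directions at one point *)

Definition apart_itv {R : realType} (p q : R * R) : bool :=
  (p.2 <= q.1) || (q.2 <= p.1).

(** Non-overlapping intervals inside [[lo, hi]]: the first one cuts the others
    into those on its left and those on its right, and the increments of [F]
    telescope. *)
Lemma packing {R : realType} (F : R -> R) (s : seq (R * R)) (lo hi : R) :
  lo <= hi -> (forall u v, lo <= u -> u <= v -> v <= hi -> F u <= F v) ->
  all (fun p => (lo <= p.1 <= p.2) && (p.2 <= hi)) s -> pairwise apart_itv s ->
  \sum_(p <- s) (F p.2 - F p.1) <= F hi - F lo.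
Proof.
move: {2}(size s) (leqnn (size s)) => n.
elim: n s lo hi => [|n IH] [|p s] lo hi //= sn lohi mF.
- by move=> _ _; rewrite big_nil subr_ge0 mF.
- by move=> _ _; rewrite big_nil subr_ge0 mF.
rewrite ltnS in sn; move=> /andP[/andP[/andP[p1 p2] p3] sall] /andP[/allP pall spw].
have [p1h lp2] : p.1 <= hi /\ lo <= p.2 by split; lra.
rewrite big_cons (bigID (fun q => q.2 <= p.1))/= -big_filter -[X in _ + (_ + X)]big_filter.
set sl := [seq q <- s | q.2 <= p.1]; set sr := [seq q <- s | ~~ (q.2 <= p.1)].
have HL : \sum_(q <- sl) (F q.2 - F q.1) <= F p.1 - F lo.
  apply: IH => //.
  - by rewrite (leq_trans _ sn)// size_filter count_size.
  - by move=> u v u0 uv v1; apply: mF => //; lra.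
  - apply/allP => q; rewrite mem_filter => /andP[q2 qs]; rewrite q2 andbT.
    by have := allP sall _ qs => /andP[].
  - exact: subseq_pairwise (filter_subseq _ _) spw.
have HR : \sum_(q <- sr) (F q.2 - F q.1) <= F hi - F p.2.
  apply: IH => //.
  - by rewrite (leq_trans _ sn)// size_filter count_size.
  - by move=> u v u0 uv v1; apply: mF => //; lra.
  - apply/allP => q; rewrite mem_filter => /andP[q2 qs].
    have := allP sall _ qs => /andP[/andP[q3 q4] ->]; rewrite q4 !andbT.
    by have := pall _ qs; rewrite /apart_itv (negbTE q2) orbF.
  - exact: subseq_pairwise (filter_subseq _ _) spw.
lra.
Qed.

(** On the gap the density [sin] of the weight is at least the whole weight
    [1 - cos p] of the cap before it. *)
Lemma cap_gap {R : realType} (p q : R) : 0 <= p -> p <= q -> q <= pi / 2 ->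
  (q - p) * (1 - cos p) <= cos p - cos q.
Proof.
move=> p0 pq q2; have pi0 := pi_gt0 R.
have cc : {within `[p, q], continuous (@cos R)} by apply: continuous_subspaceT; exact: continuous_cos.
have [c] := MVT_segment pq (fun x _ => is_derive_cos x) cc.
rewrite in_itv/= => /andP[c1 c2] E.
have -> : cos p - cos q = sin c * (q - p) by rewrite -opprB E; ring.
rewrite mulrC ler_wpM2r ?subr_ge0//.
have cp : cos c <= cos p by apply: cos_nincr; lra.
have c0 : 0 <= cos c by apply: cos_ge0_pihalf; lra.
have s0 : 0 <= sin c by apply: sin_ge0_pi; lra.
have := cos2Dsin2 c; have := cos_le1 c; have := sin_le1 c; have := cos_le1 p.
move: (cos c) (sin c) (cos p) cp c0 s0 => C S P; nra.
Qed.

(** [phi k] is the direction of an object [k] seen from a node, and [[x k, y k]] the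
    interval of directions that it covers when seen from a nearby point. The weight
    of an interval is its increment of [- cos], the weight [sin] of directions
    in the invariant measure; [err] bounds the weight of what is not covered. *)
Record mesh {R : realType} (K : finType) (phi x y : K -> R) (eta err : R) : Prop := Mesh {
  mesh_ge0 : forall k, 0 <= x k;
  mesh_le : forall k, x k <= y k;
  mesh_lepi : forall k, y k <= pi;
  mesh_nearl : forall k, `|x k - phi k| <= eta;
  mesh_nearr : forall k, `|y k - phi k| <= eta;
  mesh_apart : forall k k', k != k' -> (y k <= x k') || (y k' <= x k);
  mesh_total : 2 - err <= \sum_k (cos (x k) - cos (y k)) }.

Section fattening.
Context {R : realType} (K : finType).
Implicit Types (phi x y : K -> R) (I Z : {set K}).

(** The directions in which a trajectory may leave after coming in along [I]. *)
Definition reflections phi (e1 : R) I : {set K} :=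
  [set k | [exists j in I, `|phi k + phi j - pi| < e1]].

Lemma mesh_width_ge0 phi x y eta err : mesh phi x y eta err ->
  forall k, 0 <= cos (x k) - cos (y k).
Proof.
by move=> m k; rewrite subr_ge0 cos_nincr ?(mesh_ge0 m) ?(mesh_le m) ?(mesh_lepi m).
Qed.

Lemma mesh_reflect phi x y eta err : mesh phi x y eta err ->
  mesh (fun k => pi - phi k) (fun k => pi - y k) (fun k => pi - x k) eta err.
Proof.
move=> [m1 m2 m3 m4 m5 m6 m7]; have cp (a : R) : cos (pi - a) = - cos a.
  by rewrite cosB cospi sinpi; ring.
split=> [k|k|k|k|k|k k' kk'|].
- by rewrite subr_ge0.
- by rewrite lerD2l lerN2.
- by rewrite gerBl.
- have -> : pi - y k - (pi - phi k) = - (y k - phi k) by ring.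
  by rewrite normrN.
- have -> : pi - x k - (pi - phi k) = - (x k - phi k) by ring.
  by rewrite normrN.
- by rewrite !lerD2l !lerN2; have := m6 _ _ kk'; rewrite orbC.
- by under eq_bigr do rewrite !cp opprK addrC.
Qed.

Lemma sum_reflect (P : pred K) x y :
  \sum_(k | P k) (cos (pi - y k) - cos (pi - x k)) =
  \sum_(k | P k) (cos (x k) - cos (y k)).
Proof. by apply: eq_bigr => k _; rewrite !cosB cospi sinpi; ring. Qed.

Lemma reflections_reflect phi e1 I :
  reflections (fun k => pi - phi k) e1 I = reflections phi e1 I.
Proof.
apply/setP => k; rewrite !inE; apply: eq_existsb => j; congr (_ && _).
by rewrite -normrN; congr (`|_| < _); ring.
Qed.

(** The cells outside [O], the reflected cells of [I], and a gap disjoint from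
    both, are packed in a half turn. *)
Lemma mesh_gap phi x y eta err e1 I (O : {set K}) p q : mesh phi x y eta err ->
  2 * eta <= e1 -> 0 <= p -> p <= q -> q <= pi ->
  (forall k j, k \notin O -> j \in I -> e1 <= `|phi k + phi j - pi|) ->
  (forall k, k \notin O -> y k <= p \/ q <= x k) ->
  (forall j, j \in I -> pi - x j <= p \/ q <= pi - y j) ->
  \sum_(j in I) (cos (x j) - cos (y j)) + (cos p - cos q) - err <=
  \sum_(k in O) (cos (x k) - cos (y k)).
Proof.
move=> m ee p0 pq qpi HOI HO HI.
pose s := (p, q) :: [seq (x k, y k) | k <- enum (~: O)] ++
                     [seq (pi - y j, pi - x j) | j <- enum I].
have cp (a : R) : cos (pi - a) = - cos a by rewrite cosB cospi sinpi; ring.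
have := @packing R (fun a => - cos a) s 0 pi (pi_ge0 R).
have -> : \sum_(r <- s) (- cos r.2 - - cos r.1) = (cos p - cos q) +
   (\sum_(k in ~: O) (cos (x k) - cos (y k)) + \sum_(j in I) (cos (x j) - cos (y j))).
  rewrite /s big_cons big_cat !big_map !big_enum/=; congr (_ + (_ + _)); first by ring.
    by apply: eq_bigr => k _; ring.
  by apply: eq_bigr => k _; rewrite !cp; ring.
rewrite cospi cos0 opprK => H.
have {}H : cos p - cos q + (\sum_(k in ~: O) (cos (x k) - cos (y k)) +
    \sum_(j in I) (cos (x j) - cos (y j))) <= 1 + 1.
  apply: H.
  - by move=> u v u0 uv vpi; rewrite lerN2 cos_nincr.
  - rewrite /s/= all_cat; apply/and3P; split; first by rewrite p0 pq.
      by apply/allP => _ /mapP[k _ ->]/=; rewrite (mesh_ge0 m) (mesh_le m) (mesh_lepi m).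
    apply/allP => _ /mapP[k _ ->]/=; have := mesh_ge0 m k; have := mesh_le m k.
    by have := mesh_lepi m k; lra.
  rewrite /s/= pairwise_cat all_cat; apply/andP; split.
    apply/andP; split; apply/allP => _ /mapP[k + ->]; rewrite mem_enum.
      by rewrite inE /apart_itv/= => /HO[->|->]//; rewrite orbT.
    by rewrite /apart_itv/= => /HI[->|->]//; rewrite orbT.
  have sub (f : K -> R * R) (J : {set K}) :
      (forall k k', k != k' -> apart_itv (f k) (f k')) ->
      pairwise apart_itv [seq f k | k <- enum J].
    move=> Hf; rewrite pairwise_map.
    apply: (@sub_pairwise _ (SimplRel (fun a b : K => a != b))) => [k k'|]; first exact: Hf.
    by rewrite -uniq_pairwise enum_uniq.
  apply/and3P; split.
  - apply/allrelP => _ _ /mapP[k + ->] /mapP[j + ->]; rewrite !mem_enum inE => kO jI.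
    have {}kO := HOI _ _ kO jI.
    have := mesh_nearl m k; have := mesh_nearr m k; have := mesh_nearl m j; have := mesh_nearr m j.
    rewrite /apart_itv/= !ler_norml => ? ? ? ?.
    by move: kO; rewrite ler_normr => /orP[] ?; apply/orP; [right|left]; lra.
  - by apply: sub => k k' /(mesh_apart m).
  - by apply: sub => k k' kk'; rewrite /apart_itv/= !lerD2l !lerN2 orbC (mesh_apart m).
have := mesh_total m; rewrite (bigID (mem O))/=.
rewrite [X in _ <= _ + X](eq_bigl (mem (~: O))); last by move=> k; rewrite !inE.
by move: H; set A := \sum_(_ in ~: _) _; set B := \sum_(_ in I) _; set C := \sum_(_ | _) _; lra.
Qed.

Lemma fattening_gap phi x y eta err e1 I p q : mesh phi x y eta err ->
  2 * eta <= e1 -> 0 <= p -> p <= q -> q <= pi ->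
  (forall k, k \notin reflections phi e1 I -> y k <= p \/ q <= x k) ->
  (forall j, j \in I -> pi - x j <= p \/ q <= pi - y j) ->
  \sum_(j in I) (cos (x j) - cos (y j)) + (cos p - cos q) - err <=
  \sum_(k in reflections phi e1 I) (cos (x k) - cos (y k)).
Proof.
move=> m ee p0 pq qpi; apply: (mesh_gap m ee) => // k j.
by rewrite inE => /existsPn/(_ j) + jI; rewrite jI/= -leNgt.
Qed.

Lemma mesh_near_pack phi x y eta err (Z : {set K}) t :
  mesh phi x y eta err -> 0 <= t -> t + eta <= pi ->
  (forall k, k \in Z -> phi k <= t) ->
  \sum_(k in Z) (cos (x k) - cos (y k)) <= 1 - cos (t + eta).
Proof.
move=> m t0 tpi HZ.
have [->|[k0 k0Z]] := set_0Vmem Z; first by rewrite big_set0 subr_ge0 cos_le1.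
have eta0 : 0 <= eta := le_trans (normr_ge0 _) (mesh_nearl m k0).
have := @packing R (fun a => - cos a) [seq (x k, y k) | k <- enum Z] 0 (t + eta).
rewrite big_map big_enum/= cos0 opprK [- _ + 1]addrC.
under eq_bigr do rewrite opprK addrC; apply.
- by rewrite addr_ge0.
- by move=> u v u0 uv v1; rewrite lerN2 cos_nincr//; lra.
- apply/allP => _ /mapP[k + ->]; rewrite mem_enum => /HZ kt/=.
  rewrite (mesh_ge0 m) (mesh_le m)/=; have := mesh_nearr m k.
  by rewrite ler_norml; lra.
rewrite pairwise_map; apply: (@sub_pairwise _ (SimplRel (fun a b : K => a != b))) => [k k'|].
  by move=> /(mesh_apart m).
by rewrite -uniq_pairwise enum_uniq.
Qed.

(** An empty stretch of length [e1 / 2] just above the cells of [Z] has at least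
    [e1 / 4] times their weight: this holds on the side of [0] where the weight
    [sin] increases. *)
Lemma fattening_step phi x y eta err e1 I (Z : {set K}) t :
  mesh phi x y eta err ->
  0 <= eta -> 8 * eta <= e1 -> 0 <= t -> t + e1 / 2 <= pi / 2 ->
  (forall k, k \notin reflections phi e1 I ->
     phi k <= t \/ t + e1 / 2 <= phi k) ->
  (forall j, j \in I -> pi - phi j <= t \/ t + e1 / 2 <= pi - phi j) ->
  \sum_(k in Z) (cos (x k) - cos (y k)) <= 1 - cos (t + eta) ->
  \sum_(j in I) (cos (x j) - cos (y j)) +
    e1 / 4 * \sum_(k in Z) (cos (x k) - cos (y k)) - err <=
  \sum_(k in reflections phi e1 I) (cos (x k) - cos (y k)).
Proof.
move=> m eta0 ee t0 tpi HO HI HZ; have pi0 := pi_gt0 R.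
pose p := t + eta; pose q := t + e1 / 2 - eta.
have p0 : 0 <= p by rewrite /p; lra.
have pq : p <= q by rewrite /p /q; lra.
have q2 : q <= pi / 2 by rewrite /q; lra.
have G := cap_gap p0 pq q2.
have F : \sum_(j in I) (cos (x j) - cos (y j)) + (cos p - cos q) - err <=
  \sum_(k in reflections phi e1 I) (cos (x k) - cos (y k)).
  apply: (fattening_gap m) => //; [lra|rewrite /q; lra| |].
  - move=> k /HO; have := mesh_nearl m k; have := mesh_nearr m k.
    by rewrite !ler_norml /p /q => ? ? []; [left|right]; lra.
  - move=> k /HI; have := mesh_nearl m k; have := mesh_nearr m k.
    by rewrite !ler_norml /p /q => ? ? []; [left|right]; lra.
apply: le_trans F; rewrite lerD2r lerD2l; apply: le_trans G.
have Z0 : 0 <= \sum_(k in Z) (cos (x k) - cos (y k)).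
  by apply: sumr_ge0 => k _; exact: mesh_width_ge0 m k.
apply: ler_pM => //; first lra.
by rewrite /p /q; lra.
Qed.

Lemma fattening0 phi x y eta err e1 I : mesh phi x y eta err -> 0 <= eta ->
  2 * eta <= e1 ->
  \sum_(j in I) (cos (x j) - cos (y j)) - err <=
  \sum_(k in reflections phi e1 I) (cos (x k) - cos (y k)).
Proof.
move=> m eta0 ee.
have := @fattening_gap phi x y eta err e1 I 0 0 m ee (lexx _) (lexx _) (pi_ge0 R).
rewrite subrr addr0; apply => k _; right; first exact: (mesh_ge0 m).
by rewrite subr_ge0 (mesh_lepi m).
Qed.

(** No incidence within [e1 / 2] of the normal: above the largest incidence below
    [pi / 2] there is an empty stretch. *)
Lemma fattening_center_gap phi x y eta err e1 I : mesh phi x y eta err ->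
  (forall k, 0 <= phi k <= pi) -> 0 <= eta -> 8 * eta <= e1 ->
  (forall j, j \in I -> e1 / 2 <= `|phi j - pi / 2|) ->
  \sum_(j in I) (cos (x j) - cos (y j)) +
    e1 / 4 * \sum_(j in I | pi / 2 <= phi j) (cos (x j) - cos (y j)) - err <=
  \sum_(k in reflections phi e1 I) (cos (x k) - cos (y k)).
Proof.
move=> m phi0 eta0 ee Hc.
pose Z : {set K} := [set j in I | pi / 2 <= phi j].
have -> : \sum_(j in I | pi / 2 <= phi j) (cos (x j) - cos (y j)) =
    \sum_(j in Z) (cos (x j) - cos (y j)) by apply: eq_bigl => j; rewrite [RHS]inE.
have [Z0|[j0 j0Z]] := set_0Vmem Z.
  rewrite Z0 big_set0 mulr0 addr0; apply: (@fattening0 phi x y eta err e1 I m eta0).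
  lra.
have [/= j jZ jmax] := @arg_maxP _ _ K j0 (mem Z) (fun j => pi - phi j) j0Z.
have {}jmax k : k \in Z -> pi - phi k <= pi - phi j by move=> /jmax.
have far k : k \in I -> phi k <= pi / 2 - e1 / 2 \/ pi / 2 + e1 / 2 <= phi k.
  by move=> /Hc; rewrite ler_normr => /orP[]; [right|left]; lra.
have : j \in Z := jZ; rewrite inE => /andP[jI jpi].
have jfar : pi / 2 + e1 / 2 <= phi j by case: (far _ jI); lra.
have jpi2 := phi0 j.
apply: (fattening_step (t := pi - phi j) m) => //; [lra|lra| | |].
- move=> k; rewrite inE => /existsPn/(_ j); rewrite jI/= -leNgt ler_normr.
  by move=> /orP[]; [right|left]; lra.
- move=> k kI; case: (far _ kI) => h; first by right; lra.
  by left; apply: jmax; rewrite inE kI/=; lra.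
have := mesh_near_pack (mesh_reflect m) (Z := Z) (t := pi - phi j).
by rewrite sum_reflect; apply => //; lra.
Qed.

(** An incidence within [e1 / 2] of the normal, but some exit directions missed:
    there is an empty stretch above the largest missed direction below [pi / 2]. *)
Lemma fattening_center_hit phi x y eta err e1 I j0 : mesh phi x y eta err ->
  (forall k, 0 <= phi k <= pi) -> 0 <= eta -> 8 * eta <= e1 ->
  j0 \in I -> `|phi j0 - pi / 2| < e1 / 2 ->
  \sum_(j in I) (cos (x j) - cos (y j)) +
    e1 / 4 * \sum_(k | (k \notin reflections phi e1 I) && (phi k <= pi / 2))
      (cos (x k) - cos (y k)) - err <=
  \sum_(k in reflections phi e1 I) (cos (x k) - cos (y k)).
Proof.
move=> m phi0 eta0 ee j0I; rewrite ltr_norml => Hj0.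
set O := reflections phi e1 I.
pose Z := finset (fun k => (k \notin O) && (phi k <= pi / 2)).
have -> : \sum_(k | (k \notin O) && (phi k <= pi / 2)) (cos (x k) - cos (y k)) =
    \sum_(k in Z) (cos (x k) - cos (y k)) by apply: eq_bigl => j; rewrite [RHS]inE.
have [Z0|[k0 k0Z]] := set_0Vmem Z.
  rewrite Z0 big_set0 mulr0 addr0; apply: (@fattening0 phi x y eta err e1 I m eta0).
  lra.
have [/= k kZ kmax] := @arg_maxP _ _ K k0 (mem Z) phi k0Z.
have {}kmax k' : k' \in Z -> phi k' <= phi k by move=> /kmax.
have : k \in Z := kZ; rewrite inE => /andP[kO kpi]; have kpi2 := phi0 k.
have kI j : j \in I -> phi k + phi j - pi <= - e1 \/ e1 <= phi k + phi j - pi.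
  move=> jI; move: kO; rewrite inE => /existsPn/(_ j); rewrite jI/= -leNgt ler_normr.
  by move=> /orP[]; [right|left]; lra.
have kfar : phi k <= pi / 2 - e1 / 2 by case: (kI _ j0I); lra.
apply: (fattening_step (t := phi k) m) => //; [lra|lra| | |].
- move=> k' k'O; have [h|h] := lerP (phi k') (pi / 2); last by right; lra.
  by left; apply: kmax; rewrite inE k'O.
- by move=> j /kI[]; [right|left]; lra.
apply: (mesh_near_pack m) => //; lra.
Qed.

Lemma sin_le_middle (u v : R) : 0 <= v -> v <= u -> u <= pi - v -> sin v <= sin u.
Proof.
move=> v0 vu uv.
have E (a : R) : sin a = cos (pi / 2 - a) by rewrite cosB cos_pihalf sin_pihalf; ring.
have E' (a : R) : sin a = cos (a - pi / 2) by rewrite cosB cos_pihalf sin_pihalf; ring.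
have pi0 := pi_gt0 R; have [h|h] := lerP u (pi / 2).
  by rewrite !E cos_nincr//; lra.
by rewrite E [in leRHS]E' cos_nincr//; lra.
Qed.

Lemma sin_ge_half (a : R) : 0 <= a <= 1 / 2 -> a / 2 <= sin a.
Proof.
move=> /andP[a0 a1].
have cc : {within `[0, a], continuous (@sin R)} by apply: continuous_subspaceT; exact: continuous_sin.
have [c] := MVT_segment a0 (fun t _ => is_derive_sin t) cc.
rewrite in_itv/= sin0 !subr0 => /andP[c0 c1] ->.
have cc' : {within `[0, c], continuous (@cos R)} by apply: continuous_subspaceT; exact: continuous_cos.
have [d _] := MVT_segment c0 (fun t _ => is_derive_cos t) cc'.
rewrite cos0 subr0; move=> E; have h : 1 / 2 <= cos c.
  by have := sin_le1 d; move: E; move: (sin d) (cos c) => u v; nra.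
have : 0 <= (cos c - 1 / 2) * a by apply: mulr_ge0; lra.
by lra.
Qed.

(** The directions close to a given one have a weight that is quadratic in the
    tolerance: grazing directions are the lightest. *)
Lemma mesh_target phi x y eta err e th : mesh phi x y eta err -> 0 <= eta ->
  4 * eta <= e -> e <= 1 -> 0 <= th <= pi ->
  e ^+ 2 / 32 - err <=
  \sum_(k | `|phi k - th| < e) (cos (x k) - cos (y k)).
Proof.
move=> m eta0 ee e1 th0; have pi2 := pi_ge2 R; have e0 : 0 <= e by lra.
have [p [p0 p1 p2 p3]] : exists p, [/\ 0 <= p, p + e / 2 <= pi, th - e / 2 <= p & p <= th].
  by have [h|h] := lerP th (pi / 2); [exists th|exists (th - e / 2)]; split; lra.
pose O : {set K} := finset (fun k => `|phi k - th| < e).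
have -> : \sum_(k | `|phi k - th| < e) (cos (x k) - cos (y k)) =
    \sum_(k in O) (cos (x k) - cos (y k)) by apply: eq_bigl => k; rewrite [RHS]inE.
have := @mesh_gap phi x y eta err (2 * eta) finset.set0 O p (p + e / 2) m (lexx _) p0.
rewrite big_set0 add0r => H; apply: le_trans (H _ p1 _ _ _).
- rewrite lerD2r; pose u := p + e / 4; pose v := e / 4.
  have -> : p = u - v by rewrite /u /v; ring.
  have -> : u - v + e / 2 = u + v by rewrite /u /v; field.
  have -> : cos (u - v) - cos (u + v) = 2 * sin u * sin v by rewrite (cosB u v) (cosD u v); ring.
  have s1 : sin v <= sin u by apply: sin_le_middle; rewrite /u /v; lra.
  have s2 : v / 2 <= sin v by apply: sin_ge_half; rewrite /v; lra.
  by move: s1 s2; rewrite /v; move: (sin u) (sin _) => a b; nra.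
- by lra.
- by move=> k j _; rewrite inE.
- move=> k; rewrite inE -leNgt; have := mesh_nearl m k; have := mesh_nearr m k.
  rewrite !ler_norml ler_normr => ? ? /orP[] ?; [right|left]; lra.
- by move=> j; rewrite inE.
Qed.

(** The alternative depends on [phi] and [I] alone, not on the mesh: hence it is
    the same for all the meshes close to [phi]. *)
Lemma fattening phi e1 I : (forall k, 0 <= phi k <= pi) ->
  (forall x y eta err, mesh phi x y eta err -> 0 <= eta -> 8 * eta <= e1 ->
    \sum_(j in I) (cos (x j) - cos (y j)) +
      e1 / 8 * \sum_(j in I) (cos (x j) - cos (y j)) - err <=
    \sum_(k in reflections phi e1 I) (cos (x k) - cos (y k))) \/
  (forall x y eta err, mesh phi x y eta err -> 0 <= eta -> 8 * eta <= e1 ->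
    \sum_(j in I) (cos (x j) - cos (y j)) +
      e1 / 8 * \sum_(k in ~: reflections phi e1 I) (cos (x k) - cos (y k)) - err <=
    \sum_(k in reflections phi e1 I) (cos (x k) - cos (y k))).
Proof.
move=> phi0; pose phi' k := pi - phi k.
have phi0' k : 0 <= phi' k <= pi by rewrite /phi'; have := phi0 k; lra.
have half (P Q : pred K) x y eta err : mesh phi x y eta err ->
    (forall k, Q k -> P k) ->
    \sum_(k | Q k) (cos (x k) - cos (y k)) <= \sum_(k | P k) (cos (x k) - cos (y k)).
  move=> m PQ; rewrite [leRHS](bigID Q)/=.
  have -> : \sum_(k | P k && Q k) (cos (x k) - cos (y k)) =
      \sum_(k | Q k) (cos (x k) - cos (y k)).
    by apply: eq_bigl => k; apply: andb_idl; exact: PQ.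
  by rewrite lerDl; apply: sumr_ge0 => k _; exact: (mesh_width_ge0 m).
have [|] := boolP [exists j in I, `|phi j - pi / 2| < e1 / 2].
  move=> /existsP[j0 /andP[j0I Hj0]]; right=> x y eta err m eta0 ee.
  have A := fattening_center_hit m phi0 eta0 ee j0I Hj0.
  have Hj0' : `|phi' j0 - pi / 2| < e1 / 2.
    have E : phi' j0 - pi / 2 = - (phi j0 - pi / 2) by rewrite /phi'; lra.
    by rewrite E normrN.
  have := fattening_center_hit (mesh_reflect m) phi0' eta0 ee j0I Hj0'.
  rewrite reflections_reflect !sum_reflect; set O := reflections phi e1 I in A *.
  have -> : \sum_(k | (k \notin O) && (phi' k <= pi / 2)) (cos (x k) - cos (y k)) =
      \sum_(k | (k \notin O) && (pi / 2 <= phi k)) (cos (x k) - cos (y k)).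
    by apply: eq_bigl => k; congr (_ && _); rewrite /phi'; apply/idP/idP; lra.
  have : \sum_(k in ~: O) (cos (x k) - cos (y k)) <=
     \sum_(k | (k \notin O) && (phi k <= pi / 2)) (cos (x k) - cos (y k)) +
     \sum_(k | (k \notin O) && (pi / 2 <= phi k)) (cos (x k) - cos (y k)).
    rewrite (bigID (fun k => phi k <= pi / 2))/= lerD//.
      by apply: (half _ _ _ _ _ _ m) => k; rewrite !inE.
    by apply: (half _ _ _ _ _ _ m) => k; rewrite !inE -ltNge => /andP[-> /ltW].
  move: A; set a := \sum_(_ in I) _; set b := \sum_(_ in ~: _) _.
  set c := \sum_(_ | _ && (phi _ <= _)) _; set d := \sum_(_ | _ && (_ <= phi _)) _.
  by set f := \sum_(_ in O) _; nra.
rewrite negb_exists => /forallP Hc; left=> x y eta err m eta0 ee.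
have Hc1 j : j \in I -> e1 / 2 <= `|phi j - pi / 2|.
  by move=> jI; have := Hc j; rewrite jI/= -leNgt.
have Hc2 j : j \in I -> e1 / 2 <= `|phi' j - pi / 2|.
  have E : phi' j - pi / 2 = - (phi j - pi / 2) by rewrite /phi'; lra.
  by move=> /Hc1; rewrite E normrN.
have A := fattening_center_gap m phi0 eta0 ee Hc1.
have := fattening_center_gap (mesh_reflect m) phi0' eta0 ee Hc2.
rewrite reflections_reflect !sum_reflect; set O := reflections phi e1 I in A *.
have -> : \sum_(k in I | pi / 2 <= phi' k) (cos (x k) - cos (y k)) =
    \sum_(k in I | phi k <= pi / 2) (cos (x k) - cos (y k)).
  by apply: eq_bigl => k; congr (_ && _); rewrite /phi'; apply/idP/idP; lra.
have : \sum_(k in I) (cos (x k) - cos (y k)) <=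
     \sum_(k | (k \in I) && (phi k <= pi / 2)) (cos (x k) - cos (y k)) +
     \sum_(k | (k \in I) && (pi / 2 <= phi k)) (cos (x k) - cos (y k)).
  rewrite (bigID (fun k => phi k <= pi / 2))/= lerD//.
  by apply: (half _ _ _ _ _ _ m) => k; rewrite -ltNge => /andP[-> /ltW].
move: A; set a := \sum_(_ in I) _.
set c := \sum_(_ | _ && (phi _ <= _)) _; set d := \sum_(_ | _ && (_ <= phi _)) _.
by set f := \sum_(_ in O) _; nra.
Qed.

End fattening.

(** * Weights of a grid of nodes on the boundary *)

Definition node {R : realType} (h : R) (k : nat) : R := k%:R * h.

Definition node_angle {R : realType} (g : R -> R * R) (h : R) (i k : nat) : R :=
  if k == i then 0 else angle g (node h i) (node h k).

(** The mixed second difference of the chord length over the arcs that start at nodes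
    [i] and [k]: the mass of the lines that meet both arcs, for the measure
    [sin phi ds dphi] that the billiard map preserves. *)
Definition weight {R : realType} (g : R -> R * R) (h : R) (i k : nat) : R :=
  if k == i then 0 else
  chord g (node h i.+1) (node h k.+1) + chord g (node h i) (node h k)
  - chord g (node h i.+1) (node h k) - chord g (node h i) (node h k.+1).

(** Seen from the point [s] of arc [i], arc [k] covers the directions from
    [cell_start] to [cell_end]; arc [i] itself gets the empty interval at [0]. *)
Definition cell_start {R : realType} (g : R -> R * R) (h : R) (i : nat) (s : R) (k : nat) : R :=
  if k == i then 0 else angle g s (node h k).

Definition cell_end {R : realType} (g : R -> R * R) (h : R) (i : nat) (s : R) (k : nat) : R :=
  if k == i then 0 else angle g s (node h k.+1).

Lemma cos_ge_sub {R : realType} (a : R) : 0 <= a -> 1 - a <= cos a.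
Proof.
move=> a0; have cc : {within `[0, a], continuous (@cos R)}.
  by apply: continuous_subspaceT; exact: continuous_cos.
have [c _] := MVT_segment a0 (fun x _ => is_derive_cos x) cc.
by rewrite cos0 subr0; have := sin_le1 c; move: (sin c) (cos a) => x y; nra.
Qed.

(** Renumbering of the nodes in the order in which they are met after node [i]. *)
Definition turn (N i k : nat) : nat := (k + (k < i)%N * N)%N.

Lemma turn_bounds (N : nat) (i k : 'I_N) : k != i ->
  (i < turn N i k)%N /\ (turn N i k < i + N)%N.
Proof.
have := ltn_ord k; have := ltn_ord i; rewrite /turn => iN kN ki.
have {}ki : nat_of_ord k <> nat_of_ord i by move=> E; move/eqP: ki; apply; exact: val_inj.
by case: ltnP => /= ?; rewrite ?mul1n ?mul0n ?addn0; lia.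
Qed.

Lemma turn_inj (N : nat) (i k k' : 'I_N) : k != k' ->
  (turn N i k < turn N i k')%N \/ (turn N i k' < turn N i k)%N.
Proof.
have := ltn_ord k; have := ltn_ord k'; have := ltn_ord i; rewrite /turn => iN kN kN' ki.
have {}ki : nat_of_ord k <> nat_of_ord k' by move=> E; move/eqP: ki; apply; exact: val_inj.
by case: (ltnP k i); case: (ltnP k' i) => /= ? ?; rewrite ?mul1n ?mul0n ?addn0; lia.
Qed.

Section grid.
Context {R : realType} (L : R) (g : R -> R * R) (K A : R).
Hypothesis ov : oval L g K.
Hypothesis A0 : 0 <= A.
Hypothesis HA : lipschitz_angle L g A.
Context (N : nat) (h : R).
Hypothesis h0 : 0 < h.
Hypothesis hN : N%:R * h = L.
Hypothesis N2 : (1 < N)%N.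

Local Notation ch := (chord g).
Local Notation ph := (angle g).
Local Notation nd := (node h).
Local Notation W := (weight g h).

Lemma nodeS k : nd k.+1 = nd k + h.
Proof. by rewrite /node -natr1 mulrDl mul1r. Qed.

Lemma nodeD j k : nd (j + k) = nd j + nd k.
Proof. by rewrite /node natrD mulrDl. Qed.

Lemma nodeDN k : nd (k + N) = nd k + L.
Proof. by rewrite nodeD {2}/node hN. Qed.

Lemma node_le j k : (nd j <= nd k) = (j <= k)%N.
Proof. by rewrite /node ler_pM2r// ler_nat. Qed.

Lemma node_lt j k : (nd j < nd k) = (j < k)%N.
Proof. by rewrite /node ltr_pM2r// ltr_nat. Qed.

Lemma angle_turn (i k : nat) s : ph s (nd k) = ph s (nd (turn N i k)).
Proof.
by rewrite /turn; case: (_ < _)%N; rewrite ?mul0n ?addn0// mul1n nodeDN (angle_periodicr ov).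
Qed.

Lemma angle_turnS (i k : nat) s : ph s (nd k.+1) = ph s (nd (turn N i k) + h).
Proof.
rewrite -nodeS /turn; case: (_ < _)%N; rewrite ?mul0n ?addn0// mul1n.
by rewrite -addSn nodeDN (angle_periodicr ov).
Qed.

Lemma turn_node (i k : 'I_N) s : k != i -> nd i <= s < nd i.+1 ->
  s < nd (turn N i k) /\ nd (turn N i k) + h <= nd i + L.
Proof.
move=> /(turn_bounds)[t1 t2] /andP[s1 s2]; split.
  by apply: (lt_le_trans s2); rewrite node_le.
by rewrite -nodeS -nodeDN node_le.
Qed.

Lemma node_apart (i k : 'I_N) : k != i -> g (nd i) != g (nd k).
Proof.
move=> ki; have [|t1 t2] := @turn_node i k (nd i) ki.
  by rewrite lexx nodeS ltrDl.
have hp := h0.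
have : g (nd i) != g (nd (turn N i k)) by apply: (oval_inj ov); lra.
rewrite /turn; case: (_ < _)%N; rewrite ?mul0n ?addn0// mul1n nodeDN.
by rewrite (oval_periodic ov).
Qed.

Lemma cell_near (i k : 'I_N) s : k != i -> nd i < s < nd i.+1 ->
  [/\ `|ph s (nd k) - ph (nd i) (nd k)| <= A * h,
      0 <= ph s (nd k.+1) - ph s (nd k) <= A * h,
      0 < ph s (nd k) & ph s (nd k.+1) < pi].
Proof.
move=> ki /andP[s1 s2]; have [|t1 t2] := @turn_node i k s ki; first by rewrite s2 ltW.
rewrite (angle_turn i k s) (angle_turn i k (nd i)) (angle_turnS i k s); move: (nd (turn N i k)) t1 t2 => t t1 t2.
have [HA1 HA2] := HA; have iL := nodeS i; have hp := h0.
have Ah : A * (s - nd i) <= A * h by rewrite ler_wpM2l//; lra.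
split.
- rewrite distrC; apply: le_trans Ah; apply: HA2; lra.
- by have := HA1 s t (t + h) t1; rewrite [t + h - t]addrC addKr; apply; lra.
- by apply: (angle_gt0 ov); apply: (oval_inj ov); lra.
- by apply: (angle_ltpi ov); apply: (oval_inj ov); lra.
Qed.

(** Seen from a point of arc [i] the other arcs follow one another; what they leave
    uncovered are the directions nearly tangent to arc [i]. *)
Lemma mesh_grid (i : 'I_N) s : nd i < s < nd i.+1 ->
  mesh (fun k : 'I_N => node_angle g h i k) (fun k : 'I_N => cell_start g h i s k)
    (fun k : 'I_N => cell_end g h i s k) (2 * A * h) (2 * A * h).
Proof.
move=> sI; have hp := h0; have Ah : 0 <= A * h by rewrite mulr_ge0// ltW.
have key (k : 'I_N) : [/\ 0 <= cell_start g h i s k, cell_start g h i s k <= cell_end g h i s k,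
    cell_end g h i s k <= pi, `|cell_start g h i s k - node_angle g h i k| <= 2 * A * h &
    `|cell_end g h i s k - node_angle g h i k| <= 2 * A * h].
  rewrite /cell_start /cell_end /node_angle; rewrite -[nat_of_ord k == i]/(k == i).
  have [_|ki] := eqVneq k i.
    by rewrite subrr normr0 pi_ge0; split => //; lra.
  have [c1 /andP[c2 c3] c4 c5] := @cell_near i k s ki sI.
  move: c1; rewrite !ler_norml => /andP[c11 c12].
  by split; lra.
split=> [k|k|k|k|k|k k' kk'|]; try by have [] := key k.
  have [p1 _ _ _ _] := key k; have [p2 _ _ _ _] := key k'.
  have [ki|ki] := eqVneq k i.
    by apply/orP; left; rewrite [cell_end _ _ _ _ _]/cell_end ki eqxx.
  have [k'i|k'i] := eqVneq k' i.
    by apply/orP; right; rewrite [cell_end _ _ _ _ _]/cell_end k'i eqxx.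
  rewrite /cell_start /cell_end; rewrite -[nat_of_ord k == i]/(k == i) -[nat_of_ord k' == i]/(k' == i).
  rewrite (negbTE ki) (negbTE k'i).
  have sI' : nd i <= s < nd i.+1 by move: sI; lra.
  have [t1 t2] := turn_node ki sI'; have [t1' t2'] := turn_node k'i sI'.
  rewrite (angle_turn i k) (angle_turn i k') (angle_turnS i k) (angle_turnS i k').
  have [HA1 _] := HA.
  have mono (u v : nat) : s < nd u + h -> nd v + h <= nd i + L -> (u < v)%N -> ph s (nd u + h) <= ph s (nd v).
    move=> su vL uv; have : nd u.+1 <= nd v by rewrite node_le.
    rewrite nodeS => uv'; have := HA1 s (nd u + h) (nd v) su uv'.
    by move: sI; lra.
  have [tt|tt] := turn_inj i kk'.
    by rewrite mono//; lra.
  by rewrite orbC mono//; lra.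
have tel : \sum_(k < N) (cos (cell_start g h i s k) - cos (cell_end g h i s k)) =
    cos (ph s (nd i.+1)) - cos (ph s (nd i)).
  rewrite (bigD1 i)//= /cell_start /cell_end eqxx subrr add0r.
  pose f k := cos (ph s (nd k)).
  have T : \sum_(k < N) (f k.+1 - f k) = 0.
    rewrite -(big_mkord xpredT (fun k => f k.+1 - f k)) telescope_sumr// /f.
    by rewrite -[N]add0n nodeDN (angle_periodicr ov) subrr.
  rewrite (bigD1 i)//= in T.
  transitivity (- \sum_(k < N | k != i) (f k.+1 - f k)); last by move: T; rewrite /f; lra.
  rewrite -sumrN; apply: eq_bigr => k ki.
  by rewrite -[nat_of_ord k == i]/(k == i) (negbTE ki) /f opprB.
rewrite tel; move: sI => /andP[s1 s2]; have iL := nodeS i.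
have NL : h + h <= L.
  rewrite -hN; have : 2%:R * h <= N%:R * h by rewrite ler_pM2r// ler_nat.
  by rewrite mulr_natl mulr2n.
have [n1 _] := angle_near ov HA (s := s) (t := nd i.+1) ltac:(lra).
have [_ n2] := angle_near ov HA (s := s) (t := nd i + L) ltac:(lra).
rewrite (angle_periodicr ov) in n2.
have q1 : 0 <= ph s (nd i.+1) by apply: ltW; apply: (angle_gt0 ov); apply: (oval_inj ov); lra.
have q2 : ph s (nd i) <= pi.
  by apply: ltW; apply: (angle_ltpi ov); apply: (oval_apartC ov); lra.
have c1 := cos_ge_sub q1.
have c2 : cos (ph s (nd i)) <= - (1 - (pi - ph s (nd i))).
  rewrite lerNr -[X in _ <= X](_ : cos (pi - ph s (nd i)) = _); last by rewrite cosB cospi sinpi; ring.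
  by apply: cos_ge_sub; lra.
have B1 : A * (nd i.+1 - s) <= A * h by rewrite ler_wpM2l//; lra.
have B2 : A * (s + L - (nd i + L)) <= A * h by rewrite ler_wpM2l//; lra.
by move: n1 n2 c1 c2 B1 B2; set a := ph _ _; set b := ph _ _; set c := cos _; set d := cos _; lra.
Qed.

(** By the first variation of the chord length, the row [i] of [weight] is made of
    differences of cosines seen from one point of the arc; that point depends on the
    linear combination [c]. *)
Lemma grid_mvt (i : 'I_N) (c : 'I_N -> R) : exists2 s, nd i < s < nd i.+1 &
  \sum_(k < N) c k * W i k =
  h * \sum_(k < N) c k * (cos (cell_start g h i s k) - cos (cell_end g h i s k)).
Proof.
have hp := h0; pose c' (k : 'I_N) := if k == i then 0 else c k.
pose D (k : 'I_N) (s : R) := c' k * (ch s (nd k.+1) - ch s (nd k)).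
pose dD (s : R) (k : 'I_N) := c' k * (cos (ph s (nd k)) - cos (ph s (nd k.+1))).
have apart s (k : nat) : (k <= N)%N -> nd i < s < nd i.+1 -> g (nd k) != g s.
  move=> kN /andP[s1 s2]; have NL : nd N = L := hN.
  have iN : nd i.+1 <= L by rewrite -NL node_le.
  have i0 : 0 <= nd i by rewrite mulr_ge0// ltW.
  have k0 : 0 <= nd k by rewrite mulr_ge0// ltW.
  have kL : nd k <= L by rewrite -NL node_le.
  have [ki|ki] := leqP k i.
    have : nd k <= nd i by rewrite node_le.
    by move=> ?; apply: (oval_inj ov); lra.
  have : nd i.+1 <= nd k by rewrite node_le.
  by move=> ?; apply: (oval_apartC ov); lra.
have dch s t : g t != g s -> is_derive s 1 (fun u => ch u t) (- cos (ph s t)).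
  move=> ts; have := is_derive_chord ov ts.
  by rewrite (_ : ch t = fun u => ch u t)//; apply/funext => u; rewrite chordC.
have dDk s : nd i < s < nd i.+1 -> forall k, is_derive s 1 (D k) (dD s k).
  move=> sI k; have d1 := dch _ _ (apart s k (ltnW (ltn_ord k)) sI).
  have d2 := dch _ _ (apart s k.+1 (ltn_ord k) sI).
  by rewrite /D /dD; apply: is_derive_eq; rewrite /GRing.scale/=; ring.
have cD : {within `[nd i, nd i.+1], continuous (\sum_(k < N) D k)}.
  apply: continuous_subspaceT; apply: (big_ind (fun f : R -> R => continuous f)).
  - exact: cst_continuous.
  - by move=> f1 f2 c1 c2 x; apply: continuousD; [exact: c1|exact: c2].
  move=> k _ s; apply: cvgM; first exact: cvg_cst.
  have cc t : (fun u => ch u t) x @[x --> s] --> ch s t.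
    rewrite (_ : (fun u => ch u t) = ch t); last by apply/funext => u; rewrite chordC.
    by rewrite [ch s t]chordC; exact: (@chord_continuous _ _ _ _ ov t).
  by apply: cvgB; exact: cc.
have lt : nd i < nd i.+1 by rewrite node_lt.
have dS s : s \in `]nd i, nd i.+1[ -> is_derive s 1 (\sum_(k < N) D k) (\sum_(k < N) dD s k).
  by rewrite in_itv/= => sI; apply: is_derive_sum => k; exact: dDk.
have [s] := MVT lt dS cD; rewrite in_itv/= => sI E.
exists s => //.
transitivity (\sum_(k < N) dD s k * h); last first.
  rewrite -mulr_suml mulrC; congr (_ * _); apply: eq_bigr => k _.
  rewrite /dD /c' /cell_start /cell_end -[nat_of_ord k == i]/(k == i).
  by case: eqVneq => _; rewrite ?subrr ?mulr0 ?mul0r.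
rewrite (_ : nd i.+1 - nd i = h) in E; last by rewrite nodeS; ring.
rewrite -mulr_suml -E !fct_sumE -sumrB; apply: eq_bigr => k _.
rewrite /D /c' /weight -[nat_of_ord k == i]/(k == i).
by case: eqVneq => _; rewrite ?mulr0 ?mul0r ?subrr//; ring.
Qed.

Lemma weight_mvt (i k : 'I_N) : exists2 s, nd i < s < nd i.+1 &
  W i k = h * (cos (cell_start g h i s k) - cos (cell_end g h i s k)).
Proof.
have pick (F : 'I_N -> R) : \sum_(k' < N) (k' == k)%:R * F k' = F k.
  rewrite (bigD1 k)//= eqxx mul1r big1 ?addr0// => k' /negbTE ->.
  by rewrite mul0r.
by have [s sI] := grid_mvt i (fun k' => (k' == k)%:R); rewrite !pick; exists s.
Qed.

Lemma weight_ge0 (i k : 'I_N) : 0 <= W i k.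
Proof.
have [s sI ->] := weight_mvt i k.
by apply: mulr_ge0; [exact: ltW|exact: (mesh_width_ge0 (mesh_grid sI) k)].
Qed.

Lemma weightC (i k : 'I_N) : W i k = W k i.
Proof.
rewrite /weight -[nat_of_ord k == i]/(k == i) -[nat_of_ord i == k]/(i == k) [i == k]eq_sym.
case: eqVneq => // _.
by rewrite [ch (nd k.+1) (nd i.+1)]chordC [ch (nd k) (nd i)]chordC
  [ch (nd k.+1) (nd i)]chordC [ch (nd k) (nd i.+1)]chordC; ring.
Qed.

Lemma weight_row (i : 'I_N) : \sum_(k < N) W i k = 2 * ch (nd i) (nd i.+1).
Proof.
pose f k := ch (nd i.+1) (nd k) - ch (nd i) (nd k).
have T : \sum_(k < N) (f k.+1 - f k) = 0.
  rewrite -(big_mkord xpredT (fun k => f k.+1 - f k)) telescope_sumr// /f.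
  have -> : nd N = nd 0 + L by rewrite -nodeDN add0n.
  by rewrite !(chord_periodicr ov) subrr.
rewrite (bigD1 i)//= in T; rewrite (bigD1 i)//= {1}/weight eqxx add0r.
transitivity (\sum_(k < N | k != i) (f k.+1 - f k)).
  apply: eq_bigr => k ki; rewrite /weight -[nat_of_ord k == i]/(k == i) (negbTE ki) /f.
  by ring.
move: T; rewrite /f !chordxx [ch (nd i.+1) (nd i)]chordC; lra.
Qed.

Lemma step_lt : h < L.
Proof. by rewrite -hN -[X in X < _]mul1r ltr_pM2r// ltr1n. Qed.

Lemma weight_row_le (i : 'I_N) : \sum_(k < N) W i k <= 2 * h.
Proof.
rewrite weight_row; have := step_lt; have hp := h0 => hL.
have := @chord_le _ _ _ _ ov (nd i) (nd i.+1); rewrite nodeS.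
have -> : nd i + h - nd i = h by ring.
move=> H; have {}H := H ltac:(lra).
by move: H; rewrite -nodeS; set c := ch _ _; lra.
Qed.

Lemma weight_row_ge (i : 'I_N) : h <= (4 * K)^-1 -> h <= \sum_(k < N) W i k.
Proof.
move=> hK; rewrite weight_row; have hp := h0.
have := chord_near ov (s := nd i) (t := nd i.+1); rewrite nodeS.
have -> : nd i + h - nd i = h by ring.
by rewrite gtr0_norm//; exact.
Qed.

(** [fattening], seen from the point that [grid_mvt] provides. The order matters: the
    alternative of [fattening] is settled first, since the point depends on it. *)
Lemma node_growth (i : 'I_N) (I : {set 'I_N}) (e1 : R) :
  16 * A * h <= e1 ->
  let O := reflections (fun k : 'I_N => node_angle g h i k) e1 I in
  let a := \sum_(j in I) W i j in let o := \sum_(k in O) W i k in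
  a + e1 / 8 * a - 2 * A * h ^+ 2 <= o \/
  a + e1 / 8 * (\sum_(k < N) W i k - o) - 2 * A * h ^+ 2 <= o.
Proof.
move=> he O a o.
have pos (k : 'I_N) : 0 <= node_angle g h i k <= pi.
  rewrite /node_angle -[nat_of_ord k == i]/(k == i); case: eqVneq => [_|ki].
    by rewrite lexx pi_ge0.
  by have ik := node_apart ki; rewrite !ltW ?(angle_gt0 ov) ?(angle_ltpi ov).
have eta0 : 0 <= 2 * A * h by rewrite !mulr_ge0// ltW.
have eta1 : 8 * (2 * A * h) <= e1 by move: he; lra.
have ind (S : {set 'I_N}) F : \sum_(k in S) F k = \sum_(k < N) (k \in S)%:R * F k :> R.
  by rewrite big_mkcond; apply: eq_bigr => k _; case: (k \in S); rewrite ?mul1r ?mul0r.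
have lin (c : 'I_N -> R) :
    (forall s, nd i < s < nd i.+1 -> - (2 * A * h) <=
      \sum_(k < N) c k * (cos (cell_start g h i s k) - cos (cell_end g h i s k))) ->
    - (2 * A * h ^+ 2) <= \sum_(k < N) c k * W i k.
  move=> H; have [s sI ->] := grid_mvt i c.
  have -> : - (2 * A * h ^+ 2) = h * - (2 * A * h) by ring.
  by rewrite ler_pM2l//; exact: H.
case: (@fattening _ _ (fun k : 'I_N => node_angle g h i k) e1 I pos) => H; [left|right].
  pose c (k : 'I_N) : R := (k \in O)%:R - (1 + e1 / 8) * (k \in I)%:R.
  have E F : \sum_(k < N) c k * F k = \sum_(k in O) F k - (1 + e1 / 8) * \sum_(k in I) F k.
    rewrite !ind mulr_sumr -sumrB; apply: eq_bigr => k _; rewrite /c; ring.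
  have := lin c; rewrite E -/a -/o => Hl.
  suff : - (2 * A * h ^+ 2) <= o - (1 + e1 / 8) * a by lra.
  apply: Hl => s sI; rewrite E.
  have := H _ _ _ _ (mesh_grid sI) eta0 eta1; rewrite -/O.
  by set x := \sum_(_ in I) _; set y := \sum_(_ in O) _; lra.
pose c (k : 'I_N) : R := (k \in O)%:R - (k \in I)%:R - e1 / 8 * (k \in ~: O)%:R.
have E F : \sum_(k < N) c k * F k = \sum_(k in O) F k - \sum_(k in I) F k -
    e1 / 8 * \sum_(k in ~: O) F k.
  rewrite !ind mulr_sumr -!sumrB; apply: eq_bigr => k _; rewrite /c; ring.
have := lin c; rewrite E -/a -/o => Hl.
have -> : \sum_(k < N) W i k - o = \sum_(k in ~: O) W i k.
  rewrite (bigID (mem O))/= -/o addrAC subrr add0r.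
  by apply: eq_bigl => k; rewrite [RHS]inE.
suff : - (2 * A * h ^+ 2) <= o - a - e1 / 8 * \sum_(k in ~: O) W i k by lra.
apply: Hl => s sI; rewrite E.
have := H _ _ _ _ (mesh_grid sI) eta0 eta1; rewrite -/O.
by set x := \sum_(_ in I) _; set y := \sum_(_ in O) _; set z := \sum_(_ in ~: O) _; lra.
Qed.

End grid.

(** * Growth of a set of pairs in a weighted graph *)

Section finite_flow.
Context {R : realType} (V : finType) (W : V -> V -> R) (h k0 : R).
Hypothesis W0 : forall i k, 0 <= W i k.
Hypothesis WC : forall i k, W i k = W k i.
Hypothesis h0 : 0 < h.
Hypothesis Wrow : forall i, \sum_k W i k <= 2 * h.
Hypothesis Wmix : forall a c, k0 <= \sum_x W a x * W c x.

Implicit Type B : V -> V -> bool.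

Definition row_mass i : R := \sum_k W i k.
Definition out_mass B i : R := \sum_(k | B i k) W i k.
Definition in_mass B i : R := \sum_(j | B j i) W i j.
Definition mass B : R := \sum_i out_mass B i.
Definition total_mass : R := \sum_i row_mass i.

Lemma out_mass_itv B i : 0 <= out_mass B i <= row_mass i.
Proof.
rewrite sumr_ge0//= /row_mass (bigID (B i))/= lerDl.
by rewrite sumr_ge0.
Qed.

Lemma in_mass_itv B i : 0 <= in_mass B i <= row_mass i.
Proof.
rewrite sumr_ge0//= /row_mass (bigID (fun j => B j i))/= lerDl.
by rewrite sumr_ge0.
Qed.

Lemma row_mass_itv i : 0 <= row_mass i <= 2 * h.
Proof. by rewrite Wrow andbT sumr_ge0. Qed.

Lemma mass_in B : mass B = \sum_i in_mass B i.
Proof.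
rewrite /mass /out_mass /in_mass.
under eq_bigr do rewrite big_mkcond/=.
under [RHS]eq_bigr do rewrite big_mkcond/=.
rewrite exchange_big/=; apply: eq_bigr => i _; apply: eq_bigr => j _.
by rewrite WC.
Qed.

(** A pair of weight in [B] and a pair of weight outside [B] are joined by a
    path that changes one end at a time; one of its three moves crosses the
    boundary of [B], inside a row or inside a column. *)
Lemma flow_mixing B :
  k0 * (mass B * (total_mass - mass B)) <=
  (2 * h) ^+ 2 * (2 * \sum_i out_mass B i * (row_mass i - out_mass B i) +
                  \sum_i in_mass B i * (row_mass i - in_mass B i)).
Proof.
pose o := out_mass B; pose f := in_mass B; pose r := row_mass.
pose al a x := (B a x)%:R * W a x : R; pose be a x := (~~ B a x)%:R * W a x : R.
have al0 a x : 0 <= al a x by rewrite mulr_ge0.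
have be0 a x : 0 <= be a x by rewrite mulr_ge0.
have oE a : \sum_x al a x = o a.
  rewrite /o /out_mass [RHS]big_mkcond; apply: eq_bigr => x _.
  by rewrite /al; case: (B a x); rewrite ?mul1r ?mul0r.
have fE x : \sum_a al a x = f x.
  rewrite /f /in_mass [RHS]big_mkcond; apply: eq_bigr => a _.
  by rewrite /al WC; case: (B a x); rewrite ?mul1r ?mul0r.
have split1 a x : W a x = al a x + be a x.
  by rewrite /al /be; case: (B a x); rewrite ?mul1r ?mul0r ?addr0 ?add0r.
have beE a : \sum_x be a x = r a - o a.
  have -> : r a = o a + \sum_x be a x.
    by rewrite -oE -big_split/=; apply: eq_bigr => x _; exact: split1.
  by rewrite addrAC subrr add0r.
have fbE x : \sum_a be a x = r x - f x.
  have -> : r x = f x + \sum_a be a x.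
    by rewrite -fE -big_split/=; apply: eq_bigr => a _; rewrite WC; exact: split1.
  by rewrite addrAC subrr add0r.
have o0 a : 0 <= o a <= r a by exact: out_mass_itv.
have r0 a : 0 <= r a <= 2 * h by exact: row_mass_itv.
have hp := h0.
have wr x : \sum_c W c x * r c <= (2 * h) ^+ 2.
  apply: (@le_trans _ _ (\sum_c W x c * (2 * h))).
    by apply: ler_sum => c _; rewrite WC ler_wpM2l//; have /andP[] := r0 c.
  rewrite -mulr_suml expr2; apply: ler_wpM2r; first by lra.
  exact: Wrow.
have lhs : k0 * (mass B * (total_mass - mass B)) <=
    \sum_a \sum_c \sum_x o a * (r c - o c) * (W a x * W c x).
  have -> : total_mass - mass B = \sum_c (r c - o c) by rewrite sumrB.
  rewrite /mass mulr_suml mulr_sumr; apply: ler_sum => a _.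
  rewrite mulr_sumr mulr_sumr; apply: ler_sum => c _.
  rewrite -mulr_sumr mulrC; apply: ler_wpM2l => //.
  by have := o0 a; have := o0 c; move=> /andP[? ?] /andP[? ?]; rewrite mulr_ge0// subr_ge0.
apply: (le_trans lhs).
have point a c x : o a * (r c - o c) * (W a x * W c x) <=
    o a * be a x * (W c x * r c) + (r a * al a x) * (r c * be c x) +
    (r c - o c) * al c x * (W a x * r a).
  have := W0 a x; have := W0 c x; have := o0 a; have := o0 c; have := r0 a; have := r0 c.
  rewrite /al /be; move: (W a x) (W c x) (o a) (o c) (r a) (r c) => w w' oa oc ra rc.
  move=> /andP[rc0 _] /andP[ra0 _] /andP[oc0 oc1] /andP[oa0 oa1] w0' w0.
  have p1 : 0 <= w * w' by rewrite mulr_ge0.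
  have p2 : 0 <= rc - oc by lra.
  case: (B a x); case: (B c x); rewrite /= !(mul1r, mul0r, mulr0, addr0, add0r).
  - have -> : (rc - oc) * w' * (w * ra) = ra * (rc - oc) * (w * w') by ring.
    by rewrite ler_wpM2r// ler_wpM2r.
  - have -> : ra * w * (rc * w') = ra * rc * (w * w') by ring.
    by rewrite ler_wpM2r// ler_pM//; lra.
  - have -> : oa * w * (w' * rc) = oa * rc * (w * w') by ring.
    have H : oa * (rc - oc) * (w * w') <= oa * rc * (w * w').
      by rewrite ler_wpM2r// ler_wpM2l//; lra.
    by apply: (le_trans H); rewrite lerDl !mulr_ge0.
  - have -> : oa * w * (w' * rc) = oa * rc * (w * w') by ring.
    by rewrite ler_wpM2r// ler_wpM2l//; lra.
apply: (@le_trans _ _ (\sum_a \sum_c \sum_x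
    (o a * be a x * (W c x * r c) + (r a * al a x) * (r c * be c x) +
    (r c - o c) * al c x * (W a x * r a)))).
  by apply: ler_sum => a _; apply: ler_sum => c _; apply: ler_sum => x _; exact: point.
under eq_bigr do under eq_bigr do rewrite !big_split/=.
under eq_bigr do rewrite !big_split/=.
rewrite !big_split/=.
have T1 : \sum_a \sum_c \sum_x o a * be a x * (W c x * r c) <=
    (2 * h) ^+ 2 * \sum_a o a * (r a - o a).
  rewrite mulr_sumr; apply: ler_sum => a _; rewrite exchange_big/=.
  have -> : (2 * h) ^+ 2 * (o a * (r a - o a)) = \sum_x o a * be a x * (2 * h) ^+ 2.
    by rewrite -mulr_suml -mulr_sumr beE mulrC.
  apply: ler_sum => x _; rewrite -mulr_sumr; apply: ler_wpM2l; last exact: wr.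
  by rewrite mulr_ge0//; have /andP[] := o0 a.
have T3 : \sum_a \sum_c \sum_x (r c - o c) * al c x * (W a x * r a) <=
    (2 * h) ^+ 2 * \sum_a o a * (r a - o a).
  rewrite exchange_big/= mulr_sumr; apply: ler_sum => c _; rewrite exchange_big/=.
  have -> : (2 * h) ^+ 2 * (o c * (r c - o c)) = \sum_x (r c - o c) * al c x * (2 * h) ^+ 2.
    by rewrite -mulr_suml -mulr_sumr oE; ring.
  apply: ler_sum => x _; rewrite -mulr_sumr; apply: ler_wpM2l; last exact: wr.
  by rewrite mulr_ge0// subr_ge0; have /andP[] := o0 c.
have T2 : \sum_a \sum_c \sum_x r a * al a x * (r c * be c x) <=
    (2 * h) ^+ 2 * \sum_x f x * (r x - f x).
  under eq_bigr do rewrite exchange_big/=.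
  rewrite exchange_big/= mulr_sumr; apply: ler_sum => x _.
  under eq_bigr do rewrite -mulr_sumr.
  rewrite -mulr_suml -fbE -fE expr2 mulrACA.
  have le (F : V -> R) : (forall a, 0 <= F a) -> \sum_a r a * F a <= 2 * h * \sum_a F a.
    move=> F0; rewrite mulr_sumr; apply: ler_sum => a _; apply: ler_wpM2r => //.
    by have /andP[] := r0 a.
  have ge (F : V -> R) : (forall a, 0 <= F a) -> 0 <= \sum_a r a * F a.
    by move=> F0; apply: sumr_ge0 => a _; rewrite mulr_ge0//; have /andP[] := r0 a.
  by apply: ler_pM; rewrite ?ge ?le.
rewrite -/o -/f -/r.
move: T1 T2 T3; set t1 := \sum_a _; set t2 := \sum_a _; set t3 := \sum_a _.
by set u := \sum_a _; set v := \sum_x _; lra.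
Qed.

(** If at every vertex the outgoing mass exceeds the incoming one by a fixed proportion
    of the latter or of what is still missed, then the gain is at least of order
    [x * (r - x)], [x] being either of these masses and [r] the mass of the vertex;
    [flow_mixing] bounds the sum of these products from below. *)
Lemma mass_growth (B : nat -> V -> V -> bool) (c de : R) :
  0 <= c <= 1 -> 0 <= de ->
  (forall n i,
     in_mass (B n) i + c * in_mass (B n) i - de <= out_mass (B n.+1) i \/
     in_mass (B n) i + c * (row_mass i - out_mass (B n.+1) i) - de
       <= out_mass (B n.+1) i) ->
  (forall n, mass (B n) - #|V|%:R * de <= mass (B n.+1)) /\
  (forall n, mass (B n) + c * k0 / (32 * h ^+ 3) *
       (mass (B n.+1) * (total_mass - mass (B n.+1))) - 2 * (#|V|%:R * de)
     <= mass (B n.+2)).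
Proof.
move=> /andP[c0 c1] de0 H.
have sumde : \sum_(i : V) de = #|V|%:R * de by rewrite sumr_const mulr_natl.
have mono n i : in_mass (B n) i - de <= out_mass (B n.+1) i.
  have /andP[f0 f1] := in_mass_itv (B n) i.
  have /andP[w0 w1] := out_mass_itv (B n.+1) i.
  by case: (H n i); nra.
have sq (x r : R) : 0 <= x <= r -> r <= 2 * h -> x * (r - x) / (2 * h) <= x /\
    x * (r - x) / (2 * h) <= r - x.
  have hp := h0; move=> /andP[x0 xr] rh; split; rewrite ler_pdivrMr ?mulr_gt0//.
    by rewrite ler_wpM2l//; lra.
  by rewrite [x * _]mulrC ler_wpM2l//; lra.
have gain n i : c / 2 * (out_mass (B n.+1) i * (row_mass i - out_mass (B n.+1) i) / (2 * h))
      <= out_mass (B n.+1) i - in_mass (B n) i + de /\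
    c / 2 * (in_mass (B n) i * (row_mass i - in_mass (B n) i) / (2 * h))
      <= out_mass (B n.+1) i - in_mass (B n) i + de.
  have fi := in_mass_itv (B n) i; have oi := out_mass_itv (B n.+1) i.
  have /andP[r0 r1] := row_mass_itv i.
  have [s1 s2] := sq _ _ oi r1; have [s3 s4] := sq _ _ fi r1.
  move: fi oi s1 s2 s3 s4 (H n i) => /andP[f0 f1] /andP[w0 w1].
  move: (_ / _) (_ / (2 * h)) => x y; move: (in_mass _ _) f0 f1 => f f0 f1.
  move: (out_mass _ _) (row_mass i) w0 w1 f1 => o r w0 w1 f1 s1 s2 s3 s4 [h1|h1].
    by split; [have [?|?] := lerP (o / 2) f; nra|nra].
  by split; [nra|have [?|?] := lerP ((r - f) / 2) (r - o); nra].
have hp := h0.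
have gain1 n : c / (4 * h) * \sum_i out_mass (B n.+1) i * (row_mass i - out_mass (B n.+1) i)
    <= mass (B n.+1) - mass (B n) + #|V|%:R * de.
  rewrite (mass_in (B n)) -sumde -sumrB -big_split/= mulr_sumr; apply: ler_sum => i _.
  have [G _] := gain n i; apply: le_trans G; rewrite le_eqVlt; apply/orP; left; apply/eqP.
  by field; rewrite gt_eqF.
have gain2 n : c / (4 * h) * \sum_i in_mass (B n) i * (row_mass i - in_mass (B n) i)
    <= mass (B n.+1) - mass (B n) + #|V|%:R * de.
  rewrite (mass_in (B n)) -sumde -sumrB -big_split/= mulr_sumr; apply: ler_sum => i _.
  have [_ G] := gain n i; apply: le_trans G; rewrite le_eqVlt; apply/orP; left; apply/eqP.
  by field; rewrite gt_eqF.
split=> n.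
  by rewrite (mass_in (B n)) -sumde -sumrB; apply: ler_sum => i _; exact: mono.
have M := flow_mixing (B n.+1).
have V0 : 0 <= \sum_i in_mass (B n.+1) i * (row_mass i - in_mass (B n.+1) i).
  apply: sumr_ge0 => i _; have /andP[? ?] := in_mass_itv (B n.+1) i.
  by rewrite mulr_ge0// subr_ge0.
have := gain1 n; have := gain2 n.+1; move: M V0.
set vo := \sum_i out_mass _ _ * _; set vi := \sum_i in_mass _ _ * _.
set mm := mass (B n.+1) * _ => M V0 G2 G1.
have E : c * k0 / (32 * h ^+ 3) * mm <= c / (8 * h) * (2 * vo + vi).
  have -> : c * k0 / (32 * h ^+ 3) * mm = c / (8 * h) * (k0 * mm / (2 * h) ^+ 2).
    by field; rewrite gt_eqF.
  apply: ler_wpM2l; first by rewrite divr_ge0//; lra.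
  by rewrite ler_pdivrMr ?exprn_gt0 ?mulr_gt0// [leRHS]mulrC.
have E2 : c / (8 * h) * (2 * vo + vi) <= c / (4 * h) * vo + c / (4 * h) * vi.
  rewrite -subr_ge0 (_ : _ - _ = c / (8 * h) * vi); last by field; rewrite gt_eqF.
  by rewrite mulr_ge0// divr_ge0//; lra.
move: E E2 G1 G2; set x := _ * k0 / _ * _; set y := _ * (2 * vo + vi).
by set a := _ / _ * vo; set b := _ / _ * vi; set d := _%:R * de; lra.
Qed.
End finite_flow.

Lemma bernoulli_ge {R : realType} (q : R) (r : nat) : 0 <= q ->
  1 + r%:R * q <= (1 + q) ^+ r.
Proof.
move=> q0; elim: r => [|r IH]; first by rewrite mul0r addr0 expr0.
rewrite exprS -natr1; have r0 : 0 <= r%:R :> R by [].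
by move: IH r0; move: (_ ^+ r) (r%:R) => x y; nra.
Qed.

(** Logistic growth: the mass is multiplied by [1 + q] every second step until it
    passes three quarters of the total, and the losses are too small to bring it
    back below one half. *)
Lemma logistic_escape {R : realType} (m : nat -> R) (Wt ka eta mu0 : R) (r : nat) :
  0 < mu0 -> 0 < Wt -> 0 <= ka -> 0 <= eta -> (forall n, 0 <= m n) -> mu0 <= m 0%N ->
  (forall n, m n - eta <= m n.+1) ->
  (forall n, m n + ka * (m n.+1 * (Wt - m n.+1)) - 2 * eta <= m n.+2) ->
  eta * (2 + ka * Wt / 4) <= ka * Wt / 8 * mu0 ->
  8 * r%:R * eta <= Wt / 4 ->
  Wt <= mu0 * (1 + r%:R * (ka * Wt / 8)) ^+ 4 ->
  Wt / 2 < m (8 * r)%N.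
Proof.
move=> mu00 Wt0 ka0 eta0 m0 mu0m mono grow he hr hW.
set q := ka * Wt / 8 in he hW.
have q0 : 0 <= q by rewrite /q !mulr_ge0//; lra.
have monok n k : m n - k%:R * eta <= m (n + k)%N.
  elim: k => [|k IH]; first by rewrite mul0r subr0 addn0.
  by rewrite addnS -natr1; have := mono (n + k)%N; move: IH; move: (k%:R) => x; nra.
have claim j : (exists2 l, (l <= 2 * j)%N & 3 * Wt / 4 < m l) \/ mu0 * (1 + q) ^+ j <= m (2 * j)%N.
  elim: j => [|j [[l lj ml]|IH]]; first by right; rewrite expr0 mulr1.
    by left; exists l => //; apply: (leq_trans lj); rewrite leq_mul2l leqnSn orbT.
  have [big|small] := ltP (3 * Wt / 4) (m (2 * j).+1).
    by left; exists (2 * j).+1 => //; rewrite mulnS addSn add1n ltnW.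
  right; rewrite mulnS addSn add1n exprS.
  have one : 1 <= (1 + q) ^+ j by rewrite exprn_ege1//; lra.
  have G := grow (2 * j)%N; have M := mono (2 * j)%N; have m1 := m0 (2 * j).+1.
  have {}IH' : mu0 <= m (2 * j)%N by apply: le_trans IH; rewrite ler_peMr// ltW.
  apply: (@le_trans _ _ ((1 + q) * m (2 * j)%N)).
    by rewrite mulrCA ler_wpM2l//; lra.
  apply: le_trans G.
  have kW : 0 <= ka * Wt by rewrite mulr_ge0// ltW.
  have a1 : ka * Wt / 4 * m (2 * j).+1 <= ka * (m (2 * j).+1 * (Wt - m (2 * j).+1)).
    have -> : ka * Wt / 4 * m (2 * j).+1 = ka * (m (2 * j).+1 * (Wt / 4)) by ring.
    by apply: ler_wpM2l => //; apply: ler_wpM2l => //; lra.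
  have a2 : ka * Wt / 4 * (m (2 * j)%N - eta) <= ka * Wt / 4 * m (2 * j).+1.
    by apply: ler_wpM2l => //; lra.
  have a3 : q * mu0 <= q * m (2 * j)%N by apply: ler_wpM2l.
  by move: he a1 a2 a3; rewrite /q; move: (m (2 * j)%N) (_ * (_ * (Wt - _))) => x y; lra.
have [l lj ml] : exists2 l, (l <= 2 * (4 * r))%N & 3 * Wt / 4 < m l.
  case: (claim (4 * r)%N) => // H; exists (2 * (4 * r))%N => //.
  apply: lt_le_trans H; apply: (@lt_le_trans _ _ Wt); first by lra.
  apply: (le_trans hW); rewrite ler_pM2l// mulnC exprM lerXn2r ?nnegrE ?exprn_ge0//.
  - by rewrite addr_ge0// mulr_ge0.
  - by lra.
  - exact: bernoulli_ge.
have -> : (8 * r = l + (8 * r - l))%N by rewrite subnKC//; move: lj; rewrite mulnA.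
apply: lt_le_trans (monok _ _).
have : (8 * r - l)%:R * eta <= 8 * r%:R * eta.
  by rewrite ler_wpM2r// -natrM ler_nat leq_subr.
by move: ml hr; move: (m l) (_%:R * eta) (8 * r%:R * eta) => x y z; lra.
Qed.

Lemma sum_ge_inj {R : realType} (I J : finType) (f : I -> J) (F : J -> R) :
  injective f -> (forall j, 0 <= F j) -> \sum_i F (f i) <= \sum_j F j.
Proof.
move=> fi F0; have -> : \sum_i F (f i) = \sum_(j in [set f i | i : I]%SET) F j.
  by rewrite big_imset//= => x y _ _; exact: fi.
by rewrite [leRHS](bigID (mem [set f i | i : I]%SET))/= lerDl sumr_ge0.
Qed.

(** * Mixing of the weights of a grid *)

(** With the curve cut into eight arcs, [q] is neither [a] nor next to it. *)
Definition arc_far (a q : nat) : bool := (1 < (q + 8 - a) %% 8 < 7)%N.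

(** Two arcs out of eight are equal or adjacent to at most six arcs. *)
Lemma arc_far_both (a c : nat) : (a < 8)%N -> (c < 8)%N ->
  exists q, [/\ (q < 8)%N, arc_far a q & arc_far c q].
Proof.
move=> a8 c8.
have : all (fun a => all (fun c => has (fun q => arc_far a q && arc_far c q)
  (iota 0 8)) (iota 0 8)) (iota 0 8) by vm_compute.
move=> /allP/(_ a); rewrite mem_iota => /(_ a8)/allP/(_ c); rewrite mem_iota => /(_ c8).
by move=> /hasP[q]; rewrite mem_iota => q8 /andP[? ?]; exists q.
Qed.

Lemma turn_far (M : nat) (a x : nat) : (0 < M)%N -> (a < 8 * M)%N -> (x < 8 * M)%N ->
  arc_far (a %/ M) (x %/ M) ->
  (a.+1 + M <= turn (8 * M) a x)%N /\ ((turn (8 * M) a x).+1 + M <= a + 8 * M)%N.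
Proof.
move=> M0 aN xN; rewrite /arc_far /turn.
have qa : (a %/ M < 8)%N by rewrite ltn_divLR.
have qx : (x %/ M < 8)%N by rewrite ltn_divLR.
have Ea := divn_eq a M; have Ex := divn_eq x M.
have ra := ltn_pmod a M0; have rx := ltn_pmod x M0.
move: (a %/ M)%N (x %/ M)%N (a %% M)%N (x %% M)%N qa qx Ea Ex ra rx => p q u v p8 q8 -> -> uM vM.
have [pq|qp] := leqP p q.
  have -> : (q + 8 - p = (q - p) + 8)%N by lia.
  rewrite modnDr modn_small; last by lia.
  move=> /andP[d1 d2]; have -> : (q = p + (q - p))%N by lia.
  move: (q - p)%N d1 d2 => d d1 d2.
  by case: ltnP => /= H; rewrite ?mul1n ?mul0n; split; nia.
rewrite modn_small; last by lia.
move=> /andP[d1 d2].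
have lt : (q * M + v < p * M + u)%N.
  by apply: (@leq_trans (p * M)); [nia|rewrite leq_addr].
rewrite lt/= mul1n.
have E : (8 * M + q * M = (q + 8 - p) * M + p * M)%N by nia.
by move: (q + 8 - p)%N d1 d2 E => d d1 d2 E; split; nia.
Qed.

Section grid_mixing.
Context {R : realType} (L : R) (g : R -> R * R) (K A : R).
Hypothesis ov : oval L g K.
Hypothesis A0 : 0 <= A.
Hypothesis HA : lipschitz_angle L g A.

Local Notation cr := (crossing g).
Local Notation ch := (chord g).
Local Notation ph := (angle g).

(** The weight is a second derivative of the chord length integrated over a square of
    side [h], and that derivative is bounded below away from the diagonal. *)
Lemma weight_far (d : R) : 0 < d -> exists2 w, 0 < w &
  forall (N : nat) (h : R), 0 < h -> N%:R * h = L ->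
  forall i k : 'I_N, k != i ->
  node h i.+1 + d <= node h (turn N i k) -> node h (turn N i k) + h <= node h i + L - d ->
  w * h ^+ 2 <= weight g h i k.
Proof.
move=> d0; have [c1 c10 H1] := cross_far ov d0; have [c2 c20 H2] := angle_slope_far ov d0.
have L0 := oval_length_gt0 ov.
exists (c1 / L * c2); first by rewrite mulr_gt0// divr_gt0.
move=> N h h0 hN i k ki t1 t2.
have [s sI ->] := weight_mvt ov h0 hN i k.
rewrite /cell_start /cell_end -[nat_of_ord k == i]/(k == i) (negbTE ki).
rewrite (angle_turn ov hN i k s) (angle_turnS ov hN i k s).
move: (node h (turn N i k)) t1 t2 sI => t; rewrite nodeS => t1 t2 /andP[s1 s2].
have D u : t <= u <= t + h ->
    is_derive u 1 (fun v => cos (ph s v)) (- sin (ph s u) * (cr u s / ch s u ^+ 2)).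
  move=> u12; have su : g s != g u by apply: (oval_inj ov); lra.
  by have := @is_derive1_comp R cos (ph s) u _ _ (is_derive_cos _) (is_derive_angler ov su).
have tth : t < t + h by rewrite ltrDl.
have [||u] := @MVT_segment R (fun v => cos (ph s v)) (fun u => - sin (ph s u) * (cr u s / ch s u ^+ 2)) t (t + h) (ltW tth).
- by move=> u; rewrite in_itv/= => ?; apply: D; lra.
- apply: derivable_within_continuous => u; rewrite in_itv/= => ?.
  by have [] := D u _.
rewrite in_itv/= => uu; have -> : t + h - t = h by ring.
move=> E; have su : g s != g u by apply: (oval_inj ov); lra.
have S1 : c1 <= cr s u by apply: H1; lra.
have S2 : c2 <= cr u s / ch s u ^+ 2 by apply: H2; lra.
have chL : ch s u <= L by have := @chord_le _ _ _ _ ov s u ltac:(lra); lra.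
have S3 : c1 / L <= sin (ph s u).
  rewrite (sin_angle ov su); apply: ler_pM => //; [exact: ltW|by rewrite invr_ge0 ltW|].
  by rewrite lef_pV2 ?posrE ?(chord_gt0 ov su).
have S4 : c1 / L * c2 <= sin (ph s u) * (cr u s / ch s u ^+ 2).
  by apply: ler_pM => //; [rewrite divr_ge0// ltW|exact: ltW].
have -> : cos (ph s t) - cos (ph s (t + h)) = sin (ph s u) * (cr u s / ch s u ^+ 2) * h.
  by rewrite -opprB E; ring.
have -> : c1 / L * c2 * h ^+ 2 = h * (c1 / L * c2 * h) by ring.
by rewrite !(ler_pM2l h0, ler_pM2r h0).
Qed.

(** Some eighth of the curve is far from both [a] and [c], and each of its [M] nodes
    contributes a product of two weights of order [h ^+ 2]. *)
Lemma grid_mixing : exists2 k0, 0 < k0 &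
  forall (M : nat) (h : R), (0 < M)%N -> 0 < h -> (8 * M)%:R * h = L ->
  forall a c : 'I_(8 * M), k0 * h ^+ 3 <=
    \sum_(x < 8 * M) weight g h a x * weight g h c x.
Proof.
have L0 := oval_length_gt0 ov; have L8 : 0 < L / 8 by lra.
have [w w0 Hw] := weight_far L8.
exists (L / 8 * w ^+ 2); first by rewrite mulr_gt0// exprn_gt0.
move=> M h M0 h0 hN a c.
have N2 : (1 < 8 * M)%N by lia.
have Mh : M%:R * h = L / 8 by rewrite -hN natrM; field.
have far (i k : 'I_(8 * M)) : arc_far (i %/ M) (k %/ M) -> w * h ^+ 2 <= weight g h i k.
  move=> ik; have [t1 t2] := turn_far M0 (ltn_ord i) (ltn_ord k) ik.
  apply: (Hw _ _ h0 hN).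
  - by apply: contraTneq ik => ->; rewrite /arc_far addKn.
  - by rewrite -Mh -[M%:R * h]/(node h M) -nodeD (node_le h0).
  - by rewrite lerBrDr -Mh -[M%:R * h]/(node h M) -nodeS -nodeD -(nodeDN hN) (node_le h0).
have [q [q8 qa qc]] := arc_far_both (a := a %/ M) (c := c %/ M)
  ltac:(by rewrite ltn_divLR// ltn_ord) ltac:(by rewrite ltn_divLR// ltn_ord).
have fN (r : 'I_M) : (q * M + r < 8 * M)%N by have := ltn_ord r; nia.
pose f (r : 'I_M) : 'I_(8 * M) := Ordinal (fN r).
have fi : injective f by move=> r r' [] /eqP; rewrite eqn_add2l => /eqP/val_inj.
apply: le_trans (sum_ge_inj fi _); last first.
  by move=> j; rewrite mulr_ge0// (weight_ge0 ov A0 HA h0 hN N2).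
have fq r : (f r %/ M = q)%N by rewrite /= divnMDl// divn_small ?addn0.
apply: (@le_trans _ _ (\sum_(r < M) (w * h ^+ 2) ^+ 2)).
  rewrite sumr_const card_ord -[leRHS]mulr_natl -Mh le_eqVlt; apply/orP; left.
  by apply/eqP; ring.
have wh : 0 <= w * h ^+ 2 by rewrite mulr_ge0 ?sqr_ge0// ltW.
by apply: ler_sum => r _; rewrite expr2; apply: ler_pM => //; apply: far; rewrite fq.
Qed.

End grid_mixing.

(** * Chains of chords and their initial mass *)

(** Nodes that can be hit from [(s1, th1)]; grazing hits are left out, so that the node
    is at a definite distance from [s1]. *)
Definition start_node {R : realType} (g : R -> R * R) (h e1 s1 th1 : R) (i : nat) : bool :=
  [&& g s1 != g (node h i), `|angle g s1 (node h i) - th1| < e1,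
      e1 / 8 <= angle g s1 (node h i) & angle g s1 (node h i) <= pi - e1 / 8].

Definition start_chord {R : realType} (g : R -> R * R) (h e1 s1 th1 : R) (i k : nat) : bool :=
  [&& start_node g h e1 s1 th1 i, k != i &
      `|node_angle g h i k + angle g (node h i) s1 - pi| < e1].

(** Angles at [i] are measured from the same tangent, so the specular reflection
    of the chord from [j] has direction [pi - node_angle g h i j]. *)
Definition next_chord {R : realType} (g : R -> R * R) (h e1 : R) (N : nat)
    (B : 'I_N -> 'I_N -> bool) (i k : 'I_N) : bool :=
  (k != i) &&
  [exists j, B j i && (`|node_angle g h i k + node_angle g h i j - pi| < e1)].

Section initial_mass.
Context {R : realType} (L : R) (g : R -> R * R) (K A : R).
Hypothesis ov : oval L g K.
Hypothesis A1 : 1 <= A.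
Hypothesis HA : lipschitz_angle L g A.
Context (N : nat) (h : R).
Hypothesis h0 : 0 < h.
Hypothesis hN : N%:R * h = L.
Hypothesis N2 : (1 < N)%N.

Local Notation ph := (angle g).
Local Notation nd := (node h).
Local Notation W := (weight g h).

Let A0 : 0 <= A. Proof. exact: le_trans A1. Qed.

Lemma grid_target (i : 'I_N) e th : 8 * A * h <= e -> e <= 1 -> 0 <= th <= pi ->
  h * (e ^+ 2 / 32 - 2 * A * h) <=
  \sum_(k < N | `|node_angle g h i k - th| < e) W i k.
Proof.
move=> he e1 th0.
pose c (k : 'I_N) : R := (`|node_angle g h i k - th| < e)%R%:R.
have ind F : \sum_(k < N | `|node_angle g h i k - th| < e) F k = \sum_(k < N) c k * F k.
  by rewrite big_mkcond; apply: eq_bigr => k _; rewrite /c; case: ifP; rewrite ?mul1r ?mul0r.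
have [s sI] := grid_mvt ov h0 hN i c; rewrite ind => ->.
rewrite ler_pM2l// -ind.
have hp := h0; have Ap := A0; have Ah : 0 <= A * h by rewrite mulr_ge0// ltW.
by apply: (mesh_target (mesh_grid ov A0 HA h0 hN N2 sI)) => //; lra.
Qed.

Lemma cell_width (i k : 'I_N) s : nd i < s < nd i.+1 ->
  cos (cell_start g h i s k) - cos (cell_end g h i s k) <= A * h.
Proof.
move=> sI; rewrite /cell_start /cell_end -[nat_of_ord k == i]/(k == i).
have Ah : 0 <= A * h by rewrite mulr_ge0// ltW.
case: eqVneq => [_|ki]; first by rewrite subrr.
have [_ /andP[d0 d1] _ _] := cell_near ov A0 HA h0 hN ki sI.
move: d0 d1; move: (ph s (nd k)) (ph s (nd k.+1)) => b a d0 d1.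
have cc : {within `[b, a], continuous (@cos R)} by apply: continuous_subspaceT; exact: continuous_cos.
have ba : b <= a by lra.
have [c _] := MVT_segment ba (fun t _ => is_derive_cos t) cc.
by have := sin_le1 c; move: (sin c) (cos a) (cos b) => u v w; nra.
Qed.

Lemma grid_target_card (i : 'I_N) e th : 8 * A * h <= e -> e <= 1 -> 0 <= th <= pi ->
  e ^+ 2 / 32 - 2 * A * h <=
  #|[set k : 'I_N | `|node_angle g h i k - th| < e]%SET|%:R * (A * h).
Proof.
move=> he e1 th0; have hp := h0; have Ap := A0.
have Ah : 0 <= A * h by rewrite mulr_ge0// ltW.
pose s := nd i + h / 2.
have sI : nd i < s < nd i.+1 by rewrite nodeS /s; lra.
apply: (le_trans (mesh_target (e := e) (th := th) (mesh_grid ov A0 HA h0 hN N2 sI) _ _ _ _)) => //; try lra.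
rewrite mulr_natl -sumr_const.
rewrite [leRHS](eq_bigl (fun k : 'I_N => `|node_angle g h i k - th| < e)); last by move=> k; rewrite inE.
by apply: ler_sum => k _; exact: cell_width.
Qed.

Lemma cell_of (s : R) : 0 <= s < L -> exists i : 'I_N, nd i <= s < nd i.+1.
Proof.
move=> /andP[s0 sL]; have sh0 : 0 <= s / h by rewrite divr_ge0// ltW.
have := truncn_itv sh0; set n := Num.truncn _ => /andP[n1 n2].
have n1' : nd n <= s by rewrite /node -ler_pdivlMr.
have n2' : s < nd n.+1 by rewrite /node -ltr_pdivrMr.
have nN : (n < N)%N.
  by rewrite -(node_lt h0) [X in _ < X]hN; apply: le_lt_trans sL.
by exists (Ordinal nN); rewrite n1' n2'.
Qed.

(** About [e1 ^+ 2 / h] nodes are hit from the start, and from each of them the chords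
    allowed by the noise have mass [h * e1 ^+ 2]. *)
Lemma start_mass (e1 s1 th1 : R) : 0 < e1 <= 1 -> 2 * A * h <= e1 ^+ 2 / 32 / 32 ->
  0 <= s1 < L -> 0 <= th1 <= pi ->
  e1 ^+ 2 / 32 / 32 / A * (e1 ^+ 2 / 64) <=
  \sum_(i < N) \sum_(k < N | start_chord g h e1 s1 th1 i k) W i k.
Proof.
move=> /andP[e10 e11] he s1L th1pi; have hp := h0; have Ap := A1; have pi2 := pi_ge2 R.
have ee : e1 ^+ 2 <= e1 by rewrite expr2; nra.
have [i1 /andP[i1s si1]] := cell_of s1L.
pose th := Num.min (Num.max th1 (e1 / 2)) (pi - e1 / 2).
have [t1 t2 t3 t4] : [/\ e1 / 2 <= th, th <= pi - e1 / 2, th - th1 <= e1 / 2 & th1 - th <= e1 / 2].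
  by rewrite /th /Num.min /Num.max; case: ifPn; case: ifPn; rewrite -?leNgt; split; lra.
pose S := [set k : 'I_N | `|node_angle g h i1 k - th| < e1 / 4]%SET.
have cS : e1 ^+ 2 / 32 / 16 - 2 * A * h <= #|S|%:R * (A * h).
  have -> : e1 ^+ 2 / 32 / 16 = (e1 / 4) ^+ 2 / 32 by field.
  by apply: grid_target_card; lra.
have HS (k : 'I_N) : k \in S -> start_node g h e1 s1 th1 k.
  rewrite inE /node_angle -[nat_of_ord k == i1]/(k == i1).
  case: eqVneq => [_|ki]; first by rewrite ltr_norml; lra.
  have Hs : nd i1 <= s1 < nd i1.+1 by rewrite i1s.
  have [u1 u2] := turn_node h0 hN ki Hs.
  have [_ HA2] := HA; have := HA2 (nd i1) s1 (nd (turn N i1 k)) i1s u1.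
  rewrite -!(angle_turn ov hN) => /(_ _) HL.
  have {}HL : `|ph (nd i1) (nd k) - ph s1 (nd k)| <= e1 / 8.
    apply: (le_trans (HL _)); first by lra.
    have : A * (s1 - nd i1) <= A * h by apply: ler_wpM2l; [exact: A0|rewrite nodeS in si1; lra].
    by lra.
  have apart : g s1 != g (nd k).
    have : g s1 != g (nd (turn N i1 k)) by apply: (oval_inj ov); lra.
    rewrite /turn; case: (_ < _)%N; rewrite ?mul0n ?addn0// mul1n (nodeDN hN).
    by rewrite (oval_periodic ov).
  move: HL; rewrite ltr_norml ler_norml => ? ?.
  by rewrite /start_node apart/= ltr_norml; lra.
have row (i : 'I_N) : i \in S -> h * (e1 ^+ 2 / 32 - 2 * A * h) <=
    \sum_(k < N | start_chord g h e1 s1 th1 i k) W i k.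
  move=> /HS Hi; have ap : g (nd i) != g s1 by move: Hi => /and4P[]; rewrite eq_sym.
  have th0 : 0 <= pi - ph (nd i) s1 <= pi.
    by have := angle_gt0 ov ap; have := angle_ltpi ov ap; lra.
  apply: (le_trans (grid_target i (e := e1) _ _ th0)) => //; first by lra.
  rewrite [leLHS](bigID (fun k : 'I_N => k == i))/=.
  rewrite [X in X + _ <= _]big1 ?add0r; last first.
    by move=> k /andP[_ /eqP ->]; rewrite /weight eqxx.
  rewrite le_eqVlt; apply/orP; left; apply/eqP; apply: eq_bigl => k.
  rewrite /start_chord Hi/= andbC; congr (_ && (_ < _)); congr (`| _ |); ring.
apply: (@le_trans _ _ (\sum_(i in S) h * (e1 ^+ 2 / 32 - 2 * A * h))); last first.
  apply: (@le_trans _ _ (\sum_(i in S) \sum_(k < N | start_chord g h e1 s1 th1 i k) W i k)).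
    by apply: ler_sum => i iS; exact: row.
  rewrite [leRHS](bigID (mem S))/= lerDl; apply: sumr_ge0 => i _; apply: sumr_ge0 => k _.
  exact: (weight_ge0 ov A0 HA h0 hN N2).
rewrite sumr_const -[leRHS]mulr_natl.
have x2 : e1 ^+ 2 / 64 <= e1 ^+ 2 / 32 - 2 * A * h by have := sqr_ge0 e1; lra.
have x1 : e1 ^+ 2 / 32 / 32 / A <= #|S|%:R * h.
  rewrite ler_pdivrMr; last by lra.
  have -> : #|S|%:R * h * A = #|S|%:R * (A * h) by ring.
  by lra.
have p2 : 0 <= e1 ^+ 2 / 64 by have := sqr_ge0 e1; lra.
have p1 : 0 <= e1 ^+ 2 / 32 / 32 / A.
  by apply: divr_ge0; [have := sqr_ge0 e1|]; lra.
by rewrite [leRHS]mulrA; apply: ler_pM.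
Qed.

End initial_mass.

(** * From chains of nodes to densities *)

(** Distance at least [d] along the closed curve. *)
Definition separated {R : realType} (L d s t : R) : Prop :=
  exists m : int, s + d <= t + m%:~R * L <= s + L - d.

Section hops.
Context {R : realType} (L : R) (g : R -> R * R) (K A : R).
Hypothesis ov : oval L g K.
Hypothesis A0 : 0 <= A.
Hypothesis HA : lipschitz_angle L g A.

Local Notation cr := (crossing g).
Local Notation ch := (chord g).
Local Notation ph := (angle g).
Local Notation T := (billiard_map L g).

Lemma angle_shiftr (m : int) s t : ph s (t + m%:~R * L) = ph s t.
Proof. exact: (periodicz (fun u => angle_periodicr ov s u) m t). Qed.

Lemma separated_sym d s t : separated L d s t -> separated L d t s.
Proof.
move=> [m]; set x := m%:~R * L => H; exists (1 - m).
have -> : (1 - m)%:~R * L = L - x by rewrite rmorphB/= mulrBl mul1r.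
by move: x H => x; lra.
Qed.

Lemma separatedW d d' s t : d' <= d -> separated L d s t -> separated L d' s t.
Proof. by move=> dd [m H]; exists m; move: H; move: (m%:~R * L) => x; lra. Qed.

Lemma separated_move d r a b s t : separated L (d + r) a b ->
  a <= s <= a + r -> b <= t <= b + r -> separated L d s t.
Proof. by move=> [m H] ? ?; exists m; move: H; move: (m%:~R * L) => x; lra. Qed.

Lemma separated_apart d s t : 0 < d -> separated L d s t -> g s != g t.
Proof.
move=> d0 [m H]; rewrite -(periodicz (oval_periodic ov) m t).
by apply: (oval_inj ov); move: H; move: (m%:~R * L) => x; lra.
Qed.

Lemma angle_separated_near r a b s t : 0 < r -> separated L (2 * r) a b ->
  a <= s <= a + r -> b <= t <= b + r -> `|ph s t - ph a b| <= 2 * A * r.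
Proof.
move=> r0 [m H] Hs Ht; have [HA1 HA2] := HA.
rewrite -(angle_shiftr m s t) -(angle_shiftr m a b).
have {}Ht : b + m%:~R * L <= t + m%:~R * L <= b + m%:~R * L + r by move: Ht; move: (m%:~R * L) => x; lra.
move: (t + _) (b + _) H Ht => {b}t b H Ht.
have H1 := HA1 s b t ltac:(lra) ltac:(lra) ltac:(lra).
have H2 := HA2 a s b ltac:(lra) ltac:(lra) ltac:(lra).
have B1 : A * (t - b) <= A * r by apply: ler_wpM2l => //; lra.
have B2 : A * (s - a) <= A * r by apply: ler_wpM2l => //; lra.
by move: H2; rewrite !ler_norml; lra.
Qed.

Lemma angle_separated s t d : 0 < A -> 0 < d -> g s != g t ->
  A * d <= ph s t -> ph s t <= pi - A * d -> separated L d s t.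
Proof.
move=> Ap d0 st p1 p2; have [m Hm] := apart_lift ov st; exists m.
have := angle_near ov HA Hm; rewrite angle_shiftr.
move: Hm; move: (t + _) => u Hm [q1 q2].
have : A * d <= A * (u - s) by lra.
have : A * d <= A * (s + L - u) by lra.
by rewrite !ler_pM2l//; lra.
Qed.

Section step.
Context (e : R).
Hypothesis e_pi : 0 < e < pi / 2.

(** Seen from [s], the stretch [[b, b + r]] of the boundary is an interval of directions
    of length at least [c * r], and the noise has density [(2 * e)^-1] on it. *)
Lemma density_hop c d r n x y s th b be : (2 <= n)%N -> 0 < c -> 0 < d -> 0 < r ->
  (forall s t t', s + d <= t -> t <= t' -> t' <= s + L - d ->
     c * (t' - t) <= ph s t' - ph s t) ->
  T x = (s, th) -> 0 <= s < L -> 0 <= th <= pi -> 0 <= b -> b + r < L ->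
  separated L (d + r) s b -> `|ph s b - th| <= e - A * r -> 0 <= be ->
  (forall z t, b <= t <= b + r -> 0 <= pi - ph t s <= pi -> T z = (t, pi - ph t s) ->
     (be%:E <= density L g e n z y)%E) ->
  ((be * (c * r / (2 * e)))%:E <= density L g e n.+1 x y)%E.
Proof.
move=> n2 c0 d0 r0 Hc Tx s0 th0 b0 bL [m H] near be0 IH.
have [HA1 _] := HA.
set B := b + m%:~R * L in H.
have sB : ph s b = ph s B by rewrite /B angle_shiftr.
have up : c * r <= ph s (B + r) - ph s B.
  by have := Hc s B (B + r) ltac:(lra) ltac:(lra) ltac:(lra); rewrite [B + r - B]addrC addKr.
have dn := HA1 s B (B + r) ltac:(lra) ltac:(lra) ltac:(lra).
rewrite [B + r - B]addrC addKr in dn.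
have trans (u : R) : ph s B <= u <= ph s (B + r) -> exists2 t, b <= t <= b + r & u = ph s t.
  move=> Hu; have [t Ht <-] := @angle_ivt _ _ _ _ ov s B (B + r) u ltac:(lra) ltac:(lra) ltac:(lra) Hu.
  exists (t + (- m)%:~R * L); last by rewrite angle_shiftr.
  move: Ht; rewrite /B rmorphN/= mulNr; move: (m%:~R * L) => X; lra.
have apart t : b <= t <= b + r -> g s != g t.
  move=> Ht; apply: (@separated_apart d) => //; exists m.
  by move: Ht H; rewrite /B; move: (m%:~R * L) => X; lra.
have allowed u : ph s B <= u <= ph s (B + r) -> `|u - trunc_angle e th| <= e.
  move=> Hu; apply: trunc_angle_near => //.
    have [t Ht ->] := trans u Hu.
    by have := angle_gt0 ov (apart t Ht); have := angle_ltpi ov (apart t Ht); lra.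
  by move: near; rewrite sB !ler_norml; lra.
have cr0 : 0 < c * r by rewrite mulr_gt0.
have BB : ph s B <= ph s (B + r) by lra.
have l1 := allowed (ph s B) ltac:(lra); have l2 := allowed (ph s (B + r)) ltac:(lra).
apply: (@le_trans _ _ (be * ((ph s (B + r) - ph s B) / (2 * e)))%:E).
  rewrite lee_fin; apply: ler_wpM2l => //; apply: ler_wpM2r => //.
  by rewrite invr_ge0; move: e_pi; lra.
apply: (density_step e_pi n2 Tx s0) => //.
- by move: l1; rewrite ler_norml; lra.
- by move: l2; rewrite ler_norml; lra.
move=> u /trans[t Ht ->]; have st := apart t Ht.
apply: (IH _ t) => //; last by apply: (billiard_map_chord ov) => //; lra.
have ts : g t != g s by rewrite eq_sym.
by have := angle_gt0 ov ts; have := angle_ltpi ov ts; lra.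
Qed.

Lemma density_last c d x y s th : 0 < c -> 0 < d ->
  (forall s t, s + d <= t <= s + L - d -> c <= cr t s / ch s t ^+ 2) ->
  T x = (s, th) -> 0 <= s < L -> 0 <= th <= pi -> phase L y ->
  separated L d s y.1 -> `|ph s y.1 - th| <= e -> `|y.2 - (pi - ph y.1 s)| <= e ->
  (((4 * e ^+ 2)^-1 * c)%:E <= density L g e 2 x y)%E.
Proof.
move=> c0 d0 Hc Tx s0 th0 [y1 y2] sep near1 near2.
have st := separated_apart d0 sep; have ts : g y.1 != g s by rewrite eq_sym.
have ys : y.1 != s by apply: contra_neq st => ->.
rewrite /density/= (density2E ov e Tx s0 y1 ys) !trunc_angle_near// ?mulr1.
- rewrite lee_fin; apply: ler_wpM2l; first by rewrite invr_ge0 mulr_ge0// sqr_ge0.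
  have [m Hm] := sep; have := Hc _ _ Hm.
  rewrite (periodicz (f := fun u => cr u s) (fun u => cross_periodicl ov u s) m).
  by rewrite (periodicz (fun u => chord_periodicr ov s u) m).
- by have := angle_gt0 ov ts; have := angle_ltpi ov ts; lra.
- by have := angle_gt0 ov st; have := angle_ltpi ov st; lra.
Qed.

End step.

Section chain.
Context (N : nat) (h e : R).
Hypothesis h0 : 0 < h.
Hypothesis hN : N%:R * h = L.
Hypothesis e_pi : 0 < e < pi / 2.
Hypothesis A1 : 1 <= A.

Local Notation nd := (node h).
Let e1 := e / 2.

Lemma node_separated (i k : 'I_N) : k != i -> separated L h (nd i) (nd k).
Proof.
move=> ki; have := @turn_node _ _ _ _ h0 hN i k (nd i) ki.
rewrite nodeS lexx ltrDl h0 => /(_ isT)[_ t2].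
have [t1 _] := turn_bounds ki.
have {}t1 : nd i + h <= nd (turn N i k) by rewrite -nodeS (node_le h0).
have E : nd (turn N i k) = nd k + (k < i)%N%:R * L.
  by rewrite /turn; case: (_ < _)%N; rewrite ?mul1n ?mul0n ?addn0 ?mul0r ?addr0// mul1r (nodeDN hN).
by exists (k < i)%N; rewrite -[_%:~R]/((k < i)%N%:R : R) -E; lra.
Qed.

Lemma node_angleE (i k : 'I_N) : k != i -> node_angle g h i k = ph (nd i) (nd k).
Proof. by rewrite /node_angle -[nat_of_ord k == i]/(k == i) => /negbTE ->. Qed.

Lemma start_separated s1 th1 (i : 'I_N) : start_node g h e1 s1 th1 i ->
  separated L (e1 / (8 * A)) s1 (nd i).
Proof.
have Ap := A1; have e0 : 0 < e by case/andP: e_pi.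
move=> /and4P[a1 _ a2 a3].
have E : A * (e1 / (8 * A)) = e1 / 8 by field; lra.
apply: angle_separated => //; rewrite ?E//; first by lra.
by rewrite divr_gt0// /e1; lra.
Qed.

(** [chain s1 th1 n i k]: the chord from [i] to [k] ends a chain of nodes that the noise
    [e / 2] allows from [(s1, th1)]. The other half of the noise is kept for moving
    the points of the trajectory around the nodes. *)
Definition chain s1 th1 (n : nat) : 'I_N -> 'I_N -> bool :=
  iter n (@next_chord R g h e1 N) (fun i k : 'I_N => start_chord g h e1 s1 th1 i k).

Lemma chain_neq s1 th1 n i k : chain s1 th1 n i k -> k != i.
Proof. by case: n => [/and3P[_ ]|n /andP[]]. Qed.

Context (d0 c : R).
Hypothesis d00 : 0 < d0.
Hypothesis d0h : d0 <= h.
Hypothesis d0e : d0 <= e1 / (8 * A).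
Hypothesis c0 : 0 < c.
Hypothesis Hc1 : forall s t, s + d0 / 2 <= t <= s + L - d0 / 2 -> c <= cr t s / ch s t ^+ 2.
Hypothesis Hc2 : forall s t t', s + d0 / 2 <= t -> t <= t' -> t' <= s + L - d0 / 2 ->
  c * (t' - t) <= ph s t' - ph s t.

(* length of the stretch of boundary that follows each node *)
Let r := d0 / 8.
Let ga := c * r / (2 * e).

Let r0 : 0 < r. Proof. by have := d00; rewrite /r; lra. Qed.

Let Ar : A * r <= e1 / 64.
Proof.
have Ap := A1; have : A * d0 <= A * (e1 / (8 * A)) by apply: ler_wpM2l; [lra|exact: d0e].
have -> : A * (e1 / (8 * A)) = e1 / 8 by field; lra.
by rewrite /r; lra.
Qed.

Let ga0 : 0 <= ga.
Proof.
have e0 : 0 < e by case/andP: e_pi.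
by apply: divr_ge0; apply: mulr_ge0 => //; exact: ltW.
Qed.

Let b0 m : 0 <= (4 * e ^+ 2)^-1 * c * ga ^+ m.
Proof.
apply: mulr_ge0; last exact: exprn_ge0.
by apply: mulr_ge0; [rewrite invr_ge0 mulr_ge0// sqr_ge0|exact: ltW].
Qed.

Lemma node_phase (k : 'I_N) : 0 <= nd k /\ nd k + r < L.
Proof.
have hp := h0; have dh := d0h; have dp := d00; split; first by rewrite mulr_ge0// ltW.
have : nd k.+1 <= L by rewrite -hN -[N%:R * h]/(nd N) (node_le h0).
by rewrite nodeS /r; lra.
Qed.

(** [density_hop] with the margins that the grid guarantees: one bounce costs a
    factor [ga]. *)
Lemma node_hop n (i k : 'I_N) x y s th be : (2 <= n)%N -> k != i ->
  T x = (s, th) -> nd i <= s <= nd i + r -> 0 <= th <= pi ->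
  `|node_angle g h i k - th| <= e1 + 4 * (A * r) -> 0 <= be ->
  (forall z t, nd k <= t <= nd k + r -> 0 <= pi - ph t s <= pi -> T z = (t, pi - ph t s) ->
     `|pi - ph t s - (pi - node_angle g h k i)| <= 2 * (A * r) ->
     (be%:E <= density L g e n z y)%E) ->
  ((be * ga)%:E <= density L g e n.+1 x y)%E.
Proof.
move=> n2 ki Tx Hs th0 near be0 IH.
have [i0 iL] := node_phase i; have [k0 kL] := node_phase k.
have dp := d00; have dh := d0h; have e0 : 0 < e by case/andP: e_pi.
have sep : separated L d0 (nd i) (nd k) by exact: separatedW (node_separated ki).
have sep2 : separated L (2 * r) (nd i) (nd k) by apply: separatedW sep; rewrite /r; lra.
have sepk : separated L (2 * r) (nd k) (nd i) by exact: separated_sym.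
have rp := r0; have Arp := Ar.
have d20 : 0 < d0 / 2 by lra.
have sL : 0 <= s < L by lra.
apply: (density_hop e_pi n2 c0 d20 rp Hc2 Tx sL th0 k0 kL _ _ be0).
- apply: (@separated_move _ r (nd i) (nd k)) => //; last by lra.
  by apply: separatedW sep; rewrite /r; lra.
- have := angle_separated_near r0 sep2 Hs (t := nd k) ltac:(lra).
  move: near; rewrite node_angleE// !ler_norml; rewrite /e1 in Arp *.
  move: Arp; rewrite -(mulrA 2); move: (A * r) => a; lra.
move=> z t Ht tp Tz; apply: (IH z t) => //.
have ik : i != k by rewrite eq_sym.
have := angle_separated_near r0 sepk Ht Hs; rewrite node_angleE// -(mulrA 2).
by rewrite !ler_norml; move: (A * r) => a; lra.
Qed.

(** The chain from [y] is read backwards: the trajectory has just arrived at node [i]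
    along the chord from node [j], and goes on towards [y] along the earlier chords. *)
Lemma chain_density y n : phase L y -> forall (i j : 'I_N) x s th,
  chain y.1 (pi - y.2) n i j -> T x = (s, th) -> nd i <= s <= nd i + r ->
  0 <= th <= pi -> `|th - (pi - node_angle g h i j)| <= 2 * (A * r) ->
  (((4 * e ^+ 2)^-1 * c * ga ^+ n)%:E <= density L g e n.+2 x y)%E.
Proof.
move=> py; have [y1 y2] := py; have rp := r0; have Arp := Ar; have dp := d00.
have e0 : 0 < e by case/andP: e_pi.
elim: n => [|n IH] i j x s th B Tx Hs th0 near.
  have [i0 iL] := node_phase i.
  rewrite expr0 mulr1; move: B => /and3P[st ji close].
  have sep : separated L d0 y.1 (nd i) by apply: separatedW (start_separated st); exact: d0e.
  have sepr := separated_sym sep.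
  have sep2 : separated L (2 * r) (nd i) y.1 by apply: separatedW sepr; rewrite /r; lra.
  move: st => /and4P[_ st1 _ _].
  have d20 : 0 < d0 / 2 by lra.
  have sL : 0 <= s < L by lra.
  apply: (density_last e_pi c0 d20 Hc1 Tx sL th0 py).
  - apply: (@separated_move _ r (nd i) y.1) => //; last by lra.
    by apply: separatedW sepr; rewrite /r; lra.
  - have := angle_separated_near r0 sep2 Hs (t := y.1) ltac:(lra).
    move: near close; rewrite !ler_norml ltr_norml; rewrite /e1 in Arp *.
    by rewrite -(mulrA 2); move: (A * r) Arp => a; lra.
  have := angle_separated_near r0 (separated_sym sep2) (s := y.1) (t := s) ltac:(lra) Hs.
  move: st1; rewrite !ler_norml ltr_norml; rewrite /e1 in Arp *.
  by rewrite -(mulrA 2); move: (A * r) Arp => a; lra.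
move: B => /andP[ji /existsP[k /andP[B close]]].
have ik : i != k by exact: chain_neq B.
have ki : k != i by rewrite eq_sym.
rewrite (exprSr ga) mulrA; apply: (node_hop (n := n.+2) _ ki Tx Hs th0) => //.
  move: near close; rewrite !ler_norml ltr_norml.
  by move: (A * r) => a; lra.
by move=> z t Ht tp Tz nz; exact: (IH k i z t _ B Tz Ht tp nz).
Qed.

(** The chord shared by the two chains is moved back to the start of the first one,
    step by step: the relation between consecutive chords is symmetric under time
    reversal. *)
Lemma chain_join s1 th1 t1 ta m n i k : chain s1 th1 m i k -> chain t1 ta n k i ->
  exists i' k', chain s1 th1 0 i' k' /\ chain t1 ta (m + n) k' i'.
Proof.
elim: m n i k => [|m IH] n i k; first by exists i, k.
move=> /andP[ki /existsP[j /andP[B close]]] B'.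
have ij := chain_neq B; rewrite addSnnS; apply: IH B _.
apply/andP; split; first by rewrite eq_sym.
by apply/existsP; exists k; apply/andP; split; [exact: B'|rewrite [X in `|X - _|]addrC].
Qed.

Lemma chain_start_density x y s1 th1 n i k : phase L y -> T x = (s1, th1) ->
  0 <= s1 < L -> 0 <= th1 <= pi ->
  chain s1 th1 0 i k -> chain y.1 (pi - y.2) n k i ->
  (((4 * e ^+ 2)^-1 * c * ga ^+ n.+2)%:E <= density L g e n.+4 x y)%E.
Proof.
move=> py Tx s1L th1p /and3P[st ki close] B.
have rp := r0; have Arp := Ar; have dp := d00; have e0 : 0 < e by case/andP: e_pi.
have sep : separated L d0 s1 (nd i) by apply: separatedW (start_separated st); exact: d0e.
have sep2 : separated L (2 * r) (nd i) s1.
  by apply: separated_sym; apply: separatedW sep; rewrite /r; lra.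
have [i0 iL] := node_phase i; move: st => /and4P[_ st1 _ _].
rewrite (exprSr ga) mulrA.
have d20 : 0 < d0 / 2 by lra.
apply: (density_hop (n := n.+3) e_pi _ c0 d20 rp Hc2 Tx s1L th1p i0 iL _ _ (b0 _)) => //.
- by apply: separatedW sep; rewrite /r; lra.
- move: st1; rewrite ler_norml ltr_norml; rewrite /e1 in Arp *.
  by move: (A * r) Arp => a; lra.
move=> z t Ht tp Tz; rewrite (exprSr ga) mulrA.
have nr := angle_separated_near r0 sep2 Ht (t := s1) ltac:(lra).
apply: (node_hop (n := n.+2) _ ki Tz Ht tp) => //.
  move: nr close; rewrite !ler_norml ltr_norml -(mulrA 2).
  by move: (A * r) => a; lra.
by move=> z' t' Ht' tp' Tz' nz'; exact: (chain_density py B Tz' Ht' tp' nz').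
Qed.

End chain.
End hops.

(** * Growth of the chains *)

Section masses_meet.
Context {R : realType} (V : finType) (W : V -> V -> R).
Hypothesis W0 : forall i k, 0 <= W i k.
Hypothesis WC : forall i k, W i k = W k i.

(** The pairs of [B] and the reversed pairs of [B'] cannot be disjoint, as they do not
    fit together in the total mass. *)
Lemma masses_meet (B B' : V -> V -> bool) :
  total_mass W / 2 < mass W B -> total_mass W / 2 < mass W B' ->
  exists i k, B i k && B' k i.
Proof.
move=> m1 m2.
have [/existsP[i /existsP[k H]]|no] := boolP [exists i, exists k, B i k && B' k i].
  by exists i, k.
suff : mass W B + mass W B' <= total_mass W by lra.
rewrite (mass_in WC B') -big_split/=; apply: ler_sum => i _.
rewrite /out_mass /in_mass /row_mass [leRHS](bigID (B i))/= lerD2l.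
rewrite [leRHS](bigID (fun k => B' k i))/=.
rewrite [X in X <= _](eq_bigl (fun k => ~~ B i k && B' k i)).
  by rewrite lerDl; apply: sumr_ge0.
move=> k; move/existsPn: no => /(_ i)/existsPn/(_ k).
by case: (B i k); case: (B' k i).
Qed.
End masses_meet.

Section chain_mass.
Context {R : realType} (L : R) (g : R -> R * R) (K A k0 : R).
Hypothesis ov : oval L g K.
Hypothesis A1 : 1 <= A.
Hypothesis HA : lipschitz_angle L g A.
Hypothesis k00 : 0 < k0.
Context (N : nat) (h e : R).
Hypothesis h0 : 0 < h.
Hypothesis hN : N%:R * h = L.
Hypothesis N2 : (1 < N)%N.
Hypothesis mix : forall a c : 'I_N, k0 * h ^+ 3 <= \sum_(x < N) weight g h a x * weight g h c x.

Local Notation W := (fun i k : 'I_N => weight g h i k).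
Let e1 := e / 2.
Let mu0 := e1 ^+ 2 / 32 / 32 / A * (e1 ^+ 2 / 64).
Let ka := e1 / 8 * k0 / 32.

Let A0 : 0 <= A. Proof. exact: le_trans A1. Qed.

(** The chords that continue a chain at node [i] are the reflections of those that
    arrive there, except for the pair [(i, i)], which has weight [0]. *)
Lemma chain_growth s1 th1 n (i : 'I_N) : 16 * A * h <= e1 ->
  let B n := chain (N := N) g h e s1 th1 n in
  in_mass W (B n) i + e1 / 8 * in_mass W (B n) i - 2 * A * h ^+ 2 <= out_mass W (B n.+1) i \/
  in_mass W (B n) i + e1 / 8 * (row_mass W i - out_mass W (B n.+1) i) - 2 * A * h ^+ 2
    <= out_mass W (B n.+1) i.
Proof.
move=> he B.
have := node_growth ov A0 HA h0 hN N2 i (finset (fun j => B n j i)) he.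
cbv zeta; set O := reflections _ _ _.
have -> : \sum_(j in finset (fun j => B n j i)) weight g h i j = in_mass W (B n) i.
  by apply: eq_bigl => j; rewrite inE.
have -> : \sum_(k in O) weight g h i k = out_mass W (B n.+1) i; last by [].
rewrite (bigID (fun k => k == i))/= big1 ?add0r; last first.
  by move=> k /andP[_ /eqP ->]; rewrite /weight eqxx.
apply: eq_bigl => k; rewrite /O /reflections inE andbC.
congr (_ && _).
by apply: eq_existsb => j; rewrite inE.
Qed.

Lemma chain_mass_gt_half (r : nat) s1 th1 : 0 < e1 <= 1 -> 0 <= s1 < L -> 0 <= th1 <= pi ->
  16 * A * h <= e1 -> 2 * A * h <= e1 ^+ 2 / 32 / 32 -> h <= (4 * K)^-1 ->
  2 * A * h * L * (2 + ka * L / 2) <= ka * L / 8 * mu0 ->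
  8 * r%:R * (2 * A * h * L) <= L / 4 ->
  2 * L <= mu0 * (1 + r%:R * (ka * L / 8)) ^+ 4 ->
  total_mass W / 2 < mass W (chain (N := N) g h e s1 th1 (8 * r)%N).
Proof.
move=> /andP[e10 e11] s1L th1p he1 he2 hK hmu hr hgrow.
have L0 := oval_length_gt0 ov; have hp := h0; have Ap := A1; have kp := k00.
have W0 (i k : 'I_N) : 0 <= weight g h i k by exact: (weight_ge0 ov A0 HA h0 hN N2).
have WC (i k : 'I_N) : weight g h i k = weight g h k i by exact: weightC.
have Wr (i : 'I_N) : \sum_(k < N) weight g h i k <= 2 * h.
  exact: (weight_row_le ov h0 hN N2).
have c01 : 0 <= e1 / 8 <= 1 by lra.
have de0 : 0 <= 2 * A * h ^+ 2 by rewrite !mulr_ge0 ?sqr_ge0//; lra.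
have [mono grow] := mass_growth W0 WC h0 Wr mix c01 de0
  (fun n i => chain_growth s1 th1 n i he1).
have de : #|'I_N|%:R * (2 * A * h ^+ 2) = 2 * A * h * L by rewrite card_ord -hN; ring.
have kaE : e1 / 8 * (k0 * h ^+ 3) / (32 * h ^+ 3) = ka.
  by rewrite /ka; field; rewrite gt_eqF.
rewrite de kaE in mono grow.
have ka0 : 0 < ka by have := mulr_gt0 e10 kp; rewrite /ka; lra.
have W1 : L <= total_mass W.
  rewrite /total_mass -hN mulr_natl -[X in _ *+ X]card_ord -sumr_const; apply: ler_sum => i _.
  exact: (weight_row_ge ov h0 hN i hK).
have W2 : total_mass W <= 2 * L.
  have -> : 2 * L = \sum_(i < N) 2 * h.
    by rewrite sumr_const card_ord -[RHS]mulr_natl -hN; ring.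
  by apply: ler_sum => i _; exact: Wr.
have mu00 : 0 < mu0.
  have ee : 0 < e1 ^+ 2 by rewrite exprn_gt0.
  have A00 : 0 < A by exact: lt_le_trans ltr01 A1.
  by apply: mulr_gt0; [rewrite !divr_gt0|exact: divr_gt0].
have eta0 : 0 <= 2 * A * h * L by rewrite !mulr_ge0// ltW.
have r0 : 0 <= r%:R :> R by [].
have kL : ka * L <= ka * total_mass W by rewrite ler_pM2l.
apply: (@logistic_escape R _ (total_mass W) ka (2 * A * h * L) mu0) mono grow _ _ _ => //.
- lra.
- exact: ltW.
- by move=> n; apply: sumr_ge0 => i _; apply: sumr_ge0.
- by apply: (start_mass ov A1 HA h0 hN N2 _ he2 s1L th1p); rewrite -/e1 e10.
- apply: (@le_trans _ _ (2 * A * h * L * (2 + ka * L / 2))).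
    apply: ler_wpM2l => //.
    have : ka * total_mass W <= ka * (2 * L) by rewrite ler_pM2l.
    by lra.
  apply: (le_trans hmu); rewrite ler_pM2r//; lra.
- lra.
apply: (le_trans W2); apply: (le_trans hgrow); rewrite ler_pM2l//.
have p1 : 0 <= r%:R * (ka * L / 8) by rewrite mulr_ge0// divr_ge0// mulr_ge0// ltW.
have p2 : r%:R * (ka * L / 8) <= r%:R * (ka * total_mass W / 8) by rewrite ler_wpM2l// ler_pM2r// invr_gt0.
by apply: lerXn2r; rewrite ?nnegrE ?lerD2l ?addr_ge0// (le_trans p1 p2).
Qed.

End chain_mass.

(** * Uniform lower bound *)

(** Where the time [1 / e ^+ 2] comes from: the mass starts at order [e ^+ 4] and grows
    at rate [e], and by Bernoulli's inequality [8 * r] steps, two at a time, multiply it by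
    at least [(1 + r * (c * e)) ^+ 4], so that [r * e] has to be of order [1 / e]. *)
Lemma escape_time {R : realType} (a c L : R) : 0 < a -> 0 < c -> 0 < L ->
  exists2 C, 0 < C & forall e r : R, 0 < e -> C / e ^+ 2 <= r ->
    2 * L <= a * e ^+ 4 * (1 + r * (c * e)) ^+ 4.
Proof.
move=> a0 c0 L0; pose z := 1 + 2 * L / a.
have z1 : 1 <= z by rewrite lerDl divr_ge0//; lra.
exists (z / c) => [|e r e0 Hr]; first by rewrite divr_gt0//; lra.
have q : z / e <= 1 + r * (c * e).
  have ce : 0 < c * e by exact: mulr_gt0.
  have : z / c / e ^+ 2 * (c * e) <= r * (c * e) by rewrite ler_pM2r.
  have -> : z / c / e ^+ 2 * (c * e) = z / e by field; rewrite !gt_eqF.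
  by lra.
have ze : 0 <= z / e by apply: divr_ge0; lra.
apply: (@le_trans _ _ (a * e ^+ 4 * (z / e) ^+ 4)); last first.
  apply: ler_wpM2l; first by rewrite mulr_ge0 ?exprn_ge0// ltW.
  by apply: lerXn2r; rewrite ?nnegrE; lra.
have -> : a * e ^+ 4 * (z / e) ^+ 4 = a * z ^+ 4 by field; rewrite gt_eqF.
apply: (@le_trans _ _ (a * z)).
  have -> : a * z = a + 2 * L by rewrite /z; field; rewrite gt_eqF.
  by lra.
by rewrite ler_pM2l// -[leLHS]expr1 ler_weXn2l.
Qed.

Lemma fine_grid {R : realType} (H L : R) : 0 < H -> 0 < L ->
  exists (M : nat) (h : R), [/\ (0 < M)%N, 0 < h <= H & (8 * M)%:R * h = L].
Proof.
move=> H0 L0; have q0 : 0 <= L / (8 * H) by rewrite divr_ge0//; lra.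
have /andP[_] := truncn_itv q0; set M := (Num.truncn _).+1 => MH.
have M0 : 0 < M%:R :> R by exact: le_lt_trans MH.
have M8 : 0 < (8 * M)%:R :> R by rewrite natrM mulr_gt0.
exists M, (L / (8 * M)%:R); split => //.
  rewrite divr_gt0//= ler_pdivrMr//; move: MH.
  by rewrite ltr_pdivrMr ?mulr_gt0// natrM => ?; lra.
by rewrite mulrC divfK// gt_eqF.
Qed.

Section uniform_bound.
Context {R : realType} (L : R) (g : R -> R * R) (K A k0 : R).
Hypothesis ov : oval L g K.
Hypothesis A1 : 1 <= A.
Hypothesis HA : lipschitz_angle L g A.
Hypothesis k00 : 0 < k0.
Hypothesis mix : forall (M : nat) (h : R), (0 < M)%N -> 0 < h -> (8 * M)%:R * h = L ->
  forall a c : 'I_(8 * M), k0 * h ^+ 3 <= \sum_(x < 8 * M) weight g h a x * weight g h c x.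

(** Chains of [8 * r] steps from any two states carry more than half of the mass
    each, so that one of the first and the reverse of one of the second share a chord. *)
Lemma chains_meet (e : R) (r : nat) : 0 < e < pi / 2 -> (0 < r)%N ->
  2 * L <= (32 * 32 * A * 64)^-1 * (e / 2) ^+ 4 * (1 + r%:R * (k0 * L / 32 / 64 * (e / 2))) ^+ 4 ->
  exists (N : nat) (h : R), [/\ 0 < h, N%:R * h = L &
    forall s1 th1 t1 ta, 0 <= s1 < L -> 0 <= th1 <= pi -> 0 <= t1 < L -> 0 <= ta <= pi ->
    exists i k : 'I_N, chain g h e s1 th1 (8 * r) i k && chain g h e t1 ta (8 * r) k i].
Proof.
move=> e_pi r0; have L0 := oval_length_gt0 ov; have K1 := oval_bound_ge1 ov.
have kp := k00; have p2 := @pihalf_02 R.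
move E1 : (e / 2) => e1 growth.
have [e10 e11] : 0 < e1 /\ e1 <= 1 by lra.
have A00 : 0 < A by exact: lt_le_trans ltr01 A1.
have A0 := ltW A00.
have rp : 0 < r%:R :> R by rewrite ltr0n.
pose mu0 := e1 ^+ 2 / 32 / 32 / A * (e1 ^+ 2 / 64); pose ka := e1 / 8 * k0 / 32.
have ee : 0 < e1 ^+ 2 by exact: exprn_gt0.
have mu00 : 0 < mu0 by apply: mulr_gt0; [rewrite !divr_gt0|exact: divr_gt0].
have ka0 : 0 < ka by have := mulr_gt0 e10 kp; rewrite /ka; lra.
have kaL : 0 < ka * L by exact: mulr_gt0.
have AL : 0 < 2 * A * L by rewrite !mulr_gt0.
pose q := 2 * A * L * (2 + ka * L / 2).
have q0 : 0 < q by rewrite /q mulr_gt0// addr_gt0// divr_gt0.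
have rAL : 0 < 8 * r%:R * (2 * A * L) by rewrite !mulr_gt0.
(* every loss is of order [h], so that finitely many upper bounds on [h] absorb them *)
pose H := Num.min (e1 / (16 * A)) (Num.min (e1 ^+ 2 / 32 / 32 / (2 * A))
  (Num.min (4 * K)^-1 (Num.min (ka * L / 8 * mu0 / q) (L / 4 / (8 * r%:R * (2 * A * L)))))).
have H0 : 0 < H.
  have K0 : 0 < K by exact: lt_le_trans ltr01 K1.
  rewrite /H !lt_min invr_gt0; apply/and5P; split.
  - by rewrite divr_gt0// mulr_gt0.
  - by apply: divr_gt0; [rewrite !divr_gt0|rewrite mulr_gt0].
  - by rewrite mulr_gt0.
  - by apply: divr_gt0; [apply: mulr_gt0; [exact: divr_gt0|]|].
  - by apply: divr_gt0; [exact: divr_gt0|].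
have [M [h [M0 /andP[h0 hH] hN]]] := fine_grid H0 L0.
have N2 : (1 < 8 * M)%N by move: M0; clear; lia.
move: hH; rewrite /H !le_min => /and5P[H1 H2 H3 H4 H5].
exists (8 * M)%N, h; split=> // s1 th1 t1 ta s1L th1p t1L tap.
have half s th : 0 <= s < L -> 0 <= th <= pi ->
    total_mass (fun i k : 'I_(8 * M) => weight g h i k) / 2 <
    mass (fun i k : 'I_(8 * M) => weight g h i k) (chain (N := 8 * M) g h e s th (8 * r)%N).
  move=> sL thp; apply: (chain_mass_gt_half ov A1 HA k00 h0 hN N2 (mix M0 h0 hN)) => //;
    rewrite ?E1 -/ka -/mu0.
  - by rewrite e10.
  - by rewrite mulrC -ler_pdivlMr// mulr_gt0.
  - by rewrite mulrC -ler_pdivlMr// mulr_gt0.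
  - have -> : 2 * A * h * L * (2 + ka * L / 2) = h * q by rewrite /q; ring.
    by rewrite -ler_pdivlMr.
  - have -> : 8 * r%:R * (2 * A * h * L) = h * (8 * r%:R * (2 * A * L)) by ring.
    by rewrite -ler_pdivlMr.
  - have -> : mu0 = (32 * 32 * A * 64)^-1 * e1 ^+ 4.
      by rewrite /mu0; field; exact: lt0r_neq0.
    by have -> : ka * L / 8 = k0 * L / 32 / 64 * e1 by rewrite /ka; field.
exact: (masses_meet (fun i k : 'I_(8 * M) => weight_ge0 ov A0 HA h0 hN N2 i k)
  (fun i k : 'I_(8 * M) => weightC g h i k) (half _ _ s1L th1p) (half _ _ t1L tap)).
Qed.

(** The state [y] is reached backwards: reversing time turns a chain that starts at
    [y.1] in the direction [pi - y.2] into one that ends at [y]. *)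
Lemma uniform_density_bound (e : R) (r : nat) : 0 < e < pi / 2 -> (0 < r)%N ->
  2 * L <= (32 * 32 * A * 64)^-1 * (e / 2) ^+ 4 * (1 + r%:R * (k0 * L / 32 / 64 * (e / 2))) ^+ 4 ->
  exists2 b, 0 < b & forall x y, phase L x -> phase L y ->
    (b%:E <= density L g e (16 * r).+4 x y)%E.
Proof.
move=> e_pi r0 /(chains_meet e_pi r0)[N [h [h0 hN meet]]].
have Ap := A1; have A0 : 0 <= A by lra.
have e0 : 0 < e by case/andP: e_pi.
pose d0 := Num.min h (e / 2 / (8 * A)).
have d00 : 0 < d0 by rewrite lt_min h0 divr_gt0//; lra.
have d0h : d0 <= h by rewrite ge_min lexx.
have d0e : d0 <= e / 2 / (8 * A) by rewrite ge_min lexx orbT.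
have d20 : 0 < d0 / 2 by lra.
have [c1 c10 Hc1] := angle_slope_far ov d20.
have [c2 c20 Hc2] := angle_increase_far ov d20.
pose c := Num.min c1 c2.
have c0 : 0 < c by rewrite lt_min c10.
exists ((4 * e ^+ 2)^-1 * c * (c * (d0 / 8) / (2 * e)) ^+ (16 * r).+2).
  have d80 : 0 < d0 / 8 by exact: divr_gt0.
  have ga0 : 0 < c * (d0 / 8) / (2 * e) by rewrite divr_gt0// mulr_gt0.
  by rewrite mulr_gt0 ?exprn_gt0// mulr_gt0// invr_gt0 mulr_gt0// exprn_gt0.
move=> x y px py; have := billiard_map_phase g px.
case E : (billiard_map L g x) => [s1 th1] [/= s1L th1p].
have [y1L y2p] := py.
have [i [k /andP[B1 B2]]] := meet s1 th1 y.1 (pi - y.2) s1L th1p y1L ltac:(lra).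
have [i' [k' [B3 B4]]] := chain_join B1 B2.
have -> : (16 * r = 8 * r + 8 * r)%N by clear; lia.
apply: (chain_start_density ov A0 HA h0 hN e_pi A1 d00 d0h d0e c0 _ _ py E s1L th1p B3 B4).
  by move=> s t st; apply: le_trans (Hc1 s t st); rewrite ge_min lexx.
move=> s t t' st tt' tL; apply: le_trans (Hc2 s t t' st tt' tL).
by apply: ler_wpM2r; [lra|rewrite ge_min lexx orbT].
Qed.

End uniform_bound.

Theorem theorem2 (R : realType) (D : set (R * R)) (L : R) (g : R -> R * R)
    (hD : bounded_strictly_convex_domain D)
    (hg : C2_arclength_boundary D L g)
    (hcurv : forall s : R, curvature g s != 0) :
  exists k : R, 0 < k /\
    forall e : R, 0 < e < pi / 2 ->
      exists b : R, 0 < b /\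
        forall n : nat, 2 + k / e ^+ 2 < n%:R ->
          forall x y : R * R, phase L x -> phase L y ->
            (b%:E < density L g e n x y)%E.
Proof.
have [K ov] := C2_boundary_oval hD hg.
have [A A1 HA] := angle_lipschitz ov.
have A0 : 0 <= A by lra.
have [k0 k00 mix] := grid_mixing ov A0 HA.
have L0 := oval_length_gt0 ov.
have a0 : 0 < (32 * 32 * A * 64)^-1 by rewrite invr_gt0; lra.
have c0 : 0 < k0 * L / 32 / 64 by have := mulr_gt0 k00 L0; lra.
have [C C0 HC] := escape_time a0 c0 L0.
exists (64 * C + 72); split=> [|e /[dup] e_pi /andP[e0 epi]]; first by lra.
have e2 : e <= 2 by have := @pihalf_02 R; lra.
have e12 : 0 < e / 2 by lra.
pose r := (Num.truncn (C / (e / 2) ^+ 2)).+1.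
have q0 : 0 <= C / (e / 2) ^+ 2 by rewrite divr_ge0 ?exprn_ge0// ltW.
have /andP[r1 r2] := truncn_itv q0.
have [b b0 Hb] := uniform_density_bound ov A1 HA k00 mix e_pi (ltn0Sn _ : (0 < r)%N)
  (HC _ _ e12 (ltW r2)).
exists (b / 2); split=> [|n Hn x y px py]; first by lra.
apply: (@lt_le_trans _ _ b%:E); first by rewrite lte_fin; lra.
apply: (density_ge_persists e_pi _ _ (ltW b0) Hb) => //.
rewrite -(ler_nat R) -addn4 natrD natrM -[r]addn1 natrD.
have ee : e ^+ 2 <= 4 by rewrite expr2; nra.
have ei : 1 <= 4 / e ^+ 2 by rewrite ler_pdivlMr ?exprn_gt0// mul1r.
(* [16 * r + 4] is at most [64 * C / e ^+ 2 + 20], and [18 <= 72 / e ^+ 2] *)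
have : (64 * C + 72) / e ^+ 2 = 16 * (C / (e / 2) ^+ 2) + 18 * (4 / e ^+ 2).
  by field; rewrite gt_eqF.
by lra.
Qed.
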